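(* For every integer $n \geq 42$ there exists a planar hypohamiltonian graph of order $n$.
   Context: Graphs are finite and simple. A graph $G$ is hypohamiltonian if it has no Hamiltonian cycle, but $G-v$ has a Hamiltonian cycle for every vertex $v$ of $G$. The order of a graph is its number of vertices. *)

(* Defs.v *)
From mathcomp Require Import all_boot all_order all_algebra.
From mathcomp Require Import all_classical all_reals topology normedtype.

Set Implicit Arguments.
Unset Strict Implicit.
Unset Printing Implicit Defensive.

Import Order.TTheory GRing.Theory Num.Theory.
Import numFieldNormedType.Exports.

Record sgraph := SGraph {
  vertex :> finType;
  edge : rel vertex;
  edge_sym : symmetric edge;
  edge_irrefl : irreflexive edge
}.

Definition edges (G : sgraph) : {set {set G}} :=
  [set A : {set G} |
    [exists x : G, exists y : G, edge x y && (A == [set x; y])]]%SET.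

Section DeleteVertex.
Variables (G : sgraph) (v : G).

Definition del_vertex_type : finType := {x : G | x != v}.

Definition del_vertex_edge : rel del_vertex_type :=
  fun x y => edge (val x) (val y).

Lemma del_vertex_sym : symmetric del_vertex_edge.
Proof. by move=> x y; apply: edge_sym. Qed.

Lemma del_vertex_irrefl : irreflexive del_vertex_edge.
Proof. by move=> x; apply: edge_irrefl. Qed.

Definition del_vertex : sgraph := SGraph del_vertex_sym del_vertex_irrefl.

End DeleteVertex.

(* The bound on the size is needed: for an edge xy, [:: x; y] is a ucycle. *)
Definition hamiltonian_cycle (G : sgraph) (c : seq G) : Prop :=
  [/\ (2 < size c)%N, ucycle (@edge G) c & forall x : G, x \in c].

Definition hamiltonian (G : sgraph) : Prop :=
  exists c : seq G, hamiltonian_cycle c.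

Definition hypohamiltonian (G : sgraph) : Prop :=
  ~ hamiltonian G /\ forall v : G, hamiltonian (del_vertex v).

Local Open Scope ring_scope.
Local Open Scope classical_set_scope.

(* Only the values on [0, 1] matter; by compactness, the image of [0, 1] is
   then homeomorphic to [0, 1]. *)
Definition simple_arc (R : realType) (g : R -> R * R) : Prop :=
  {within `[0, 1], continuous g} /\ {in `[0, 1]%R &, injective g}.

(* Arcs are indexed by the unordered edges, so that each edge is drawn once and
   the direction in which its arc is traversed is free. *)
Record plane_drawing (R : realType) (G : sgraph)
    (pos : G -> R * R) (arc : {set G} -> R -> R * R) : Prop := PlaneDrawing {
  pos_inj : injective pos;
  arc_simple : forall A, A \in edges G -> simple_arc (arc A);
  arc_ends : forall A, A \in edges G ->
    [set arc A 0; arc A 1] = pos @` [set x | x \in A];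
  arc_vertex : forall A, A \in edges G ->
    forall (t : R) (x : G), 0 < t < 1 -> arc A t <> pos x;
  arc_disjoint : forall A B, A \in edges G -> B \in edges G -> A != B ->
    forall s t : R, 0 < s < 1 -> 0 < t < 1 -> arc A s <> arc B t
}.

Definition planar (R : realType) (G : sgraph) : Prop :=
  exists pos arc, @plane_drawing R G pos arc.

(* Main.v *)
(** If a plane hypohamiltonian graph has a face bounded by a 4-cycle [v0 v1 v2 v3]
    of cubic vertices, Thomassen's operation deletes the edges [v0 v1] and [v2 v3]
    and adds a new 4-cycle [w0 w1 w2 w3] together with the edges [vi wi].  A
    Hamiltonian cycle meets the gadget only through its four outgoing edges, hence
    runs through it in one or two paths; by parity and planarity, the pairs of
    terminals that such paths can join are the same before and after the operation.
    So the graph stays hypohamiltonian, gains 4 vertices, and has a new 4-face to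
    which the operation applies again.  With the 4-face as the outer face of a
    straight-line drawing, the new 4-cycles are drawn as larger and larger squares.
    It remains to exhibit suitable graphs of orders 42, 44, 47 and 49, and planar
    hypohamiltonian graphs of orders 43 and 45. *)

From Stdlib Require Import ZArith.
Require Import Defs.
From mathcomp Require Import all_boot all_order all_algebra.
From mathcomp Require Import all_classical all_reals topology normedtype.
From mathcomp Require Import ring lra zify ssrZ.

Set Implicit Arguments.
Unset Strict Implicit.
Unset Printing Implicit Defensive.

(* The gadget, called a ladder, is bipartite and has an even number of vertices, so a single
   spanning path through it joins adjacent corners; two disjoint paths cannot join the two pairs of
   opposite corners, since they would cross. All other patterns occur in every ladder, so
   Hamiltonian cycles can be carried from any ladder to any other: down to the base to show that
   there are none, and up from the base to find those that avoid a given outer vertex. Deleting a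
   vertex of the ladder itself makes the number of vertices odd, so that opposite corners have to be
   joined. This pattern never occurs in the full graph, hence the base must supply separate
   certificates for it: spanning paths of the outer part between opposite attachments. Crossing
   paths are excluded by peeling off layers, so that the Hamiltonicity argument uses no topology.
   Non-Hamiltonicity of the six given graphs has no short certificate and is computed by dynamic
   programming. The orders 42, 44, 47 and 49 represent all residues modulo 4; 43 and 45 are the
   orders that their progressions miss. *)
Local Delimit Scope Z_scope with coqZ.

(** * Walks and linkages *)

Section Walks.
Variable T : eqType.
Implicit Types (e : rel T) (a b c d x y : T) (s p q : seq T) (P O D : pred T).

(** The list contains both ends, so that a covering by disjoint paths becomes a statement about a
    concatenation of lists. *)
Definition walk e a b s :=
  if s is x :: p then [&& x == a, path e a p & last a p == b] else false.

Lemma walk1 e a : walk e a a [:: a].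
Proof. by rewrite /= !eqxx. Qed.

Lemma walk_cat e a b c d p q :
  walk e a b p -> walk e c d q -> e b c -> walk e a d (p ++ q).
Proof.
case: p q => [|x p] [|y q] //= /and3P[/eqP-> pp /eqP lp] /and3P[/eqP-> pq lq] ebc.
by rewrite eqxx cat_path last_cat /= lp ebc pp pq.
Qed.

Lemma walk_ne e a b s : walk e a b s -> s != [::].
Proof. by case: s. Qed.

Lemma walk_head e a b s : walk e a b s -> a \in s.
Proof. by case: s => //= x p /and3P[/eqP-> _ _]; rewrite mem_head. Qed.

Lemma walk_last e a b s : walk e a b s -> b \in s.
Proof. by case: s => //= x p /and3P[/eqP-> _ /eqP<-]; rewrite mem_last. Qed.

Lemma walk_rev e a b s : symmetric e -> walk e a b s -> walk e b a (rev s).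
Proof.
move=> es; case: s => //= x p /and3P[/eqP-> pp /eqP lp].
elim: p a pp lp {x} => [|y p IH] a /=; first by move=> _ ->; rewrite !eqxx.
case/andP=> eay pp lp; have := IH _ pp lp; rewrite [rev (a :: _)]rev_cons.
move=> w; rewrite -cats1; apply: walk_cat w _ _; first exact: walk1.
by rewrite es.
Qed.

Lemma walk_cycle e a b s : walk e a b s -> e b a -> cycle e s.
Proof.
by case: s => //= x p /and3P[/eqP-> pp /eqP lp] eba; rewrite rcons_path pp lp.
Qed.

Lemma walk_sub (e e' : rel T) a b s :
  (forall x y, x \in s -> y \in s -> e x y -> e' x y) ->
  walk e a b s -> walk e' a b s.
Proof.
case: s => //= x p ee' /and3P[/eqP xa pp ->]; rewrite xa eqxx andbT /=.
rewrite xa in ee' => {x xa}.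
elim: p a pp ee' => //= y p IH a /andP[eay pp] ee'.
rewrite ee' ?inE ?eqxx ?orbT //=; apply: IH => // u v iu iv.
by apply: ee'; rewrite inE ?iu ?iv orbT.
Qed.

(** Spanning linkages: one path, or two disjoint paths, covering exactly [D]. These are the traces
    that a Hamiltonian cycle can leave on one side of a cut of four edges. *)
Definition linked1 e D a b := exists s, [/\ walk e a b s, uniq s & s =i D].
Definition linked2 e D a b c d := exists p q,
  [/\ walk e a b p, walk e c d q, uniq (p ++ q) & p ++ q =i D].

Definition ham_on e D := exists s, [/\ 2 < size s, cycle e s, uniq s & s =i D].

Lemma linked1_sym e D a b : symmetric e -> linked1 e D a b -> linked1 e D b a.
Proof.
move=> es [s [w us sD]]; exists (rev s); split; first exact: walk_rev.
  by rewrite rev_uniq.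
by move=> x; rewrite mem_rev.
Qed.

Lemma linked2_swap e D a b c d : linked2 e D a b c d -> linked2 e D c d a b.
Proof.
move=> [p [q [wp wq upq pqD]]]; exists q, p; split=> //; first by rewrite uniq_catC.
by move=> x; rewrite mem_cat orbC -mem_cat.
Qed.

Lemma linked2_revl e D a b c d :
  symmetric e -> linked2 e D a b c d -> linked2 e D b a c d.
Proof.
move=> es [p [q [wp wq upq pqD]]]; exists (rev p), q; split=> //.
- exact: walk_rev.
- move: upq; rewrite !cat_uniq rev_uniq (eq_has (a2 := [in p])) // => x.
  by rewrite /= mem_rev.
by move=> x; rewrite mem_cat mem_rev -mem_cat.
Qed.

Lemma linked2_revr e D a b c d :
  symmetric e -> linked2 e D a b c d -> linked2 e D a b d c.
Proof. by move=> es /linked2_swap/(linked2_revl es)/linked2_swap. Qed.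

(** Cuts a walk at its first exit from [P]. Applied alternately to [P] and its complement, it splits
    a cycle into runs. *)
Lemma walk_run e P a d s : walk e a d s -> P a -> all P s \/
  exists g r b c, [/\ s = g ++ r, walk e a b g, all P g, e b c & ~~ P c /\ walk e c d r].
Proof.
elim: s a => // x s IH a /and3P[/eqP-> pp /eqP ld] Pa.
case: s IH pp ld => [|y s] IH /=; first by left; rewrite Pa.
case/andP=> eay py ld; case Py: (P y); last first.
  right; exists [:: a], (y :: s), a, y; split=> //; first exact: walk1.
  - by rewrite /= Pa.
  - by split; rewrite ?Py //= eqxx py ld eqxx.
have wy : walk e y d (y :: s) by rewrite /= eqxx py ld eqxx.
case: (IH y wy Py) => [aP|[g [r [b [c [Es wg Pg ebc H]]]]]].
  by left; move: aP => /=; rewrite Py Pa.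
rewrite Es.
right; exists (a :: g), r, b, c; split=> //; last by rewrite /= Pa.
exact: (walk_cat (walk1 e a) wg eay).
Qed.

(** A cycle that is rotated to begin where it enters [P] ends outside [P], so that no run wraps
    around. *)
Lemma rot_cycle_start e P s x y : cycle e s -> x \in s -> P x -> y \in s -> ~~ P y ->
  exists r a d, [/\ walk e a d r, e d a, perm_eq r s & P a /\ ~~ P d].
Proof.
move=> cs xs Px ys nPy; have [i c1 E] := rot_to ys.
have cr : cycle e (y :: c1) by rewrite -E rot_cycle.
have : x \in c1.
  have : x \in y :: c1 by rewrite -E mem_rot.
  by rewrite inE => /orP[/eqP xy|//]; rewrite -xy Px in nPy.
move=> xc1; have hp : has P (y :: c1) by apply/hasP; exists x => //; rewrite inE xc1 orbT.
have wy : walk e y (last y c1) (y :: c1).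
  by move: cr; rewrite /= rcons_path eqxx => /andP[-> _] /=.
case: (walk_run (P := predC P) wy nPy) => [|[g [r [b [c [Er wg Pg ebc [Pc wr]]]]]]].
  by rewrite all_predC hp.
have ely : e (last y c1) y by move: cr; rewrite /= rcons_path => /andP[].
exists (r ++ g), c, b; split=> //.
- exact: walk_cat wr wg ely.
- by rewrite perm_catC -Er -E perm_rot.
split; first by move: Pc => /=; rewrite negbK.
by move/allP: Pg => /(_ b (walk_last wg)).
Qed.

(** * Hamiltonian cycles across a cut of four edges *)

Section Ports.
Variables (e : rel T) (P O : pred T) (t u : nat -> T).
Hypothesis es : symmetric e.
Hypothesis PO : forall x, P x -> ~~ O x.
Hypothesis cross : forall x y, P x -> O y -> e x y ->
  exists i, [/\ i < 4, x = t i & y = u i].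

(* Every maximal run of the cycle inside [P] uses two of the four edges leaving [P]. *)
Lemma ham_split : (exists x, P x) -> (exists x, O x) -> (forall x, ~ P =i pred1 x) ->
  ham_on e (predU P O) ->
  (exists i j, [/\ i < 4, j < 4, i != j, linked1 e P (t i) (t j) & linked1 e O (u j) (u i)]) \/
  (exists i j k l, [/\ all (gtn 4) [:: i; j; k; l], uniq [:: i; j; k; l],
     linked2 e P (t i) (t j) (t k) (t l) & linked2 e O (u j) (u k) (u l) (u i)]).
Proof.
move=> [x Px] [y Oy] P1 [s0 [_ cs us sD]].
have {}sD z : (z \in s0) = P z || O z by rewrite sD.
have xs : x \in s0 by rewrite sD Px.
have ys : y \in s0 by rewrite sD Oy orbT.
have nPy : ~~ P y by apply/negP => /PO; rewrite Oy.
have [s [a0 [z0 [ws ezx ps [Pa nPz]]]]] := rot_cycle_start cs xs Px ys nPy.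
have {cs xs ys} us' : uniq s by rewrite (perm_uniq ps).
have {}sD z : (z \in s) = P z || O z by rewrite (perm_mem ps) sD.
have nP z : z \in s -> ~~ P z -> O z by rewrite sD; case: (P z).
have Oz := nP _ (walk_last ws) nPz.
have [ia [ia4 ea0 ez0]] := cross Pa Oz (etrans (es _ _) ezx).
subst a0 z0.
case: (walk_run ws Pa) => [aP|[g1 [r1 [b1 [c1 [Es1 wg1 Pg1 ebc1 [Pc1 wr1]]]]]]].
  by rewrite (allP aP _ (walk_last ws)) in nPz.
have Pb1 := allP Pg1 _ (walk_last wg1).
have Oc1 : O c1 by apply: nP => //; rewrite Es1 mem_cat (walk_head wr1) orbT.
have [ib [ib4 eb0 ec0]] := cross Pb1 Oc1 ebc1.
subst b1 c1.
case: (walk_run (P := predC P) wr1 Pc1) => [aO|[o1 [r2 [b2 [c2 [Es2 wo1 Po1 ebc2 [Pc2 wr2]]]]]]].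
  left; exists ia, ib; split=> //.
  (* A run that leaves through the edge by which it entered is a single vertex; as the only run in
     [P], it would make [P] a singleton. *)
  - apply/eqP => iab; subst ib; apply: (P1 (t ia)) => z.
    have Eg1 : g1 = [:: t ia].
      move: us' wg1; rewrite Es1 cat_uniq => /and3P[+ _ _].
      case: g1 {Es1 Pg1} => // x1 [|x2 g] //=; first by move=> _ /andP[/eqP->].
      move=> /andP[nx1 _] /and3P[/eqP x1t _ /eqP lt].
      by rewrite x1t -lt in nx1; have := mem_last x2 g; rewrite (negbTE nx1).
    apply/idP/idP => [Pz|/eqP->]; last exact: Pa.
    have {}Pz : P z := Pz.
    have : z \in s by rewrite sD Pz.
    rewrite Es1 Eg1 mem_cat inE => /orP[//|/(allP aO)/=]; by rewrite Pz.
  - exists g1; split=> //; first by move: us'; rewrite Es1 cat_uniq => /and3P[].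
    move=> z; apply/idP/idP => [/(allP Pg1)//|Pz].
    have {}Pz : P z := Pz.
    have : z \in s by rewrite sD Pz.
    rewrite Es1 mem_cat => /orP[//|/(allP aO)/=]; by rewrite Pz.
  - exists r1; split=> //; first by move: us'; rewrite Es1 cat_uniq => /and3P[].
    move=> z; apply/idP/idP => [zr|Oz'].
      by apply: nP; [rewrite Es1 mem_cat zr orbT | exact: (allP aO)].
    have {}Oz' : O z := Oz'.
    have : z \in s by rewrite sD Oz' orbT.
    rewrite Es1 mem_cat => /orP[/(allP Pg1)/PO|//]; by rewrite Oz'.
have {}Pc2 : P c2 by move: Pc2 => /=; rewrite negbK.
have Ob2 : O b2.
  apply: nP; last exact: (allP Po1 _ (walk_last wo1)).
  by rewrite Es1 Es2 !mem_cat (walk_last wo1) orbT.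
have [ik [ik4 ec2 eb2]] := cross Pc2 Ob2 (etrans (es _ _) ebc2).
subst b2 c2.
case: (walk_run wr2 Pc2) => [aP|[g2 [r3 [b3 [c3 [Es3 wg2 Pg2 ebc3 [Pc3 wr3]]]]]]].
  by rewrite (allP aP _ (walk_last wr2)) in nPz.
have Pb3 := allP Pg2 _ (walk_last wg2).
have Oc3 : O c3.
  by apply: nP => //; rewrite Es1 Es2 Es3 !mem_cat (walk_head wr3) !orbT.
have [il [il4 eb3 ec3]] := cross Pb3 Oc3 ebc3.
subst b3 c3.
have Es : s = g1 ++ o1 ++ g2 ++ r3 by rewrite Es1 Es2 Es3.
have cat_neq p q x1 x2 : uniq (p ++ q) -> x1 \in p -> x2 \in q -> x1 != x2.
  rewrite cat_uniq => /and3P[_ /hasPn H _] i1 i2.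
  by apply: contraNneq (H _ i2) => <-.
have [u1 u2 u3] : [/\ uniq (g1 ++ g2 ++ r3), uniq (o1 ++ r3) & uniq (g2 ++ r3)].
  split; apply: (subseq_uniq _ us'); rewrite Es.
  - by rewrite cat_subseq // suffix_subseq.
  - rewrite catA; apply: (subseq_trans (cat_subseq (suffix_subseq g1 o1) (suffix_subseq g2 r3))).
    by [].
  - by rewrite catA suffix_subseq.
have nt (k l : nat) : t k != t l -> k != l by apply: contraNneq => ->.
have nu (k l : nat) : u k != u l -> k != l by apply: contraNneq => ->.
(* Indices belonging to different runs in [P] are told apart by their ends in [P]. A run may be a
   single vertex, so its own two indices are told apart by the runs in [O] that they lead to. *)
have ni1 : [/\ t ia != t ik, t ia != t il, t ib != t ik & t ib != t il].
  by split; apply: (cat_neq _ _ _ _ u1);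
    rewrite ?(walk_head wg1) ?(walk_last wg1) // mem_cat ?(walk_head wg2) ?(walk_last wg2).
have ni2 : u ib != u ia.
  apply: (cat_neq _ _ _ _ u2); [exact: walk_head wo1 | exact: walk_last wr3].
have ni3 : u ik != u il.
  apply: (cat_neq _ _ _ _ u2); [exact: walk_last wo1 | exact: walk_head wr3].
have U : uniq [:: ia; ib; ik; il].
  case: ni1 => /nt n1 /nt n2 /nt n3 /nt n4.
  by rewrite /= !inE !negb_or n1 n2 n3 n4 (nu _ _ ni3) eq_sym (nu _ _ ni2).
case: (walk_run (P := predC P) wr3 Pc3) => [aO|[o2 [r4 [b4 [c4 [Es4 wo2 Po2 ebc4 [Pc4 wr4]]]]]]].
  right; exists ia, ib, ik, il; split=> //; first by rewrite /= ia4 ib4 ik4 il4.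
  - exists g1, g2; split=> //.
      by apply: (subseq_uniq _ u1); rewrite catA prefix_subseq.
    move=> z; apply/idP/idP => [|Pz].
      by rewrite mem_cat => /orP[/(allP Pg1)|/(allP Pg2)].
    have {}Pz : P z := Pz.
    have : z \in s by rewrite sD Pz.
    rewrite Es !mem_cat; case/or4P=> [->|/(allP Po1)/=|->|/(allP aO)/=]; by rewrite ?orbT ?Pz.
  - exists o1, r3; split=> //.
    move=> z; apply/idP/idP => [zo|Oz'].
      apply: nP; first by move: zo; rewrite Es !mem_cat => /orP[->|->]; rewrite ?orbT.
      by move: zo; rewrite mem_cat => /orP[/(allP Po1)|/(allP aO)].
    have {}Oz' : O z := Oz'.
    have : z \in s by rewrite sD Oz' orbT.
    rewrite Es !mem_cat; case/or4P=> [/(allP Pg1)/PO|->|/(allP Pg2)/PO|->]; by rewrite ?orbT ?Oz'.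
have {}Pc4 : P c4 by move: Pc4 => /=; rewrite negbK.
have Ob4 : O b4.
  apply: nP; last exact: (allP Po2 _ (walk_last wo2)).
  by rewrite Es Es4 !mem_cat (walk_last wo2) !orbT.
have [im [im4 ec4 eb4]] := cross Pc4 Ob4 (etrans (es _ _) ebc4).
subst b4 c4.
have tr3 : t im \in r3 by rewrite Es4 mem_cat (walk_head wr4) orbT.
have tgr : t im \in g2 ++ r3 by rewrite mem_cat tr3 orbT.
have n1 := nt _ _ (cat_neq _ _ _ _ u1 (walk_head wg1) tgr).
have n2 := nt _ _ (cat_neq _ _ _ _ u1 (walk_last wg1) tgr).
have n3 := nt _ _ (cat_neq _ _ _ _ u3 (walk_head wg2) tr3).
have n4 := nt _ _ (cat_neq _ _ _ _ u3 (walk_last wg2) tr3).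
have : uniq [:: im; ia; ib; ik; il].
  by rewrite cons_uniq U andbT !inE !negb_or ![im == _]eq_sym n1 n2 n3 n4.
(* A third entry into [P] would need a fifth index below 4. *)
move/uniq_leq_size => /(_ (iota 0 4)) H.
suff : 5 <= 4 by []; apply: H => z; rewrite mem_iota add0n !inE.
by do 4![case/orP=> [/eqP->//|]] => /eqP->.
Qed.

Hypothesis tu : forall i, i < 4 -> e (t i) (u i).
Hypothesis t_inj : forall i j, i < 4 -> j < 4 -> t i = t j -> i = j.

(** With [ham_join2], the converse of [ham_split]. Only the indices of the linkages matter for the
    gluing, so one side of the cut can be replaced by another with the same linkages. *)
Lemma ham_join1 i j : i < 4 -> j < 4 -> i != j ->
  linked1 e P (t i) (t j) -> linked1 e O (u j) (u i) -> ham_on e (predU P O).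
Proof.
move=> i4 j4 nij [g [wg ug gP]] [o [wo uo oO]]; exists (g ++ o).
have ugo : uniq (g ++ o).
  rewrite cat_uniq ug uo andbT; apply/hasPn => z; rewrite oO => Oz.
  by apply/negP; rewrite gP => /PO /negP[].
split=> //.
(* The cycle has at least three vertices: the two distinct ports in [P], and one in [O]. *)
- have : uniq [:: t i; t j; u i].
    rewrite /= !inE negb_or.
    have Pi : P (t i) by rewrite -[P _]/(t i \in P) -gP (walk_head wg).
    have Pj : P (t j) by rewrite -[P _]/(t j \in P) -gP (walk_last wg).
    have Oi : O (u i) by rewrite -[O _]/(u i \in O) -oO (walk_last wo).
    have -> : t i != t j by apply: contra_neq nij; apply: t_inj.
    have -> : t i != u i by apply: contraTneq Oi => <-; exact: PO.
    by have -> : t j != u i by apply: contraTneq Oi => <-; exact: PO.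
  move/uniq_leq_size => /(_ (g ++ o)); apply=> z; rewrite !inE mem_cat.
  by case/or3P => /eqP->; rewrite ?(walk_head wg) ?(walk_last wg) ?(walk_last wo) ?orbT.
- by apply: (walk_cycle (walk_cat wg wo (tu j4))); rewrite es tu.
by move=> z; rewrite mem_cat gP oO.
Qed.

Lemma ham_join2 i j k l : all (gtn 4) [:: i; j; k; l] -> uniq [:: i; j; k; l] ->
  linked2 e P (t i) (t j) (t k) (t l) -> linked2 e O (u j) (u k) (u l) (u i) ->
  ham_on e (predU P O).
Proof.
move=> /and5P[/= i4 j4 k4 l4 _] U [g [g' [wg wg' ug gP]]] [o [o' [wo wo' uo oO]]].
have ugo : uniq ((g ++ g') ++ (o ++ o')).
  rewrite cat_uniq ug uo andbT; apply/hasPn => z; rewrite oO => Oz.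
  by apply/negP; rewrite gP => /PO /negP[].
have pm : perm_eq (g ++ o ++ g' ++ o') ((g ++ g') ++ (o ++ o')).
  by rewrite -!catA perm_cat2l !catA perm_cat2r perm_catC.
exists (g ++ o ++ g' ++ o'); split.
- rewrite !size_cat (@leq_trans (1 + (1 + (1 + 1)))) //.
  by rewrite !leq_add // lt0n size_eq0; apply/walk_ne; eassumption.
- apply: (@walk_cycle e (t i) (u i)); last by rewrite es; exact: tu.
  apply: (walk_cat wg _ (tu j4)); apply: (walk_cat wo); last by rewrite es; exact: tu.
  exact: (walk_cat wg' wo' (tu l4)).
- by rewrite (perm_uniq pm).
by move=> z; rewrite (perm_mem pm) mem_cat gP oO.
Qed.

End Ports.
End Walks.

Lemma walk_map (T T' : eqType) (f : T -> T') (e : rel T) (e' : rel T') a b s :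
  injective f -> (forall x y, e' (f x) (f y) = e x y) ->
  walk e' (f a) (f b) (map f s) = walk e a b s.
Proof.
move=> fI fe; case: s => //= x s; rewrite (inj_eq fI) path_map last_map (inj_eq fI).
by congr [&& _, _ & _]; apply: eq_path => y z /=; rewrite fe.
Qed.

(** * Ladders *)

Definition adj (E : seq (nat * nat)) : rel nat :=
  fun x y => ((x, y) \in E) || ((y, x) \in E).

Lemma adj_sym E : symmetric (adj E).
Proof. by move=> x y; rewrite /adj orbC. Qed.

Definition shift m (E : seq (nat * nat)) := [seq (m + xy.1, m + xy.2) | xy <- E].

(* [d] iterations of Thomassen's operation on a 4-cycle.  Layer [i] consists of the
   vertices [4 * i], ..., [4 * i + 3]; only the last layer is a full 4-cycle, and
   layer 0 is attached to the rest of the graph. *)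
Fixpoint ladder d : seq (nat * nat) :=
  if d is d'.+1 then
    [:: (1, 2); (3, 0); (0, 4); (1, 5); (2, 6); (3, 7)] ++ shift 4 (ladder d')
  else [:: (0, 1); (1, 2); (2, 3); (3, 0)].

Lemma mem_shift m E x y : ((m + x, m + y) \in shift m E) = ((x, y) \in E).
Proof.
apply/mapP/idP => [[[x' y'] i /= [/addnI-> /addnI->]] //|i].
by exists (x, y).
Qed.

Lemma adj_shift m E x y : adj (shift m E) (m + x) (m + y) = adj E x y.
Proof. by rewrite /adj !mem_shift. Qed.

Lemma adj_cat E F x y : adj (E ++ F) x y = adj E x y || adj F x y.
Proof. by rewrite /adj !mem_cat orbACA. Qed.

Lemma shift_ge m E x y : adj (shift m E) x y -> (m <= x) && (m <= y).
Proof. by rewrite /adj => /orP[] /mapP[[x' y'] _ [-> ->]]; rewrite !leq_addr. Qed.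

Lemma walk_shift m E a b s :
  walk (adj (shift m E)) (m + a) (m + b) (map (addn m) s) = walk (adj E) a b s.
Proof. exact: (walk_map _ _ _ (@addnI m) (adj_shift m E)). Qed.

Lemma walk_catr E F a b s : walk (adj F) a b s -> walk (adj (E ++ F)) a b s.
Proof. by apply: walk_sub => x y _ _; rewrite adj_cat orbC => ->. Qed.

Lemma walk_ladderS d a b s : walk (adj (ladder d)) a b s ->
  walk (adj (ladder d.+1)) (4 + a) (4 + b) (map (addn 4) s).
Proof. by move=> w; apply: walk_catr; rewrite walk_shift. Qed.

Definition layers d : pred nat := gtn (4 * d.+1).

(** Layer plus position in the layer gives a 2-colouring: an edge changes either the layer by one or
    the position by one modulo 4. *)
Lemma ladder_parity d x y : adj (ladder d) x y -> odd (x %/ 4 + x %% 4) != odd (y %/ 4 + y %% 4).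
Proof.
have H : forall x y, (x, y) \in ladder d -> odd (x %/ 4 + x %% 4) != odd (y %/ 4 + y %% 4).
  elim: d {x y} => [|d IH] x y; first by rewrite !inE => /or4P[] /eqP[-> ->].
  rewrite mem_cat => /orP[|/mapP[[x' y'] /IH /= b [-> ->]]]; last first.
    by rewrite !divnDl // !modnDl !addSn /= (inj_eq negb_inj).
  by rewrite !inE; do 5?[case/orP]; move=> /eqP[-> ->].
by rewrite /adj => /orP[/H|/H]; rewrite // eq_sym.
Qed.

Lemma walk_parity (T : eqType) (e : rel T) (f : T -> bool) a b s :
  (forall x y, e x y -> f x != f y) -> walk e a b s -> odd (size s) = (f a == f b).
Proof.
move=> ef; case: s => // x p /and3P[/eqP-> pp /eqP<-] {x b} /=.
elim: p a pp => [|y p IH] a /=; first by rewrite eqxx.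
case/andP=> /ef fay /IH ->.
by case: (f a) fay; case: (f y); case: (f (last y p)).
Qed.

Lemma size_layers d (s : seq nat) : uniq s -> s =i layers d -> size s = 4 * d.+1.
Proof.
move=> us sD; rewrite -[RHS](size_iota 0); apply/perm_size/uniq_perm => //.
  exact: iota_uniq.
by move=> x; rewrite sD mem_iota.
Qed.

(** A spanning path has an even number of vertices, so its ends have opposite colours; among the
    corners of layer 0 these are the adjacent ones. *)
Lemma ladder_linked1 d a b : a < 4 -> b < 4 ->
  linked1 (adj (ladder d)) (layers d) a b -> odd (a + b).
Proof.
move=> a4 b4 [s [w us sD]].
have := walk_parity (@ladder_parity d) w.
rewrite (size_layers us sD) oddM /= !divn_small // !modn_small // !add0n oddD.
by case: (odd a) (odd b) => [] [].
Qed.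

(* Planarity of the ladder, in the form of an induction step: a walk joining opposite
   corners of layer 0 that avoids the other two corners contains a walk joining the
   corresponding corners of layer 1. *)
Lemma ladder_peel d a b s : a < 4 -> b < 4 -> ~~ odd (a + b) ->
  walk (adj (ladder d.+1)) a b s -> uniq s ->
  (forall x, x < 4 -> x \in s -> (x == a) || (x == b)) -> a != b ->
  exists s', [/\ walk (adj (ladder d)) a b s', uniq s' & {subset map (addn 4) s' <= s}].
Proof.
move=> a4 b4 oab; case: s => // x s /and3P[/eqP-> {x} pp lb].
case/lastP: s pp lb => [|s y]; first by move=> _ /eqP /= ->; rewrite eqxx.
rewrite last_rcons => pp /eqP yb us H nab; rewrite {y}yb in pp us H *.
move: pp; rewrite rcons_path => /andP[pp elb].
(* The interior avoids layer 0: [a] and [b] occur only at the ends, and the other two corners are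
   excluded by hypothesis. *)
have s4 x : x \in s -> 4 <= x.
  move=> xs; case: (ltnP x 4) => // x4.
  have := H x x4; rewrite inE mem_rcons inE xs !orbT => /(_ isT).
  by move: us; rewrite /= mem_rcons rcons_uniq => /and3P[n1 n2 _] /orP[] /eqP xE;
    move: n1 n2; rewrite -xE ?inE xs ?orbT.
have adj1 x y : x < 4 -> 4 <= y -> adj (ladder d.+1) x y -> y = 4 + x.
  move=> x4 y4; rewrite /ladder -/ladder adj_cat => /orP[|/shift_ge]; last lia.
  rewrite /adj !inE; do 11?[case/orP]; move=> /eqP[]; clear -x4 y4; lia.
(* Opposite corners are not adjacent, so the interior is not empty. *)
have adj0 : ~~ adj (ladder d.+1) a b.
  apply/negP; rewrite /ladder -/ladder adj_cat => /orP[|/shift_ge]; last lia.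
  rewrite /adj !inE; do 11?[case/orP]; move=> /eqP[]; clear -oab a4 b4; lia.
have {}us : uniq s by move: us; rewrite cons_uniq rcons_uniq => /and3P[].
case: s pp elb s4 us {H} => [|z s]; first by rewrite /= (negbTE adj0).
case/andP=> eaz pz elb s4 us; rewrite /= in elb.
have zE : z = 4 + a by apply: adj1 => //; rewrite s4 ?mem_head.
have lE : last z s = 4 + b.
  by apply: adj1; rewrite 1?adj_sym // s4 ?mem_last.
have mE : z :: s = map (addn 4) (map (subn^~ 4) (z :: s)).
  by rewrite -map_comp map_id_in // => w /s4 /=; lia.
exists (map (subn^~ 4) (z :: s)); split.
- rewrite -(walk_shift 4) -mE.
  apply: (@walk_sub _ (adj (ladder d.+1))) => [x y /s4 x4 /s4 y4|].
    rewrite /ladder -/ladder adj_cat => /orP[|//].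
    rewrite /adj !inE; do 11?[case/orP]; move=> /eqP[]; clear -x4 y4; lia.
  by apply/and3P; split; rewrite -?zE ?lE.
- by rewrite -(map_inj_uniq (@addnI 4)) -mE.
- by rewrite -mE => w wzs; rewrite inE mem_rcons inE wzs !orbT.
Qed.

(** Peeling carries the two paths to the last layer. There the ladder is a 4-cycle, and the path
    from 0 has 1 or 3 as its second vertex, which is an end of the other path. *)
Lemma ladder_no_crossing d p q : walk (adj (ladder d)) 0 2 p -> walk (adj (ladder d)) 1 3 q ->
  uniq (p ++ q) -> False.
Proof.
elim: d p q => [|d IH] p q wp wq; rewrite cat_uniq => /and3P[up /hasPn pq uq].
  case: p wp up pq => [|x [|y p]] //; first by case/and3P=> /eqP->.
  case/and3P=> /eqP-> /= /andP[e0y _] _ _ pq.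
  have /orP[/eqP y1|/eqP y3] : (y == 1) || (y == 3) by case: y e0y {pq} => [|[|[|[|y]]]].
    by have := pq _ (walk_head wq); rewrite y1 !inE.
  by have := pq _ (walk_last wq); rewrite y3 !inE.
have pn x : x \in p -> x \in q -> False by move=> xp /pq /negP.
have [p' [wp' up' sp']] : exists p', [/\ walk (adj (ladder d)) 0 2 p', uniq p' & {subset map (addn 4) p' <= p}].
  apply: ladder_peel => //; case=> [|[|[|[|]]]] // _ H.
    by case: (pn 1 H (walk_head wq)).
  by case: (pn 3 H (walk_last wq)).
have [q' [wq' uq' sq']] : exists q', [/\ walk (adj (ladder d)) 1 3 q', uniq q' & {subset map (addn 4) q' <= q}].
  apply: ladder_peel => //; case=> [|[|[|[|]]]] // _ H.
    by case: (pn 0 (walk_head wp) H).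
  by case: (pn 2 (walk_last wp) H).
apply: (IH p' q') => //; rewrite cat_uniq up' uq' andbT; apply/hasPn => x xq.
by apply/negP => xp; apply: (pn (4 + x)); [apply: sp' | apply: sq']; apply: map_f.
Qed.

(** For four distinct corners an even [i + j] means that the pairs are those of opposite corners.
    The eight ways to write this reduce to one by reversing and exchanging the paths. *)
Lemma ladder_linked2 d i j k l : all (gtn 4) [:: i; j; k; l] -> uniq [:: i; j; k; l] ->
  linked2 (adj (ladder d)) (layers d) i j k l -> odd (i + j).
Proof.
move=> lt4 U; apply: contraPT => oij.
have es := adj_sym (ladder d).
have N1 : ~ linked2 (adj (ladder d)) (layers d) 0 2 1 3.
  by move=> [p [q [wp wq upq _]]]; exact: ladder_no_crossing wp wq upq.
have N2 : ~ linked2 (adj (ladder d)) (layers d) 0 2 3 1 by move/(linked2_revr es).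
have N3 : ~ linked2 (adj (ladder d)) (layers d) 2 0 1 3 by move/(linked2_revl es).
have N4 : ~ linked2 (adj (ladder d)) (layers d) 2 0 3 1 by move/(linked2_revl es).
have [N5 N6 N7 N8] : [/\ ~ linked2 (adj (ladder d)) (layers d) 1 3 0 2,
   ~ linked2 (adj (ladder d)) (layers d) 3 1 0 2,
   ~ linked2 (adj (ladder d)) (layers d) 1 3 2 0 &
   ~ linked2 (adj (ladder d)) (layers d) 3 1 2 0] by split=> /linked2_swap.
move: lt4 U oij.
by case: i => [|[|[|[|//]]]]; case: j => [|[|[|[|//]]]] //; case: k => [|[|[|[|//]]]] //;
   case: l => [|[|[|[|//]]]].
Qed.

(** * Construction of the spanning linkages of a ladder *)

Lemma walk_push (T : eqType) (e : rel T) a b c s :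
  e a b -> walk e b c s -> walk e a c (a :: s).
Proof. by move=> eab w; apply: (walk_cat (walk1 e a) w eab). Qed.

Lemma walk_rcons (T : eqType) (e : rel T) a b c s :
  walk e a b s -> e b c -> walk e a c (rcons s c).
Proof. by move=> w ebc; rewrite -cats1; apply: (walk_cat w (walk1 e c) ebc). Qed.

Lemma ladder_edge d x y :
  adj [:: (1, 2); (3, 0); (0, 4); (1, 5); (2, 6); (3, 7)] x y -> adj (ladder d.+1) x y.
Proof. by rewrite /ladder -/ladder adj_cat => ->. Qed.

(** A path of the larger ladder mixes corners of layer 0 with pieces of paths one layer further. Its
    covering property does not depend on their order: it only has to be a rearrangement of the two
    lists. *)
Lemma cover_shift (c s l : seq nat) (D : pred nat) :
  uniq c -> all (gtn 4) c -> uniq s -> s =i D ->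
  perm_eq l (c ++ map (addn 4) s) ->
  uniq l /\ (forall x, x \in l = if x < 4 then x \in c else D (x - 4)).
Proof.
move=> uc c4 us sD pl; split.
  rewrite (perm_uniq pl) cat_uniq uc (map_inj_uniq (@addnI 4)) us andbT.
  by apply/hasPn => x /mapP[y _ ->]; apply/negP => /(allP c4) /=; lia.
move=> x; rewrite (perm_mem pl) mem_cat; case: ltnP => x4.
  by case: mapP => [[y _ E]|]; rewrite ?orbF //; lia.
have -> : (x \in c) = false by apply/negP => /(allP c4) /=; lia.
have -> : (x \in map (addn 4) s) = (4 + (x - 4) \in map (addn 4) s) by rewrite subnKC.
by rewrite /= (mem_map (@addnI 4)) sD.
Qed.

Definition full_links d :=
  [/\ linked1 (adj (ladder d)) (layers d) 0 1, linked1 (adj (ladder d)) (layers d) 1 2,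
      linked1 (adj (ladder d)) (layers d) 2 3, linked1 (adj (ladder d)) (layers d) 3 0 &
      linked2 (adj (ladder d)) (layers d) 0 1 2 3 /\ linked2 (adj (ladder d)) (layers d) 1 2 3 0].

Lemma linked1_shift d (c s l : seq nat) (D D' : pred nat) a b :
  uniq c -> all (gtn 4) c -> uniq s -> s =i D ->
  perm_eq l (c ++ map (addn 4) s) -> (forall x, D' x = if x < 4 then x \in c else D (x - 4)) ->
  walk (adj (ladder d.+1)) a b l -> linked1 (adj (ladder d.+1)) D' a b.
Proof.
move=> uc c4 us sD pl DD w; have [ul lD] := cover_shift uc c4 us sD pl.
by exists l; split=> // x; rewrite lD [RHS]DD.
Qed.

Lemma layersS d x : layers d.+1 x = if x < 4 then x \in iota 0 4 else layers d (x - 4).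
Proof. by rewrite mem_iota /layers /=; case: ifP => ? /=; lia. Qed.

Lemma linked2_shift d (p q p' q' : seq nat) i j k l :
  uniq (p ++ q) -> p ++ q =i layers d ->
  perm_eq (p' ++ q') (iota 0 4 ++ map (addn 4) (p ++ q)) ->
  walk (adj (ladder d.+1)) i j p' -> walk (adj (ladder d.+1)) k l q' ->
  linked2 (adj (ladder d.+1)) (layers d.+1) i j k l.
Proof.
move=> us sD pl wp wq; have [ul lD] := cover_shift (iota_uniq 0 4) isT us sD pl.
by exists p', q'; split=> // x; rewrite lD [RHS]layersS.
Qed.

(** Two arrangements of the same pieces are permutations of each other because every predicate has
    the same count on both. *)
Ltac perm_count := apply/permP => f; rewrite /= -?cats1 ?map_cat ?count_cat ?count_rev
  /= ?count_cat ?count_rev /=; ring.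

(** The six linkages need a simultaneous induction, because layer 0 lacks the edges [(0, 1)] and
    [(2, 3)]. A spanning path from 0 to 1 runs along [(3, 0)] and [(1, 2)] and takes one path from
    the next ladder; one from 1 to 2 visits the next ladder twice and takes a pair of paths. *)
Lemma ladder_full d : full_links d.
Proof.
elim: d => [|d [L01 L12 L23 L30 [L0123 L1230]]].
  split; last split.
  - by exists [:: 0; 3; 2; 1]; split=> // -[|[|[|[|x]]]].
  - by exists [:: 1; 0; 3; 2]; split=> // -[|[|[|[|x]]]].
  - by exists [:: 2; 1; 0; 3]; split=> // -[|[|[|[|x]]]].
  - by exists [:: 3; 2; 1; 0]; split=> // -[|[|[|[|x]]]].
  - by exists [:: 0; 1], [:: 2; 3]; split=> // -[|[|[|[|x]]]].
  - by exists [:: 1; 2], [:: 3; 0]; split=> // -[|[|[|[|x]]]].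
have es := adj_sym (ladder d).
have {L01} L10 := linked1_sym es L01; have {L23} L32 := linked1_sym es L23.
have L1032 := linked2_revl es (linked2_revr es L0123).
have edge x y := @ladder_edge d x y.
split; last split.
- have [s [w us sD]] := L32; have {}w := walk_ladderS w.
  apply: (linked1_shift (c := iota 0 4) (l := 0 :: 3 :: rcons (rcons (map (addn 4) s) 2) 1) _ _ us sD) => //.
  + perm_count.
  + exact: layersS.
  apply: (@walk_push _ _ _ 3); first exact: edge.
  apply: (walk_push (edge 3 7 isT)); apply: walk_rcons (edge 2 1 isT).
  exact: walk_rcons w (edge 6 2 isT).
- have [p [q [wp wq us sD]]] := L1032; have {}wp := walk_ladderS wp; have {}wq := walk_ladderS wq.
  apply: (linked1_shift (c := iota 0 4) (l := 1 :: rcons (map (addn 4) p) 0 ++ 3 :: rcons (map (addn 4) q) 2) _ _ us sD) => //.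
  + perm_count.
  + exact: layersS.
  rewrite -cat_cons; apply: walk_cat (edge 0 3 isT).
    by apply: (walk_push (edge 1 5 isT)); apply: walk_rcons wp (edge 4 0 isT).
  by apply: (walk_push (edge 3 7 isT)); apply: walk_rcons wq (edge 6 2 isT).
- have [s [w us sD]] := L10; have {}w := walk_ladderS w.
  apply: (linked1_shift (c := iota 0 4) (l := 2 :: 1 :: rcons (rcons (map (addn 4) s) 0) 3) _ _ us sD) => //.
  + perm_count.
  + exact: layersS.
  apply: (@walk_push _ _ _ 1); first exact: edge.
  apply: (walk_push (edge 1 5 isT)); apply: walk_rcons (edge 0 3 isT).
  exact: walk_rcons w (edge 4 0 isT).
- have [p [q [wp wq us sD]]] := linked2_swap L1032; have {}wp := walk_ladderS wp; have {}wq := walk_ladderS wq.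
  apply: (linked1_shift (c := iota 0 4) (l := 3 :: rcons (map (addn 4) p) 2 ++ 1 :: rcons (map (addn 4) q) 0) _ _ us sD) => //.
  + perm_count.
  + exact: layersS.
  rewrite -cat_cons; apply: walk_cat (edge 2 1 isT).
    by apply: (walk_push (edge 3 7 isT)); apply: walk_rcons wp (edge 6 2 isT).
  by apply: (walk_push (edge 1 5 isT)); apply: walk_rcons wq (edge 4 0 isT).
- have [p [q [wp wq us sD]]] := L0123; have {}wp := walk_ladderS wp; have {}wq := walk_ladderS wq.
  apply: (linked2_shift (p' := 0 :: rcons (map (addn 4) p) 1) (q' := 2 :: rcons (map (addn 4) q) 3) us sD).
  + perm_count.
  + by apply: (walk_push (edge 0 4 isT)); apply: walk_rcons wp (edge 5 1 isT).
  by apply: (walk_push (edge 2 6 isT)); apply: walk_rcons wq (edge 7 3 isT).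
- have [p [q [wp wq us sD]]] := L1230; have {}wp := walk_ladderS wp; have {}wq := walk_ladderS wq.
  apply: (linked2_shift (p' := 1 :: rcons (map (addn 4) p) 2) (q' := 3 :: rcons (map (addn 4) q) 0) us sD).
  + perm_count.
  + by apply: (walk_push (edge 1 5 isT)); apply: walk_rcons wp (edge 6 2 isT).
  by apply: (walk_push (edge 3 7 isT)); apply: walk_rcons wq (edge 4 0 isT).
Qed.

Lemma ladder_linked1_full d i j : i < 4 -> j < 4 -> odd (i + j) ->
  linked1 (adj (ladder d)) (layers d) i j.
Proof.
have es := adj_sym (ladder d).
have [L01 L12 L23 L30 _] := ladder_full d.
have L10 := linked1_sym es L01; have L21 := linked1_sym es L12.
have L32 := linked1_sym es L23; have L03 := linked1_sym es L30.
by case: i => [|[|[|[|//]]]] _; case: j => [|[|[|[|//]]]].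
Qed.

Lemma ladder_linked2_full d i j k l : all (gtn 4) [:: i; j; k; l] -> uniq [:: i; j; k; l] ->
  odd (i + j) -> linked2 (adj (ladder d)) (layers d) i j k l.
Proof.
move=> lt4 U oij; have es := adj_sym (ladder d).
have [_ _ _ _ [L L']] := ladder_full d.
have Ll := linked2_revl es L; have Lr := linked2_revr es L; have Llr := linked2_revr es Ll.
have Ll' := linked2_revl es L'; have Lr' := linked2_revr es L'; have Llr' := linked2_revr es Ll'.
move: lt4 U oij.
by case: i => [|[|[|[|//]]]]; case: j => [|[|[|[|//]]]] //; case: k => [|[|[|[|//]]]] //;
   case: l => [|[|[|[|//]]]] // _ _ _ //; apply: linked2_swap.
Qed.

Definition layers_but d w : pred nat := fun x => (x != w) && layers d x.

Lemma layers_butS d w x : layers_but d.+1 (4 + w) x = if x < 4 then x \in iota 0 4 else layers_but d w (x - 4).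
Proof. by rewrite /layers_but layersS; case: ltnP => x4; [rewrite mem_iota | congr andb]; lia. Qed.

Lemma layers_but0 d w x : w < 4 ->
  layers_but d.+1 w x = if x < 4 then x \in rem w (iota 0 4) else layers d (x - 4).
Proof.
move=> w4; rewrite /layers_but layersS mem_rem_uniq ?iota_uniq // inE.
by case: ltnP => // x4; have -> : x != w by lia.
Qed.

(** The number of remaining vertices is odd, so a spanning path has both ends in the colour class
    that is now larger: its ends are opposite corners, and the colour of [w] decides which. Adding a
    layer in front exchanges the two pairs, since each corner has the other colour than its copy in
    the next layer. *)
Lemma ladder_but d w : w < 4 * d.+1 ->
  linked1 (adj (ladder d)) (layers_but d w) 0 2 \/ linked1 (adj (ladder d)) (layers_but d w) 1 3.
Proof.
elim: d w => [|d IH] w.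
  case: w => [|[|[|[|]]]] // _.
  - by right; exists [:: 1; 2; 3]; split=> // -[|[|[|[|x]]]].
  - by left; exists [:: 0; 3; 2]; split=> // -[|[|[|[|x]]]].
  - by right; exists [:: 1; 0; 3]; split=> // -[|[|[|[|x]]]].
  - by left; exists [:: 0; 1; 2]; split=> // -[|[|[|[|x]]]].
have edge x y := @ladder_edge d x y; have es := adj_sym (ladder d).
have [[s01 [w01 us01 sD01]] _ [s23 [w23 us23 sD23]] _ _] := ladder_full d.
have {}w01 := walk_ladderS w01; have w10 := walk_rev (adj_sym _) w01.
have {}w23 := walk_ladderS w23; have w32 := walk_rev (adj_sym _) w23.
(* If a corner of layer 0 is missing, one spanning path between adjacent corners of the next ladder
   is enough. *)
case: (ltnP w 4) => [w4 _|w4 wd].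
  have D' x := layers_but0 d x w4.
  case: w w4 D' => [|[|[|[|]]]] // _ D'.
  - right; apply: (linked1_shift (l := 1 :: 2 :: rcons (map (addn 4) s23) 3) _ _ us23 sD23 _ D') => //.
      perm_count.
    by apply: (walk_push (edge 1 2 isT)); apply: (walk_push (edge 2 6 isT)); apply: walk_rcons (edge 7 3 isT).
  - left; apply: (linked1_shift (l := 0 :: 3 :: rcons (rev (map (addn 4) s23)) 2) _ _ us23 sD23 _ D') => //.
      perm_count.
    by apply: (walk_push (edge 0 3 isT)); apply: (walk_push (edge 3 7 isT)); apply: walk_rcons (edge 6 2 isT).
  - right; apply: (linked1_shift (l := 1 :: rcons (rcons (rev (map (addn 4) s01)) 0) 3) _ _ us01 sD01 _ D') => //.
      perm_count.
    by apply: (walk_push (edge 1 5 isT)); apply: walk_rcons (edge 0 3 isT); apply: walk_rcons (edge 4 0 isT).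
  - left; apply: (linked1_shift (l := 0 :: rcons (rcons (map (addn 4) s01) 1) 2) _ _ us01 sD01 _ D') => //.
      perm_count.
    by apply: (walk_push (edge 0 4 isT)); apply: walk_rcons (edge 1 2 isT); apply: walk_rcons (edge 5 1 isT).
have -> : w = 4 + (w - 4) by lia.
have D' x := layers_butS d (w - 4) x.
have /IH[[s [ws us sD]]|[s [ws us sD]]] : w - 4 < 4 * d.+1 by lia.
- have {}ws := walk_rev (adj_sym _) (walk_ladderS ws).
  right; apply: (linked1_shift (l := 1 :: 2 :: rcons (rcons (rev (map (addn 4) s)) 0) 3) _ _ us sD _ D') => //.
    perm_count.
  apply: (walk_push (edge 1 2 isT)); apply: (walk_push (edge 2 6 isT)).
  by apply: walk_rcons (edge 0 3 isT); apply: walk_rcons (edge 4 0 isT).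
- have {}ws := walk_rev (adj_sym _) (walk_ladderS ws).
  left; apply: (linked1_shift (l := 0 :: 3 :: rcons (rcons (rev (map (addn 4) s)) 1) 2) _ _ us sD _ D') => //.
    perm_count.
  apply: (walk_push (edge 0 3 isT)); apply: (walk_push (edge 3 7 isT)).
  by apply: walk_rcons (edge 1 2 isT); apply: walk_rcons (edge 5 1 isT).
Qed.

(** * Excluding Hamiltonian cycles by vertex elimination *)

Notation pairs := (seq (nat * nat)).

Definition upair x y : nat * nat := if x < y then (x, y) else (y, x).

Lemma upairC x y : upair x y = upair y x.
Proof. by rewrite /upair; case: ltngtP => // ->. Qed.

Lemma upair_inj x y x' y' : upair x y = upair x' y' ->
  (x == x') && (y == y') || (x == y') && (y == x').
Proof. by rewrite /upair; do 2!case: ifP => _; case=> -> ->; rewrite !eqxx ?orbT. Qed.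

Lemma upair_eq v x y : (upair v x == upair v y) = (x == y).
Proof.
apply/eqP/eqP => [/upair_inj/orP[/andP[_ /eqP]//|/andP[/eqP-> /eqP->]]//|-> //].
Qed.

(** Sorting gives every set of virtual edges a single representation, so that [undup] merges equal
    states. *)
Fixpoint insert_pair (q : nat * nat) (M : pairs) : pairs :=
  if M is r :: M' then
    if (q.1 < r.1) || (q.1 == r.1) && (q.2 <= r.2) then q :: M else r :: insert_pair q M'
  else [:: q].

Lemma perm_insert_pair q M : perm_eq (insert_pair q M) (q :: M).
Proof.
elim: M => //= r M IH; case: ifP => // _.
by rewrite (perm_trans (_ : perm_eq _ (r :: q :: M))) ?perm_cons // (perm_catCA [:: r] [:: q] M).
Qed.

Definition mates v (M : pairs) : seq nat :=
  [seq (if q.1 == v then q.2 else q.1) | q <- M & (q.1 == v) || (q.2 == v)].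

(** The candidates for the two neighbours of the removed vertex on the cycle: all its virtual edges,
    whose other ends are [m], must be used, and graph edges make up the rest. Three virtual edges at
    a vertex are a dead end. *)
Definition splices (N m : seq nat) : pairs :=
  match m with
  | [::] => [seq (x, y) | x <- N, y <- [seq y <- N | x < y]]
  | [:: x] => [seq (x, y) | y <- N]
  | [:: x; y] => [:: (x, y)]
  | _ => [::]
  end.

(* Removing [v] from a cyclic sequence makes its two neighbours consecutive.  The
   list [M] records the consecutive pairs created in this way ("virtual edges"), which
   the cycle must use; [N] lists the remaining neighbours of [v] in the graph. *)
Definition eliminate v (N : seq nat) (M : pairs) : seq pairs :=
  let M0 := [seq q <- M | (q.1 != v) && (q.2 != v)] in
  [seq insert_pair (upair q.1 q.2) M0
     | q <- splices N (mates v M) & (q.1 != q.2) && (upair q.1 q.2 \notin M0)].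

Definition nbrs (E : pairs) v : seq nat :=
  [seq q.2 | q <- E & q.1 == v] ++ [seq q.1 | q <- E & q.2 == v].

(** Dynamic programming over all reachable sets of virtual edges. It stops at three vertices, since
    then the cycle can only be the triangle; shorter lists yield [false], the safe answer. *)
Fixpoint no_cycle (E : pairs) (vs : seq nat) (Ms : seq pairs) : bool :=
  match vs with
  | [:: x; y; z] =>
    all (fun M => ~~ all (fun q => adj E q.1 q.2 || (upair q.1 q.2 \in M)) [:: (x, y); (y, z); (z, x)]) Ms
  | v :: rest =>
    let N := [seq x <- nbrs E v | x \in rest] in
    no_cycle E rest (undup (flatten [seq eliminate v N M | M <- Ms]))
  | [::] => false
  end.

Definition ppairs (x : nat) (l : seq nat) : pairs := pairmap pair x l.
Definition cpairs (c : seq nat) : pairs := if c is x :: l then ppairs x (rcons l x) else [::].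

Lemma ppairs_rcons x l y : ppairs x (rcons l y) = rcons (ppairs x l) (last x l, y).
Proof. by elim: l x => //= z l IH x; rewrite IH. Qed.

Lemma cpairs_cons2 v s l : cpairs (v :: s :: l) = (v, s) :: rcons (ppairs s l) (last s l, v).
Proof. by rewrite /= ppairs_rcons. Qed.

Lemma cpairs_cons s l : cpairs (s :: l) = rcons (ppairs s l) (last s l, s).
Proof. by rewrite /= ppairs_rcons. Qed.

Lemma perm_cpairs_rot i c : perm_eq (cpairs (rot i c)) (cpairs c).
Proof.
elim: i => [|i IH]; first by rewrite rot0.
case: (ltnP i (size c)) => ic; last by rewrite rot_oversize // leqW.
rewrite -addn1 rotD; last by rewrite addn1.
rewrite rot_rot; apply: perm_trans IH.
case: (rot i c) => [|x [|y l]] //.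
by rewrite rot1_cons rcons_cons /= !ppairs_rcons last_rcons perm_rcons.
Qed.

Lemma ppairs_mem x l q : q \in ppairs x l -> (q.1 \in x :: l) && (q.2 \in l).
Proof.
elim: l x => //= y l IH x; rewrite inE => /orP[/eqP->|/IH /andP[i1 i2]].
  by rewrite /= !inE !eqxx.
by rewrite [q.1 \in _]inE i1 orbT inE i2 orbT.
Qed.

(** The invariant of the elimination. The last clause, that every virtual edge is a step of the
    cycle, limits the virtual edges at a vertex to those leading to its two neighbours. *)
Definition threaded (E : pairs) (M : pairs) (c : seq nat) : Prop :=
  [/\ uniq M, (forall q, q \in cpairs c -> adj E q.1 q.2 || (upair q.1 q.2 \in M)) &
      forall q, q \in M -> exists2 r, r \in cpairs c & q = upair r.1 r.2].

Lemma mem_upair v x y : (((upair x y).1 == v) || ((upair x y).2 == v)) = (x == v) || (y == v).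
Proof. by rewrite /upair; case: ifP => _ //=; rewrite orbC. Qed.

Lemma threaded_rot E M i c : threaded E M c -> threaded E M (rot i c).
Proof.
move=> [uM H1 H2]; split=> // q.
  by rewrite (perm_mem (perm_cpairs_rot i c)) => /H1.
by move/H2 => [r rc ->]; exists r; rewrite ?(perm_mem (perm_cpairs_rot i c)).
Qed.

Lemma mem_nbrs E v x : (x \in nbrs E v) = adj E v x.
Proof.
rewrite /nbrs /adj mem_cat; congr orb; apply/mapP/idP => [[[a b]]|i].
- by rewrite mem_filter /= => /andP[/eqP-> i] ->.
- by exists (v, x); rewrite ?mem_filter /= ?eqxx.
- by rewrite mem_filter /= => /andP[/eqP-> i] ->.
by exists (x, v); rewrite ?mem_filter /= ?eqxx.
Qed.

(** A virtual edge at [v] is a step of the cycle, hence leads to the successor [s] or to the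
    predecessor [last s l]. *)
Lemma threaded_mates E M v s l : uniq (v :: s :: l) -> l != [::] ->
  threaded E M (v :: s :: l) ->
  perm_eq (mates v M) ([seq x <- [:: s; last s l] | upair v x \in M]).
Proof.
move=> /and3P[vsl sl ul] l0 [uM _ H2].
have pl : last s l \in l by case: l l0 {vsl sl ul H2} => //= z l _; rewrite mem_last.
have sp : s != last s l by apply: contraNneq sl => ->.
have vs : v != s by apply: contraNneq vsl => ->; rewrite mem_head.
have -> : [seq x <- [:: s; last s l] | upair v x \in M] =
   [seq (if q.1 == v then q.2 else q.1) | q <- [seq upair v x | x <- [:: s; last s l]] & q \in M].
  have g x : v != x -> (if (upair v x).1 == v then (upair v x).2 else (upair v x).1) = x.
    by rewrite /upair => vx; case: (v < x); rewrite /= ?eqxx // eq_sym (negbTE vx).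
  have vp : v != last s l by apply: contraNneq vsl => ->; rewrite inE pl orbT.
  by rewrite /=; do 2!case: ifP => _ /=; rewrite ?g.
apply: perm_map; apply: uniq_perm; first exact: filter_uniq.
  by rewrite filter_uniq //= inE upair_eq sp.
move=> q; rewrite !mem_filter andbC; case qM: (q \in M) => //=.
have [r] := H2 q qM; rewrite cpairs_cons2 inE mem_rcons inE => rc ->.
rewrite mem_upair !inE; case/or3P: rc => [/eqP->|/eqP->|/ppairs_mem /andP[i1 i2]] /=.
- by rewrite !eqxx.
- by rewrite eqxx orbT (upairC _ v) eqxx orbT.
have v1 : r.1 != v by apply: contraNneq vsl => <-.
have v2 : r.2 != v by apply: contraNneq vsl => <-; rewrite inE i2 orbT.
rewrite (negbTE v1) (negbTE v2); symmetry; apply/negbTE; rewrite negb_or.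
by apply/andP; split; apply/eqP => /upair_inj; rewrite (negbTE v1) (negbTE v2) !andbF.
Qed.

Lemma perm2 (T : eqType) (m : seq T) x y : perm_eq m [:: x; y] -> m = [:: x; y] \/ m = [:: y; x].
Proof.
move=> pm; have := perm_size pm; case: m pm => [|a [|b []]] // pm _.
have := perm_mem pm a; rewrite !inE eqxx /= => /esym/orP[]/eqP E; subst a.
  by move: pm; rewrite perm_cons => /perm_small_eq -> //; left.
move: pm; rewrite (perm_sym _ [:: x; y]) -[[:: x; y]]/([:: x] ++ [:: y]) perm_catC perm_cons.
by move/perm_small_eq => <- //; right.
Qed.

Lemma uniq_last_eq (T : eqType) (z : T) l : last z l = z -> uniq (z :: l) -> l = [::].
Proof.
case: l => // a l lz /andP[/negP[]].
by have := mem_last a l; rewrite -[last a l]/(last z (a :: l)) lz.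
Qed.

Lemma threaded_eliminate E M v rest c :
  uniq c -> c =i v :: rest -> v \notin rest -> 3 < size c -> threaded E M c ->
  exists c' M', [/\ uniq c', c' =i rest, threaded E M' c' &
    M' \in eliminate v [seq x <- nbrs E v | x \in rest] M].
Proof.
move=> uc cD vr sc tc.
have vc : v \in c by rewrite cD mem_head.
have [i c1 Ec] := rot_to vc.
have {}tc : threaded E M (v :: c1) by rewrite -Ec; apply: threaded_rot.
have {}uc : uniq (v :: c1) by rewrite -Ec rot_uniq.
have {}sc : 3 < size (v :: c1) by rewrite -Ec size_rot.
have {}cD : c1 =i rest.
  move=> x; have := cD x; rewrite -(mem_rot i) Ec !inE; case: eqP => //= -> _.
  by rewrite (negbTE vr); apply/negbTE; case/andP: uc.
case: c1 {Ec vc} uc sc cD tc => [|s [|z l]] // uc sc cD tc.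
have pm := threaded_mates uc isT tc.
move: tc pm uc sc cD; set l1 := z :: l; set p := last s l1 => tc pm uc sc cD.
have pl : p \in l1 by rewrite /p /= mem_last.
have [vsl sl ul] := and3P uc.
have sp : s != p by apply: contraNneq sl => ->.
have vs : v != s by apply: contraNneq vsl => ->; rewrite mem_head.
have vp : v != p by apply: contraNneq vsl => ->; rewrite inE pl orbT.
case: tc => uM H1 H2; rewrite cpairs_cons2 in H1 H2.
have pp_nv r : r \in ppairs s l1 -> (r.1 != v) && (r.2 != v).
  move/ppairs_mem => /andP[i1 i2]; apply/andP; split; apply: contraNneq vsl => <- //.
  by rewrite inE i2 orbT.
set M0 := [seq q <- M | (q.1 != v) && (q.2 != v)].
set N := [seq x <- nbrs E v | x \in rest].
have inN x : x \in s :: l1 -> adj E v x -> x \in N by rewrite mem_filter mem_nbrs -cD => -> ->.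
have sN : upair v s \notin M -> s \in N.
  move=> nM; apply: inN; first exact: mem_head.
  by have := H1 (v, s); rewrite inE eqxx /= (negbTE nM) orbF; apply.
have pN : upair v p \notin M -> p \in N.
  move=> nM; apply: inN; first by rewrite inE pl orbT.
  by have := H1 (p, v); rewrite inE mem_rcons mem_head orbT /= upairC (negbTE nM) orbF adj_sym; apply.
(* The four cases tell which of the two steps at [v] are virtual; the others are edges of the graph.
   The order of the pair is lost, since [M] is sorted without regard to the cycle. *)
have [q qS qE] : exists2 q, q \in splices N (mates v M) & q = (s, p) \/ q = (p, s).
  move: pm => /=; case: ifP => sM; case: ifP => pM.
  - by case/perm2 => ->; [exists (s, p) | exists (p, s)]; rewrite /= ?mem_head; auto.
  - move/perm_small_eq => -> //; exists (s, p); last by left.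
    by rewrite /= map_f // pN // pM.
  - move/perm_small_eq => -> //; exists (p, s); last by right.
    by rewrite /= map_f // sN // sM.
  move/perm_small_eq => -> //=.
  have {}sN : s \in N by apply: sN; rewrite sM.
  have {}pN : p \in N by apply: pN; rewrite pM.
  case: (ltngtP s p) sp => // lt _; [exists (s, p) | exists (p, s)]; auto.
    by apply/allpairsPdep; exists s, p; split=> //; rewrite mem_filter lt pN.
  by apply/allpairsPdep; exists p, s; split=> //; rewrite mem_filter lt sN.
have qU : upair q.1 q.2 = upair s p by case: qE => -> //=; rewrite upairC.
have qn : q.1 != q.2 by case: qE => -> //=; rewrite eq_sym.
(* Otherwise [s] and [p] would already be consecutive, and the cycle would be a triangle with [v],
   against its length. *)
have nM0 : upair s p \notin M0.
  rewrite mem_filter; apply/negP => /andP[_ /H2[r]].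
  rewrite inE mem_rcons inE => rc /esym/upair_inj.
  case/or3P: rc => [/eqP->|/eqP->|rl] /=.
  - by rewrite (negbTE vs) (negbTE vp).
  - by rewrite (negbTE vs) (negbTE vp) !andbF.
  case/orP => /andP[/eqP r1 /eqP r2].
    move: rl; rewrite /l1 /= inE => /orP[/eqP rE|].
      move: r2; rewrite rE /= /p /= => zE.
      by move: sc; rewrite /l1 (uniq_last_eq (esym zE) ul).
    by move/ppairs_mem => /andP[]; rewrite r1 (negbTE sl).
  by move/ppairs_mem: rl => /andP[_]; rewrite r2 (negbTE sl).
exists (s :: l1), (insert_pair (upair s p) M0); split=> //.
- by case/andP: uc.
- have pI := perm_insert_pair (upair s p) M0; split.
  + by rewrite (perm_uniq pI) /= nM0 filter_uniq.
  + move=> r; rewrite cpairs_cons mem_rcons inE (perm_mem pI) => /orP[/eqP->|rl] /=.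
      by rewrite -/p upairC mem_head orbT.
    have := H1 r; rewrite inE mem_rcons inE rl !orbT => /(_ isT) /orP[->//|rM].
    have := pp_nv r rl; rewrite inE mem_filter rM andbT -!negb_or mem_upair => ->.
    by rewrite !orbT.
  move=> r; rewrite (perm_mem pI) inE mem_filter => /orP[/eqP->|].
    by exists (p, s); rewrite ?cpairs_cons ?mem_rcons ?mem_head //= upairC.
  rewrite -negb_or => /andP[rv /H2[r']]; rewrite inE mem_rcons inE => rc rE.
  exists r' => //; rewrite cpairs_cons mem_rcons inE.
  move: rv; rewrite rE mem_upair; case/or3P: rc => [/eqP->|/eqP->|->] /=.
  + by rewrite eqxx.
  + by rewrite eqxx orbT.
  by rewrite orbT.
apply/mapP; exists q; last by rewrite qU.
by rewrite mem_filter qn qU nM0 qS.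
Qed.

Lemma no_cycleP E vs Ms M c : uniq vs -> no_cycle E vs Ms -> M \in Ms ->
  uniq c -> c =i vs -> threaded E M c -> False.
Proof.
elim: vs Ms M c => [//|v rest IH] Ms M c uvs.
have [vr ur] := andP uvs.
case: (ltnP 2 (size rest)) => sr H MM uc cD tc; have sc := perm_size (uniq_perm uc uvs cD).
  have {}sc : 3 < size c by rewrite sc.
  have [c' [M' [uc' cD' tc' M'e]]] := threaded_eliminate uc cD vr sc tc.
  apply: (IH (undup (flatten [seq eliminate v [seq x <- nbrs E v | x \in rest] M | M <- Ms])) M' c') => //.
    by case: rest sr H {IH vr ur uvs cD cD' M'e sc} => [|? [|? [|? ?]]].
  by rewrite mem_undup; apply/flatten_mapP; exists M.
case: rest sr ur {IH} H cD sc vr uvs => [|x [|y []]] // _ _ H cD sc _ uvs.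
have {H} /allPn[q qi /negP[]] := allP (H : all (fun M => ~~ all (fun q => adj E q.1 q.2 || (upair q.1 q.2 \in M))
  [:: (v, x); (x, y); (y, v)]) Ms) M MM.
case: tc => _ H1 _.
case: c sc uc cD H1 => [|a [|b [|d []]]] // _ uc cD H1.
have in3 z : z \in [:: a; b; d] -> (z == a) || (z == b) || (z == d) by rewrite !inE orbA.
have ne : q.1 != q.2.
  move: uvs; rewrite /= !inE negb_or => /and3P[/andP[vx vy] xy _].
  by move: qi; rewrite !inE => /or3P[] /eqP-> //=; rewrite eq_sym.
have q1 : q.1 \in [:: a; b; d] by rewrite cD; move: qi; rewrite !inE => /or3P[] /eqP-> /=; rewrite eqxx ?orbT.
have q2 : q.2 \in [:: a; b; d] by rewrite cD; move: qi; rewrite !inE => /or3P[] /eqP-> /=; rewrite eqxx ?orbT.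
(* On a cycle of three vertices any two are consecutive, in one direction or the other. *)
have [qc|qc] : q \in cpairs [:: a; b; d] \/ (q.2, q.1) \in cpairs [:: a; b; d].
  case: q q1 q2 ne {qi} => q1 q2 /= /in3 + /in3.
  rewrite !inE => /orP[/orP[]|] /eqP-> /orP[/orP[]|] /eqP->; rewrite ?eqxx ?orbT //; auto.
- exact: H1.
by have := H1 _ qc; rewrite /= adj_sym upairC.
Qed.

(** * Towers over a plane graph *)

Definition loopless (E : seq (nat * nat)) := all (fun q => q.1 != q.2) E.

Lemma loopless_adj E x : loopless E -> adj E x x = false.
Proof.
by move=> /allP lE; apply/negbTE; rewrite /adj orbb; apply/negP => /lE /=; rewrite eqxx.
Qed.

Section ListGraph.
Variables (n : nat) (E : seq (nat * nat)) (lE : loopless E).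

Definition list_edge : rel 'I_n := fun x y => adj E (val x) (val y).

Lemma list_edge_sym : symmetric list_edge.
Proof. by move=> x y; rewrite /list_edge adj_sym. Qed.

Lemma list_edge_irrefl : irreflexive list_edge.
Proof. by move=> x; apply: loopless_adj. Qed.

Definition list_graph : sgraph := SGraph list_edge_sym list_edge_irrefl.

End ListGraph.

Lemma ham_on_ext (T : eqType) (e : rel T) (D D' : pred T) :
  D =i D' -> ham_on e D -> ham_on e D'.
Proof. by move=> DD [s [? ? ? sD]]; exists s; split=> // x; rewrite sD. Qed.

Lemma cycle_map (T T' : Type) (f : T -> T') (e : rel T') c :
  cycle e (map f c) = cycle (relpre f e) c.
Proof. by case: c => //= x c; rewrite -map_rcons path_map. Qed.

Lemma seq_lift (T T' : eqType) (f : T -> T') s :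
  (forall x, x \in s -> exists y, f y = x) -> exists c, map f c = s.
Proof.
elim: s => [|x s IH] H; first by exists [::].
have [y fy] := H x (mem_head _ _).
have [|c <-] := IH; first by move=> z zs; apply: H; rewrite inE zs orbT.
by exists (y :: c); rewrite /= fy.
Qed.

(** The map [f] identifies the vertices of [G] with [D]. This treats a graph and its vertex-deleted
    subgraphs, which live on a subtype, as subsets of the same type. *)
Lemma ham_on_hamiltonian (G : sgraph) (T : eqType) (f : G -> T) (e : rel T) (D : pred T) :
  injective f -> (forall x y, edge x y = e (f x) (f y)) ->
  (forall x, D (f x)) -> (forall z, D z -> exists x, f x = z) ->
  ham_on e D <-> hamiltonian G.
Proof.
move=> fI fe fD Df; split.
  move=> [s [ss cs us sD]].
  have [c cE] : exists c, map f c = s by apply: seq_lift => x; rewrite sD; apply: Df.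
  exists c; split; first by rewrite -(size_map f) cE.
    apply/andP; split; last by rewrite -(map_inj_uniq fI) cE.
    by move: cs; rewrite -cE cycle_map; congr is_true; apply: eq_cycle => x y /=; rewrite fe.
  by move=> x; rewrite -(mem_map fI) cE sD; apply: fD.
move=> [c [sc /andP[cc uc] call]]; exists (map f c); split.
- by rewrite size_map.
- by rewrite cycle_map; move: cc; congr is_true; apply: eq_cycle => x y /=; rewrite fe.
- by rewrite (map_inj_uniq fI).
move=> z; apply/mapP/idP => [[x _ ->]|/Df[x <-]]; first exact: fD.
by exists x.
Qed.

Lemma list_graph_hypohamiltonian n E (lE : loopless E) :
  ~ ham_on (adj E) (gtn n) -> (forall v, v < n -> ham_on (adj E) (fun x => (x != v) && (x < n))) ->
  hypohamiltonian (list_graph n lE).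
Proof.
move=> nh hv; split.
  move/(ham_on_hamiltonian (f := fun x : list_graph n lE => nat_of_ord x) (e := adj E) (D := gtn n)) => H.
  apply/nh/H => // [x y /val_inj //|x|z zn]; first exact: ltn_ord.
  by exists (Ordinal zn).
move=> v.
have /(ham_on_hamiltonian (G := del_vertex v) (f := fun x : del_vertex v => nat_of_ord (val x : 'I_n))) := hv v (ltn_ord v).
apply=> //.
- by move=> x y /val_inj/val_inj.
- by move=> x; apply/andP; split; [by have := valP x | exact: ltn_ord].
move=> z /andP[zv zn]; have zv' : (Ordinal zn : list_graph n lE) != v by [].
by exists (Sub (Ordinal zn : list_graph n lE) zv').
Qed.

Section LinkedMap.
Variables (T T' : eqType) (f : T -> T') (e : rel T) (e' : rel T') (D : pred T) (D' : pred T').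
Hypothesis fI : injective f.
Hypothesis fe : forall x y, e' (f x) (f y) = e x y.
Hypothesis fD : forall x, D' (f x) = D x.
Hypothesis Df : forall z, D' z -> exists x, f x = z.

Lemma map_cover s : s =i D <-> map f s =i D'.
Proof.
split=> sD x; last by rewrite -(mem_map fI) sD [LHS]fD.
apply/mapP/idP => [[y ys ->]|D'x]; first by rewrite sD in ys; rewrite [_ \in _]fD.
by have [y yx] := Df D'x; exists y; rewrite // sD; move: D'x; rewrite -yx [_ \in _]fD.
Qed.

Lemma linked1_map a b : linked1 e' D' (f a) (f b) <-> linked1 e D a b.
Proof.
split=> [[s [w us sD]]|[s [w us sD]]]; last first.
  by exists (map f s); split; [rewrite (walk_map _ _ _ fI fe) | rewrite map_inj_uniq | apply/map_cover].
have [c cs] : exists c, map f c = s by apply: seq_lift => x; rewrite sD; apply: Df.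
subst s; exists c; split; last exact/map_cover.
  by rewrite -(walk_map _ _ _ fI fe).
by rewrite -(map_inj_uniq fI).
Qed.

Lemma linked2_map i j k l : linked2 e' D' (f i) (f j) (f k) (f l) <-> linked2 e D i j k l.
Proof.
split=> [[p [q [wp wq us sD]]]|[p [q [wp wq us sD]]]]; last first.
  exists (map f p), (map f q); rewrite !(walk_map _ _ _ fI fe) -map_cat map_inj_uniq //.
  by split=> //; apply/map_cover.
have [c cs] : exists c, map f c = p.
  by apply: seq_lift => x xp; apply: Df; rewrite -[D' x]/(x \in D') -sD mem_cat xp.
have [c' cs'] : exists c', map f c' = q.
  by apply: seq_lift => x xp; apply: Df; rewrite -[D' x]/(x \in D') -sD mem_cat xp orbT.
subst p q; exists c, c'; rewrite -!(walk_map _ _ _ fI fe) -(map_inj_uniq fI) map_cat.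
by split=> //; apply/map_cover; rewrite map_cat.
Qed.

End LinkedMap.

Section Tower.
Variables (m : nat) (K : seq (nat * nat)) (us : seq nat).
Hypothesis K_lt : all (fun q => (q.1 < m) && (q.2 < m)) K.
Hypothesis us_lt : all (gtn m) us.
Hypothesis us_size : size us = 4.

Let u i := nth 0 us i.

(* The vertices below [m] are those outside the quadrilateral, and [m], ..., [m + 3]
   are the corners of the quadrilateral, with outer neighbours [us]. *)
Definition feet := [seq (nth 0 us i, m + i) | i <- iota 0 4].
Definition tower d := K ++ feet ++ shift m (ladder d).

Let u_lt i : i < 4 -> u i < m.
Proof. by move=> i4; apply: (allP us_lt); rewrite mem_nth ?us_size. Qed.

Lemma adj_K_lt x y : adj K x y -> (x < m) && (y < m).
Proof. by rewrite /adj => /orP[] /(allP K_lt) //=; rewrite andbC. Qed.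

Lemma adj_feet x y : adj feet x y -> exists2 i, i < 4 & (x = u i /\ y = m + i) \/ (y = u i /\ x = m + i).
Proof.
by rewrite /adj => /orP[] /mapP[i]; rewrite mem_iota => i4 [-> ->]; exists i => //; [left|right].
Qed.

Lemma tower_base d x y : x < m -> y < m -> adj (tower d) x y = adj K x y.
Proof.
move=> xm ym; rewrite !adj_cat.
case E: (adj feet x y); first by have [i _ [] [] ? ?] := adj_feet E; lia.
by case F: (adj (shift _ _) _ _); [have := shift_ge F; lia | rewrite !orbF].
Qed.

Lemma tower_ladder d x y : adj (tower d) (m + x) (m + y) = adj (ladder d) x y.
Proof.
rewrite !adj_cat adj_shift.
case E: (adj K _ _); first by have := adj_K_lt E; lia.
case F: (adj feet _ _) => //=.
by have [i /u_lt ui [] [] ? ?] := adj_feet F; lia.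
Qed.

Lemma tower_cross d x y : m <= x -> y < m -> adj (tower d) x y ->
  exists i, [/\ i < 4, x = m + i & y = u i].
Proof.
move=> xm ym; rewrite !adj_cat => /or3P[/adj_K_lt|/adj_feet[i i4]|/shift_ge]; try lia.
by case=> [[xE yE]|[yE xE]]; [have := u_lt i4; lia | exists i].
Qed.

Lemma tower_foot d i : i < 4 -> adj (tower d) (m + i) (u i).
Proof.
move=> i4; rewrite !adj_cat; apply/or3P/Or32; rewrite adj_sym /adj; apply/orP; left.
by apply/mapP; exists i; rewrite ?mem_iota.
Qed.

Definition above (D : pred nat) : pred nat := fun x => (m <= x) && D (x - m).

Let aboveE D x : above D (m + x) = D x.
Proof. by rewrite /above leq_addr addKn. Qed.

Let above_ex D z : above D z -> exists x, m + x = z.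
Proof. by case/andP=> mz _; exists (z - m); rewrite subnKC. Qed.

Lemma linked1_above d D a b :
  linked1 (adj (tower d)) (above D) (m + a) (m + b) <-> linked1 (adj (ladder d)) D a b.
Proof.
exact: (linked1_map (@addnI m) (tower_ladder d) (aboveE D) (@above_ex D)).
Qed.

Lemma linked2_above d D i j k l :
  linked2 (adj (tower d)) (above D) (m + i) (m + j) (m + k) (m + l) <->
  linked2 (adj (ladder d)) D i j k l.
Proof.
exact: (linked2_map (@addnI m) (tower_ladder d) (aboveE D) (@above_ex D)).
Qed.

Section Outside.
Variable O : pred nat.
Hypothesis O_lt : forall x, O x -> x < m.

(** Below [m] the edges of a tower do not depend on its ladder. *)
Let sub_tower d d' s a b : {subset s <= O} ->
  walk (adj (tower d)) a b s -> walk (adj (tower d')) a b s.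
Proof. by move=> sO; apply: walk_sub => x y /sO/O_lt xm /sO/O_lt ym; rewrite !tower_base. Qed.

Lemma linked1_outside d d' a b :
  linked1 (adj (tower d)) O a b -> linked1 (adj (tower d')) O a b.
Proof.
by move=> [s [w us' sO]]; exists s; split=> //; apply: sub_tower w => x; rewrite sO.
Qed.

Lemma linked2_outside d d' i j k l :
  linked2 (adj (tower d)) O i j k l -> linked2 (adj (tower d')) O i j k l.
Proof.
move=> [p [q [wp wq us' sO]]]; exists p, q; split=> //.
  by apply: sub_tower wp => x xp; rewrite -sO mem_cat xp.
by apply: sub_tower wq => x xq; rewrite -sO mem_cat xq orbT.
Qed.

Lemma above_O D x : above D x -> ~~ O x.
Proof. by case/andP=> mx _; apply/negP => /O_lt; lia. Qed.

Let cross d D x y : above D x -> O y -> adj (tower d) x y ->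
  exists i, [/\ i < 4, x = m + i & y = u i].
Proof. by case/andP=> mx _ /O_lt ym; apply: tower_cross. Qed.

(* Every way in which a Hamiltonian cycle can run through one ladder is available in
   every other ladder. *)
Lemma ham_tower d d' : (exists x, O x) ->
  ham_on (adj (tower d)) (predU (above (layers d)) O) ->
  ham_on (adj (tower d')) (predU (above (layers d')) O).
Proof.
move=> Oex; have tI i j : i < 4 -> j < 4 -> m + i = m + j -> i = j by move=> _ _ /addnI.
case/(ham_split (adj_sym _) (@above_O (layers d)) (@cross d (layers d)) _ Oex).
- by exists m; rewrite -[m]addn0 aboveE.
- move=> x H.
  have xE k : k < 2 -> m + k = x.
    move=> k2; apply/eqP; rewrite -[_ == _]/(_ \in pred1 x) -H -[_ \in _]/(above _ _) aboveE /layers /=.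
    by lia.
  by have := xE 0 isT; rewrite -(xE 1 isT) => /addnI.
- move=> [i [j [i4 j4 nij /linked1_above L L']]].
  apply: (ham_join1 (adj_sym _) (@above_O (layers d')) (tower_foot d') tI i4 j4 nij).
    by apply/linked1_above/ladder_linked1_full => //; apply: ladder_linked1 L.
  exact: linked1_outside L'.
move=> [i [j [k [l [lt4 U /linked2_above L L']]]]].
apply: (ham_join2 (adj_sym _) (@above_O (layers d')) (tower_foot d') lt4 U).
  by apply/linked2_above/ladder_linked2_full => //; apply: ladder_linked2 L.
exact: linked2_outside L'.
Qed.

End Outside.

Hypothesis m_gt1 : 1 < m.
Hypothesis base_nonham : ~ ham_on (adj (tower 0)) (gtn (m + 4)).
Hypothesis base_but : forall v, v < m ->
  ham_on (adj (tower 0)) (fun x => (x != v) && (x < m + 4)).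
(** These two paths through the outer part close up the paths between opposite corners that
    [ladder_but] provides. *)
Hypothesis base_link02 : linked1 (adj K) (gtn m) (u 0) (u 2).
Hypothesis base_link13 : linked1 (adj K) (gtn m) (u 1) (u 3).

Let base_link d i j : linked1 (adj K) (gtn m) i j -> linked1 (adj (tower d)) (gtn m) i j.
Proof.
move=> [s [w us' sm]]; exists s; split=> //; apply: walk_sub w => x y.
by rewrite !sm => xm ym; rewrite tower_base.
Qed.

(** By [ham_tower], a Hamiltonian cycle of the tower would descend to the base, and the cycles of
    the base that miss an outer vertex lift to the tower. A missing ladder vertex is the one case
    where the linkage pattern changes. *)
Lemma tower_hypohamiltonian d (lE : loopless (tower d)) :
  hypohamiltonian (list_graph (m + 4 * d.+1) lE).
Proof.
have D0 (O : pred nat) e x : (forall x, O x -> x < m) ->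
    (x \in predU (above (layers e)) O) = ((m <= x) && (x < m + 4 * e.+1)) || O x.
  by move=> Om; rewrite -[LHS]/(above _ _ || _) /above /layers /=; congr orb; lia.
have Om v x : (x != v) && (x < m) -> x < m by case/andP.
apply: list_graph_hypohamiltonian => [H|v vn].
  apply: base_nonham; have H' : ham_on (adj (tower d)) (predU (above (layers d)) (gtn m)).
    apply: ham_on_ext H => x; rewrite D0 // -[LHS]/(x < _) /=; lia.
  have := ham_tower (O := gtn m) (fun x => id) 0 (ex_intro _ 0 (ltnW m_gt1)) H'.
  by apply: ham_on_ext => x; rewrite D0 // -[RHS]/(x < _) /=; lia.
case: (ltnP v m) => vm.
  have H' : ham_on (adj (tower 0)) (predU (above (layers 0)) (fun x => (x != v) && (x < m))).
    apply: ham_on_ext (base_but vm) => x; rewrite D0; last exact: Om.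
    by rewrite -[LHS]/((x != v) && (x < _)); lia.
  (* The outer part keeps a vertex after the removal of [v], because it has at least two. *)
  have Oex : exists x, (x != v) && (x < m).
    by case: (v =P 0) => [->|/eqP v0]; [exists 1 | exists 0]; rewrite ?[0 == v]eq_sym ?v0 //= ltnW.
  have := ham_tower (@Om v) d Oex H'.
  apply: ham_on_ext => x; rewrite D0; last exact: Om.
  by rewrite -[RHS]/((x != v) && (x < _)); lia.
have vE : v = m + (v - m) by rewrite subnKC.
have vd : v - m < 4 * d.+1 by lia.
have nO : forall x, above (layers_but d (v - m)) x -> ~~ (gtn m) x by apply: above_O.
have tI i j : i < 4 -> j < 4 -> m + i = m + j -> i = j by move=> _ _ /addnI.
have H : ham_on (adj (tower d)) (predU (above (layers_but d (v - m))) (gtn m)).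
  have es := adj_sym (tower d).
  case: (ladder_but vd) => /linked1_above L.
    apply: (ham_join1 es nO (tower_foot d) tI (i := 0) (j := 2)) => //.
    exact/(linked1_sym es)/base_link.
  apply: (ham_join1 es nO (tower_foot d) tI (i := 1) (j := 3)) => //.
  exact/(linked1_sym es)/base_link.
apply: ham_on_ext H => x; rewrite -[LHS]/(above _ x || (x < m)) -[RHS]/((x != v) && (x < _)).
by rewrite /above /layers_but /layers /=; lia.
Qed.

End Tower.

Import Order.TTheory GRing.Theory Num.Theory.
Import numFieldNormedType.Exports.

(** * Straight-line drawings *)

Definition affine (l : Z * Z * Z) (p : Z * Z) : Z := (l.1.1 * p.1 + l.1.2 * p.2 + l.2)%coqZ.

(* A line separates the two segments weakly and does not contain both of them, so the
   open segments are disjoint. *)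
Definition separated (p q r s : Z * Z) : Prop := exists l,
  [/\ (0 <= affine l p)%coqZ, (0 <= affine l q)%coqZ, (affine l r <= 0)%coqZ, (affine l s <= 0)%coqZ &
      (affine l r + affine l s < affine l p + affine l q)%coqZ].

(** A vertex counts as a degenerate segment. Edges with a common end are subject to [drawn_edge]
    too, since their open segments have to be disjoint as well. *)
Record drawn (n : nat) (E : seq (nat * nat)) (pos : nat -> Z * Z) : Prop := Drawn {
  drawn_inj : forall x y, (x < n)%N -> (y < n)%N -> pos x = pos y -> x = y;
  drawn_vertex : forall q x, q \in E -> (x < n)%N -> x != q.1 -> x != q.2 ->
    separated (pos q.1) (pos q.2) (pos x) (pos x);
  drawn_edge : forall q r, q \in E -> r \in E -> upair q.1 q.2 != upair r.1 r.2 ->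
    separated (pos q.1) (pos q.2) (pos r.1) (pos r.2) }.

Section Segments.
Local Open Scope ring_scope.
Variable R : realType.

(** Coordinates are binary integers, so that drawings can be verified by computation; they become
    real numbers only here. *)
Definition embed (z : Z) : R := (int_of_Z z)%:~R.
Definition embed2 (p : Z * Z) : R * R := (embed p.1, embed p.2).

Definition segment (p q : R * R) (t : R) : R * R :=
  ((1 - t) * p.1 + t * q.1, (1 - t) * p.2 + t * q.2).

Lemma embed_le x y : (x <= y)%coqZ -> embed x <= embed y.
Proof. by rewrite /embed ler_int => H; lia. Qed.

Lemma embed_lt x y : (x < y)%coqZ -> embed x < embed y.
Proof. by rewrite /embed ltr_int => H; lia. Qed.

Lemma embedD x y : embed (x + y)%coqZ = embed x + embed y.
Proof. by rewrite /embed -intrD; congr (_%:~R); lia. Qed.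

Lemma embedM x y : embed (x * y)%coqZ = embed x * embed y.
Proof. by rewrite /embed -intrM; congr (_%:~R); lia. Qed.

Lemma embed_inj : injective embed.
Proof. by move=> x y /intr_inj; lia. Qed.

Lemma embed2_inj : injective embed2.
Proof. by move=> [a b] [c d] [/embed_inj-> /embed_inj->]. Qed.

Lemma segment0 p q : segment p q 0 = p.
Proof. by rewrite /segment; case: p q => a b [c d] /=; congr pair; lra. Qed.

Lemma segment1 p q : segment p q 1 = q.
Proof. by rewrite /segment; case: p q => a b [c d] /=; congr pair; lra. Qed.

Lemma segmentxx p t : segment p p t = p.
Proof. by rewrite /segment; case: p => a b /=; congr pair; lra. Qed.

(** At a common point the affine functional is a combination, with positive weights, of nonnegative
    values and also one of nonpositive values. So it vanishes at all four ends, against the strict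
    inequality. *)
Lemma separated_disjoint p q r s : separated p q r s -> forall t t' : R,
  0 < t < 1 -> 0 < t' < 1 -> segment (embed2 p) (embed2 q) t <> segment (embed2 r) (embed2 s) t'.
Proof.
move=> [[[a b] c] [lp lq lr ls lt]] t t' /andP[t0 t1] /andP[t0' t1'].
pose L (x : R * R) := embed a * x.1 + embed b * x.2 + embed c.
have LE x : L (embed2 x) = embed (affine (a, b, c) x) by rewrite /affine /= !embedD !embedM.
have LS x y v : L (segment x y v) = (1 - v) * L x + v * L y by rewrite /L /segment /=; ring.
move=> /(congr1 L); rewrite !LS !LE.
have e0 : embed 0%coqZ = 0 by [].
move: lp lq lr ls lt; move: (affine _ p) (affine _ q) (affine _ r) (affine _ s) => zp zq zr zs.
move=> /embed_le + /embed_le + /embed_le + /embed_le + /embed_lt; rewrite !embedD e0.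
move: (embed zp) (embed zq) (embed zr) (embed zs) => P Q V W Ps Qs Vs Ws lt E.
have h1 : 0 <= (1 - t) * P by apply: mulr_ge0 => //; lra.
have h2 : 0 <= t * Q by apply: mulr_ge0 => //; lra.
have h3 : 0 <= (1 - t') * - V by apply: mulr_ge0; lra.
have h4 : 0 <= t' * - W by apply: mulr_ge0; lra.
have zero x y : 0 < x -> x * y = 0 -> y = 0 :> R.
  by move=> x0 /eqP; rewrite mulf_eq0 gt_eqF //= => /eqP.
have P0 : P = 0 by apply: (zero (1 - t)); lra.
have Q0 : Q = 0 by apply: (zero t); lra.
have V0 : V = 0 by apply: (zero (1 - t')); lra.
have W0 : W = 0 by apply: (zero t'); lra.
by move: lt; rewrite P0 Q0 V0 W0 ltxx.
Qed.

Lemma affine_continuous (a b : R) : continuous (fun t : R => (1 - t) * a + t * b).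
Proof.
move=> t; apply: cvgD; apply: cvgM; try exact: cvg_cst; try exact: cvg_id.
by apply: cvgB; [exact: cvg_cst | exact: cvg_id].
Qed.

Lemma segment_continuous p q : continuous (segment p q).
Proof.
by move=> t; exact: (cvg_pair (@affine_continuous p.1 q.1 t) (@affine_continuous p.2 q.2 t)).
Qed.

Lemma segment_simple p q : p <> q -> simple_arc (segment p q).
Proof.
move=> pq; split; first exact/continuous_subspaceT/segment_continuous.
move=> s t _ _ [E1 E2]; apply/eqP; rewrite -subr_eq0; apply: contra_notT pq => st.
case: p q E1 E2 => a b [c d] /= E1 E2.
have : (s - t) * (c - a) = 0 by lra.
have : (s - t) * (d - b) = 0 by lra.
move=> /eqP; rewrite mulf_eq0 (negbTE st) /= subr_eq0 => /eqP ->.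
by move=> /eqP; rewrite mulf_eq0 (negbTE st) /= subr_eq0 => /eqP ->.
Qed.

End Segments.

(** The order of [enum] orients the arc of an unordered edge. The edge list may hold the pair in
    either order, hence the comparison through [upair]. *)
Lemma list_graph_edge n E (lE : loopless E) (A : {set list_graph n lE}) : A \in edges (list_graph n lE) ->
  exists x y : list_graph n lE, [/\ enum A = [:: x; y],
     upair (nat_of_ord x) (nat_of_ord y) \in [seq upair q.1 q.2 | q <- E] & x != y].
Proof.
rewrite inE => /existsP[x /existsP[y /andP[exy /eqP ->]]].
have xy : x != y by apply/eqP => xy; move: exy; rewrite xy edge_irrefl.
have uE : upair (nat_of_ord x) (nat_of_ord y) \in [seq upair q.1 q.2 | q <- E].
  case/orP: exy => i; apply/mapP; first by exists (nat_of_ord x, nat_of_ord y).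
  by exists (nat_of_ord y, nat_of_ord x); rewrite //= upairC.
have /perm2[eA|eA] : perm_eq (enum [set x; y]%SET) [:: x; y].
- apply: uniq_perm; rewrite ?enum_uniq //= ?inE ?xy // => z.
  by rewrite mem_enum !inE.
- by exists x, y.
by exists y, x; rewrite upairC eq_sym.
Qed.

Lemma separated_sym p q r s : separated p q r s -> separated r s p q.
Proof.
move=> [[[a b] c] [lp lq lr ls lt]]; exists ((- a)%coqZ, (- b)%coqZ, (- c)%coqZ).
have E x : affine ((- a)%coqZ, (- b)%coqZ, (- c)%coqZ) x = (- affine (a, b, c) x)%coqZ.
  by rewrite /affine /=; ring.
by rewrite !E; split; lia.
Qed.

Lemma separated_swap p q r s : separated p q r s -> separated q p r s.
Proof. by move=> [l [lp lq lr ls lt]]; exists l; split=> //; rewrite (Z.add_comm (affine l q)). Qed.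

Lemma separated_upair (f : nat -> Z * Z) x y x' y' r s : upair x y = upair x' y' ->
  separated (f x) (f y) r s -> separated (f x') (f y') r s.
Proof.
move/upair_inj/orP => [] /andP[/eqP-> /eqP->] //; exact: separated_swap.
Qed.

Section Planar.
Local Open Scope classical_set_scope.
Local Open Scope ring_scope.

Lemma drawn_planar (R : realType) n E pos (lE : loopless E) :
  drawn n E pos -> planar R (list_graph n lE).
Proof.
move=> [pI pV pE]; set G := list_graph n lE.
pose p (x : G) : R * R := embed2 R (pos (nat_of_ord x)).
pose arc (A : {set G}) : R -> R * R :=
  segment (nth 0 [seq p x | x <- enum A] 0) (nth 0 [seq p x | x <- enum A] 1).
have p_inj : injective p.
  by move=> x y /embed2_inj/pI H; apply: val_inj; apply: H; exact: ltn_ord.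
have arcE (A : {set G}) (x y : G) : enum A = [:: x; y] -> arc A = segment (p x) (p y).
  by rewrite /arc => ->.
have end_neq (x y : G) t : x != y -> 0 < t < 1 ->
    segment (p x) (p y) t <> p x /\ segment (p x) (p y) t <> p y.
  move=> xy t01; have t01' : (t \in `[0, 1]) by rewrite in_itv /=; lra.
  have /segment_simple[_ inj] : p x <> p y by move/p_inj/eqP; rewrite (negbTE xy).
  have i0 : (0 : R) \in `[0, 1] by rewrite in_itv /=; lra.
  have i1 : (1 : R) \in `[0, 1] by rewrite in_itv /=; lra.
  split=> E'.
    by have := inj t 0 t01' i0; rewrite segment0 => /(_ E'); lra.
  by have := inj t 1 t01' i1; rewrite segment1 => /(_ E'); lra.
exists p, arc; split=> //.
- move=> A /list_graph_edge[x [y [eA _ xy]]]; rewrite (arcE _ _ _ eA).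
  by apply: segment_simple => /p_inj /eqP; rewrite (negbTE xy).
- move=> A /list_graph_edge[x [y [eA _ xy]]]; rewrite (arcE _ _ _ eA) segment0 segment1.
  have Axy z : z \in A = (z == x) || (z == y) by rewrite -mem_enum eA !inE.
  apply/seteqP; split=> [z [->|->]|_ [z /= + <-]].
  + by exists x; rewrite //= Axy eqxx.
  + by exists y; rewrite //= Axy eqxx orbT.
  by rewrite Axy => /orP[]/eqP->; [left|right].
- move=> A /list_graph_edge[x [y [eA /mapP[q qE qU] xy]]] t z t01; rewrite (arcE _ _ _ eA).
  case: (eqVneq z x) => [->|zx]; first by case: (end_neq x y t xy t01).
  case: (eqVneq z y) => [->|zy]; first by case: (end_neq x y t xy t01).
  (* The vertex is read as a constant segment, so that the lemma on disjoint segments applies. *)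
  rewrite -(segmentxx (p z) t); apply: separated_disjoint => //.
  apply: (separated_upair (esym qU)); apply: pV => //.
    by case/upair_inj/orP: qU => /andP[/eqP Ex /eqP Ey]; rewrite -?Ex -?Ey.
  by case/upair_inj/orP: qU => /andP[/eqP Ex /eqP Ey]; rewrite -?Ex -?Ey.
move=> A B /list_graph_edge[x [y [eA /mapP[q qE qU] xy]]] /list_graph_edge[z [w [eB /mapP[r rE rU] zw]]] AB s t s01 t01.
rewrite (arcE _ _ _ eA) (arcE _ _ _ eB); apply: separated_disjoint => //.
apply: (separated_upair (esym qU)); apply/separated_sym.
apply: (separated_upair (esym rU)); apply/separated_sym; apply: pE => //.
apply: contra_neq AB; rewrite -qU -rU => /upair_inj H.
apply/setP => v; rewrite -[v \in A]mem_enum -[v \in B]mem_enum eA eB !inE.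
by case/orP: H => /andP[/eqP/val_inj-> /eqP/val_inj->] //; rewrite orbC.
Qed.

End Planar.

(** * Concentric squares *)

Definition corners : seq (Z * Z) := [:: (1, 1); (-1, 1); (-1, -1); (1, -1)]%coqZ.

Definition corner (j : nat) : Z * Z := nth (0, 0)%coqZ corners j.

Definition dilate (r : Z) (p : Z * Z) : Z * Z := (r * p.1, r * p.2)%coqZ.

Definition dot (l p : Z * Z) : Z := (l.1 * p.1 + l.2 * p.2)%coqZ.

(** Candidate normals of separating lines through the origin; these eight settle all pairs in
    [ring_radial]. *)
Definition directions : seq (Z * Z) :=
  [:: (1, 0); (-1, 0); (0, 1); (0, -1); (1, 1); (-1, -1); (1, -1); (-1, 1)]%coqZ.

(* For a functional vanishing at the origin the sign conditions do not depend on the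
   radii, so that a finite computation covers all rings. *)
Definition radially_separated (p q r s : Z * Z) : bool :=
  has (fun l => let: (lp, lq, lr, ls) := (dot l p, dot l q, dot l r, dot l s) in
    [&& (0 <=? lp)%coqZ, (0 <=? lq)%coqZ, (lr <=? 0)%coqZ, (ls <=? 0)%coqZ &
        [|| (0 <? lp)%coqZ, (0 <? lq)%coqZ, (lr <? 0)%coqZ | (ls <? 0)%coqZ]]) directions.

Lemma radially_separatedP p q r s a b c d :
  (0 < a)%coqZ -> (0 < b)%coqZ -> (0 < c)%coqZ -> (0 < d)%coqZ -> radially_separated p q r s ->
  separated (dilate a p) (dilate b q) (dilate c r) (dilate d s).
Proof.
move=> a0 b0 c0 d0 /hasP[l _ /and5P[lp lq lr ls lt]]; exists (l.1, l.2, 0%coqZ).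
have E x t : affine (l.1, l.2, 0%coqZ) (dilate t x) = (t * dot l x)%coqZ.
  rewrite /affine /dilate /dot /=; ring.
rewrite !E; move: lp lq lr ls lt; move: (dot l p) (dot l q) (dot l r) (dot l s) => P Q V W.
by move=> lp lq lr ls lt; split; nia.
Qed.

(** Corners 0 to 3 belong to the square already drawn, 4 to 7 to the next one. The edges are the
    four spokes and the sides of the new square. *)
Definition ring_edges : seq (nat * nat) :=
  [:: (0, 4); (1, 5); (2, 6); (3, 7); (4, 5); (5, 6); (6, 7); (7, 4)].

Lemma upair_addn k x y : upair (k + x) (k + y) = ((k + (upair x y).1), (k + (upair x y).2)).
Proof. by rewrite /upair ltn_add2l; case: ifP. Qed.

Lemma affineE a b c x y : affine (a, b, c) (x, y) = (a * x + b * y + c)%coqZ.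
Proof. by []. Qed.

Section Ring.
Variables (k : nat) (E : seq (nat * nat)) (pos : nat -> Z * Z) (r : Z).
Hypothesis r_gt0 : (0 < r)%coqZ.
Hypothesis E_lt : forall q, q \in E -> (q.1 < k + 4) && (q.2 < k + 4).
Hypothesis box : forall x, x < k + 4 ->
  (- r <= (pos x).1 <= r)%coqZ /\ (- r <= (pos x).2 <= r)%coqZ.
Hypothesis inner : forall j, j < 4 -> pos (k + j) = dilate r (corner j).
Hypothesis outer : forall j, j < 4 -> pos (k + (4 + j)) = dilate (r + 1)%coqZ (corner j).

(** The line has the whole box on one side, so that one certificate separates the segment from
    everything drawn before. *)
Definition beyond (p q : Z * Z) : Prop := exists l,
  [/\ (0 <= affine l p)%coqZ, (0 <= affine l q)%coqZ, (0 < affine l p + affine l q)%coqZ &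
      forall x y, (- r <= x <= r)%coqZ -> (- r <= y <= r)%coqZ -> (affine l (x, y) <= 0)%coqZ].

Lemma beyond_separated p q x y : beyond p q -> x < k + 4 -> y < k + 4 ->
  separated p q (pos x) (pos y).
Proof.
move=> [l [lp lq lt H]] /box [bx bx'] /box [b b']; exists l.
have {bx bx'} := H _ _ bx bx'; have {b b'} := H _ _ b b'.
rewrite -!surjective_pairing => ly lx; split=> //; lia.
Qed.

Let i0 : pos (k + 0) = (r * 1, r * 1)%coqZ := inner (j := 0) isT.
Let i1 : pos (k + 1) = (r * -1, r * 1)%coqZ := inner (j := 1) isT.
Let i2 : pos (k + 2) = (r * -1, r * -1)%coqZ := inner (j := 2) isT.
Let i3 : pos (k + 3) = (r * 1, r * -1)%coqZ := inner (j := 3) isT.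
Let o4 : pos (k + 4) = ((r + 1) * 1, (r + 1) * 1)%coqZ := outer (j := 0) isT.
Let o5 : pos (k + 5) = ((r + 1) * -1, (r + 1) * 1)%coqZ := outer (j := 1) isT.
Let o6 : pos (k + 6) = ((r + 1) * -1, (r + 1) * -1)%coqZ := outer (j := 2) isT.
Let o7 : pos (k + 7) = ((r + 1) * 1, (r + 1) * -1)%coqZ := outer (j := 3) isT.

Lemma beyond_vertex j : j < 4 -> beyond (pos (k + (4 + j))) (pos (k + (4 + j))).
Proof.
case: j => [|[|[|[|//]]]] _; rewrite ?addn0 ?o4 ?o5 ?o6 ?o7.
- by exists (1, 0, - r)%coqZ; split=> [|||x y]; rewrite ?affineE; clear -r_gt0; lia.
- by exists (-1, 0, - r)%coqZ; split=> [|||x y]; rewrite ?affineE; clear -r_gt0; lia.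
- by exists (-1, 0, - r)%coqZ; split=> [|||x y]; rewrite ?affineE; clear -r_gt0; lia.
by exists (1, 0, - r)%coqZ; split=> [|||x y]; rewrite ?affineE; clear -r_gt0; lia.
Qed.

Lemma beyond_edge q : q \in ring_edges -> beyond (pos (k + q.1)) (pos (k + q.2)).
Proof.
rewrite !inE; do 7?[case/orP]; move=> /eqP->; rewrite ?i0 ?i1 ?i2 ?i3 ?o4 ?o5 ?o6 ?o7 //.
(* A spoke starts at a corner of the box, so its line is the diagonal one that touches the box
   there. For the sides of the new square the side lines of the box serve. *)
- by exists (1, 1, - 2 * r)%coqZ; split=> [|||x y]; rewrite ?affineE; clear -r_gt0; lia.
- by exists (-1, 1, - 2 * r)%coqZ; split=> [|||x y]; rewrite ?affineE; clear -r_gt0; lia.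
- by exists (-1, -1, - 2 * r)%coqZ; split=> [|||x y]; rewrite ?affineE; clear -r_gt0; lia.
- by exists (1, -1, - 2 * r)%coqZ; split=> [|||x y]; rewrite ?affineE; clear -r_gt0; lia.
- by exists (0, 1, - r)%coqZ; split=> [|||x y]; rewrite ?affineE; clear -r_gt0; lia.
- by exists (-1, 0, - r)%coqZ; split=> [|||x y]; rewrite ?affineE; clear -r_gt0; lia.
- by exists (0, -1, - r)%coqZ; split=> [|||x y]; rewrite ?affineE; clear -r_gt0; lia.
by exists (1, 0, - r)%coqZ; split=> [|||x y]; rewrite ?affineE; clear -r_gt0; lia.
Qed.

Definition ray j := corner (j %% 4).

(** Only directions enter this check, so it is valid for all radii. Of the vertices it treats 4 to
    7; the inner corners lie in the box and are covered by [beyond]. *)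
Lemma ring_radial : all (fun q => all (fun s => (upair q.1 q.2 == upair s.1 s.2) ||
    radially_separated (ray q.1) (ray q.2) (ray s.1) (ray s.2)) ring_edges &&
  all (fun j => (j == q.1) || (j == q.2) ||
    radially_separated (ray q.1) (ray q.2) (ray j) (ray j)) (iota 4 4)) ring_edges.
Proof. by []. Qed.

Lemma pos_ray j : j < 8 -> exists2 t, (0 < t)%coqZ & pos (k + j) = dilate t (ray j).
Proof.
move=> j8; case: (ltnP j 4) => j4; first by exists r; rewrite // inner // /ray modn_small.
exists (r + 1)%coqZ; first by clear -r_gt0; lia.
have jE : j = 4 + (j - 4) by rewrite subnKC.
by rewrite jE outer /ray ?modnDl ?modn_small // ltn_subLR.
Qed.

Lemma ray_separated p q s t : p < 8 -> q < 8 -> s < 8 -> t < 8 ->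
  radially_separated (ray p) (ray q) (ray s) (ray t) ->
  separated (pos (k + p)) (pos (k + q)) (pos (k + s)) (pos (k + t)).
Proof.
move=> /pos_ray[a a0 ->] /pos_ray[b b0 ->] /pos_ray[c c0 ->] /pos_ray[d d0 ->].
exact: radially_separatedP.
Qed.

(** Two old objects are separated by hypothesis, a new one from an old one by a line beyond the box,
    and two new ones by a line through the origin. *)
Lemma drawn_ring : drawn (k + 4) E pos -> drawn (k + 8) (shift k ring_edges ++ E) pos.
Proof.
move=> [pI pV pE].
have new x : x < k + 8 -> (x < k + 4) || [exists j : 'I_4, x == k + (4 + j)].
  move=> x8; case: ltnP => //= x4; have j4 : x - (k + 4) < 4 by rewrite ltn_subLR // -addnA.
  by apply/existsP; exists (Ordinal j4); rewrite /= addnA subnKC.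
have sepx x y : separated (pos x) (pos x) (pos y) (pos y) -> pos x <> pos y.
  by move=> [l [? ? ? ? +]] E'; rewrite E'; lia.
have q8 q : q \in ring_edges -> (q.1 < 8) && (q.2 < 8).
  by apply/allP: q.
have vin j : j < 4 -> 4 + j \in iota 4 4 by move=> j4; rewrite mem_iota.
split.
- move=> x y /new/orP[x4|/existsP[i /eqP->]] /new/orP[y4|/existsP[j /eqP->]].
  + exact: pI.
  + by move/esym/sepx; case; apply: beyond_separated => //; apply: beyond_vertex.
  + by move/sepx; case; apply: beyond_separated => //; apply: beyond_vertex.
  rewrite !outer // /dilate => -[]; case: i j => [[|[|[|[|//]]]] ?] [[|[|[|[|//]]]] ?] //=;
    by clear -r_gt0; lia.
- move=> q x; rewrite mem_cat => /orP[/mapP[q' qi ->]|qE] /new/orP[x4|/existsP[j /eqP->]] /=.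
  + by move=> _ _; apply: beyond_separated => //; apply: beyond_edge.
  + rewrite !eqn_add2l => n1 n2; have /andP[q1 q2] := q8 _ qi.
    apply: ray_separated => //; first by rewrite -[8]/(4 + 4) ltn_add2l.
      by rewrite -[8]/(4 + 4) ltn_add2l.
    have /andP[_ /allP /(_ _ (vin j (ltn_ord j)))] := allP ring_radial _ qi.
    by rewrite (negbTE n1) (negbTE n2).
  + by move=> n1 n2; apply: pV.
  move=> _ _; have /andP[q1 q2] := E_lt qE.
  by apply/separated_sym/beyond_separated => //; apply: beyond_vertex.
move=> q s; rewrite !mem_cat => /orP[/mapP[q' qi ->]|qE] /orP[/mapP[s' si ->]|sE] /=.
- rewrite !upair_addn => ne; have /andP[q1 q2] := q8 _ qi; have /andP[s1 s2] := q8 _ si.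
  apply: ray_separated => //.
  have /andP[/allP /(_ _ si) + _] := allP ring_radial _ qi.
  by case/orP=> // /eqP E'; rewrite E' eqxx in ne.
- by move=> _; have /andP[s1 s2] := E_lt sE; apply: beyond_separated => //; apply: beyond_edge.
- move=> _; have /andP[q1 q2] := E_lt qE.
  by apply/separated_sym/beyond_separated => //; apply: beyond_edge.
exact: pE.
Qed.

End Ring.

(** * Verification of a given drawing *)

Definition orient (p q r : Z * Z) : Z :=
  ((q.1 - p.1) * (r.2 - p.2) - (q.2 - p.2) * (r.1 - p.1))%coqZ.

(** Only the line through [p] and [q] itself is tried as a separating line. *)
Definition one_side (p q r s : Z * Z) : bool :=
  let a := orient p q r in let b := orient p q s in
  [&& (0 <=? a), (0 <=? b) & (0 <? a + b)]%coqZ ||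
  [&& (a <=? 0), (b <=? 0) & (a + b <? 0)]%coqZ.

Lemma one_sideP p q r s : one_side p q r s -> separated p q r s.
Proof.
have E x : orient p q x = affine (p.2 - q.2, q.1 - p.1, p.1 * q.2 - p.2 * q.1)%coqZ x.
  by rewrite /orient /affine /=; ring.
have Ep : orient p q p = 0%coqZ by rewrite /orient; ring.
have Eq : orient p q q = 0%coqZ by rewrite /orient; ring.
rewrite /one_side => /orP[]/and3P[]; last first.
  move=> h1 h2 h3; exists (p.2 - q.2, q.1 - p.1, p.1 * q.2 - p.2 * q.1)%coqZ.
  by rewrite -!E Ep Eq; split; lia.
move=> h1 h2 h3; apply/separated_sym.
exists (p.2 - q.2, q.1 - p.1, p.1 * q.2 - p.2 * q.1)%coqZ.
by rewrite -!E Ep Eq; split; lia.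
Qed.

Lemma pairwise_neq (T : eqType) (r : rel T) s x y :
  pairwise r s -> x \in s -> y \in s -> x != y -> r x y || r y x.
Proof.
elim: s => //= z s IH /andP[/allP zs ps]; rewrite !inE.
case/orP=> [/eqP->|xs]; case/orP=> [/eqP->|ys]; rewrite ?eqxx // => ne.
- by rewrite zs.
- by rewrite zs ?orbT.
exact: IH.
Qed.

(** Two segments with a separating line need not have one that contains the first, so the lines of
    both are tried. The coordinates are tabulated before the quadratically many comparisons. *)
Definition drawn_check n (E : seq (nat * nat)) (pos : nat -> Z * Z) : bool :=
  let pts := [seq (x, pos x) | x <- iota 0 n] in
  let segs := [seq (q, (pos q.1, pos q.2)) | q <- E] in
  [&& pairwise (fun p q => ~~ ((p.2.1 =? q.2.1)%coqZ && (p.2.2 =? q.2.2)%coqZ)) pts,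
      all (fun s => all (fun p => one_side s.2.1 s.2.2 p.2 p.2 ||
        (p.1 == s.1.1) || (p.1 == s.1.2)) pts) segs &
      pairwise (fun s t => one_side s.2.1 s.2.2 t.2.1 t.2.2 || one_side t.2.1 t.2.2 s.2.1 s.2.2) segs].

Lemma drawn_checkP n E pos : drawn_check n E pos -> drawn n E pos.
Proof.
move=> /and3P[cI cV cE].
have pt x : x < n -> (x, pos x) \in [seq (x, pos x) | x <- iota 0 n].
  by move=> xn; apply/mapP; exists x; rewrite ?mem_iota.
have sg q : q \in E -> (q, (pos q.1, pos q.2)) \in [seq (q, (pos q.1, pos q.2)) | q <- E].
  by move=> qE; apply/mapP; exists q.
split.
- move=> x y /pt xn /pt yn xy; apply/eqP; apply/negPn/negP => ne.
  have := pairwise_neq cI xn yn; rewrite -pair_eqE /= negb_and ne => /(_ isT).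
  by rewrite xy !Z.eqb_refl.
- move=> q x /sg qE /pt xn n1 n2; apply: one_sideP.
  by have := allP (allP cV _ qE) _ xn; rewrite /= (negbTE n1) (negbTE n2) !orbF.
move=> q s qE sE ne.
have qs : q != s by apply: contraNneq ne => ->.
have := pairwise_neq cE (sg _ qE) (sg _ sE); rewrite -pair_eqE /= negb_and qs => /(_ isT).
by rewrite [X in _ || X]orbC orbb => /orP[]/one_sideP // /separated_sym.
Qed.

(** * Drawings of towers *)

Section Layout.
Variables (m : nat) (K : seq (nat * nat)) (us : seq nat) (pts : seq (Z * Z)) (r0 : Z).

Definition layout (x : nat) : Z * Z :=
  if x < m then nth (0, 0)%coqZ pts x
  else dilate (r0 + Z.of_nat ((x - m) %/ 4))%coqZ (corner ((x - m) %% 4)).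

(* Drawing all four ring edges of every layer, deleted or not, makes the induction
   uniform. *)
Fixpoint full_tower d : seq (nat * nat) :=
  if d is d'.+1 then shift (m + 4 * d') ring_edges ++ full_tower d' else tower m K us 0.

Definition in_box (p : Z * Z) := [&& (- r0 <=? p.1), (p.1 <=? r0), (- r0 <=? p.2) & (p.2 <=? r0)]%coqZ.

Hypothesis K_lt : all (fun q => (q.1 < m) && (q.2 < m)) K.
Hypothesis us_lt : all (gtn m) us.
Hypothesis us_size : size us = 4.
Hypothesis r0_gt0 : (0 <? r0)%coqZ.
Hypothesis pts_box : all in_box pts.
Hypothesis base_drawn : drawn (m + 4) (tower m K us 0) layout.

Lemma full_tower_lt d q : q \in full_tower d -> (q.1 < m + 4 * d.+1) && (q.2 < m + 4 * d.+1).
Proof.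
elim: d q => [|d IH] q.
  rewrite !mem_cat => /or3P[/(allP K_lt)|/mapP[i + ->]|/mapP[q' qi ->]] /=; first by lia.
    rewrite mem_iota => i4.
    by have := allP us_lt _ (mem_nth 0 (_ : i < size us)); rewrite us_size => /(_ i4) /=; clear -i4; lia.
  by move: qi; rewrite !inE; do 3?[case/orP]; move=> /eqP-> /=; lia.
rewrite mem_cat => /orP[/mapP[q' qi ->]|/IH]; last by lia.
by move: qi; rewrite !inE; do 7?[case/orP]; move=> /eqP-> /=; lia.
Qed.

Lemma layout_above e j : j < 4 -> layout (m + 4 * e + j) = dilate (r0 + Z.of_nat e)%coqZ (corner j).
Proof.
move=> j4; rewrite /layout -addnA ltnNge leq_addr /= addKn mulnC divnMDl // divn_small // addn0.
by rewrite modnMDl modn_small.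
Qed.

Lemma layout_box d x : x < m + 4 * d.+1 ->
  (- (r0 + Z.of_nat d) <= (layout x).1 <= r0 + Z.of_nat d)%coqZ /\
  (- (r0 + Z.of_nat d) <= (layout x).2 <= r0 + Z.of_nat d)%coqZ.
Proof.
move=> xd; have r0p : (0 < r0)%coqZ by apply/Z.ltb_lt.
case: (ltnP x m) => xm.
  (* A vertex without a listed position falls back on the origin, which lies in the box. *)
  rewrite /layout xm; case: (ltnP x (size pts)) => xs; last by rewrite nth_default //=; lia.
  by have /and4P[] := allP pts_box _ (mem_nth (0, 0)%coqZ xs) => /=;
    move: (nth _ _ _) => [a b] /=; clear -r0p; lia.
rewrite /layout ltnNge xm /=.
have : (x - m) %/ 4 <= d by rewrite -ltnS ltn_divLR //; lia.
have : (x - m) %% 4 < 4 by rewrite ltn_mod.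
move: ((x - m) %/ 4) ((x - m) %% 4) => e j + ed; clear -ed r0p.
have B (c : Z * Z) : (-1 <= c.1 <= 1)%coqZ -> (-1 <= c.2 <= 1)%coqZ ->
  (- (r0 + Z.of_nat d) <= (dilate (r0 + Z.of_nat e) c).1 <= r0 + Z.of_nat d)%coqZ /\
  (- (r0 + Z.of_nat d) <= (dilate (r0 + Z.of_nat e) c).2 <= r0 + Z.of_nat d)%coqZ.
  case: c => c c' /=; nia.
by case: j => [|[|[|[|//]]]] _; apply: B => /=; lia.
Qed.

Lemma full_tower_drawn d : drawn (m + 4 * d.+1) (full_tower d) layout.
Proof.
elim: d => [//|d IH].
have r0p : (0 < r0)%coqZ by apply/Z.ltb_lt.
(* The inner square of the new ring is the last layer drawn, whose corners start at [m + 4 * d]. *)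
have e1 : m + 4 * d.+2 = (m + 4 * d) + 8 by lia.
have e2 : m + 4 * d.+1 = (m + 4 * d) + 4 by lia.
rewrite e1; apply: (drawn_ring (r := (r0 + Z.of_nat d)%coqZ)).
- by clear -r0p; lia.
- by move=> q /full_tower_lt; rewrite e2.
- by move=> x; rewrite -e2; apply: layout_box.
- exact: layout_above.
- move=> j j4; rewrite addnA -e2 layout_above //; congr (dilate _ _); clear; lia.
by rewrite -e2.
Qed.

(** An explicit form of the edges, as sides of a layer or spokes between layers. It mediates between
    two opposite recursions: [ladder] adds a layer in front, [full_tower] at the end. *)
Lemma ladder_structure d q : q \in ladder d -> exists e i, i < 4 /\
  ((e <= d /\ q = (4 * e + i, 4 * e + i.+1 %% 4)) \/ (e < d /\ q = (4 * e + i, 4 * e.+1 + i))).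
Proof.
elim: d q => [|d IH] q.
  rewrite !inE; do 3?[case/orP]; move=> /eqP->; [exists 0, 0|exists 0, 1|exists 0, 2|exists 0, 3]; split; auto.
rewrite mem_cat => /orP[|/mapP[q' /IH[e [i [i4 H]]] ->]]; last first.
  by exists e.+1, i; split=> //; case: H => -[ed ->]; [left | right]; split=> //=; congr pair; lia.
rewrite !inE; do 5?[case/orP]; move=> /eqP->;
  [exists 0, 1|exists 0, 3|exists 0, 0|exists 0, 1|exists 0, 2|exists 0, 3]; split=> //; auto.
Qed.

Lemma mem_full_tower d q : q \in ladder d -> (m + q.1, m + q.2) \in full_tower d.
Proof.
move=> /ladder_structure[e [i [i4 H]]].
elim: d H => [|d IH] H.
  case: H => -[] //; rewrite leqn0 => /eqP-> -> /=.
  rewrite !mem_cat; apply/or3P/Or33; apply/mapP.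
  exists (i, i.+1 %% 4); last by rewrite /= !add0n.
  by case: i i4 => [|[|[|[|]]]].
rewrite mem_cat.
case: H => -[ed qE].
  case: (ltnP d e) => de; last by rewrite IH ?orbT //; left.
  have {ed de} eE : e = d.+1 by lia.
  apply/orP; left; apply/mapP; exists (4 + i, 4 + i.+1 %% 4).
    by move: i4; clear; case: i => [|[|[|[|]]]].
  by rewrite qE eE /=; congr pair; lia.
case: (ltnP e d) => de; first by rewrite IH ?orbT //; right.
have {ed de} eE : e = d by lia.
apply/orP; left; apply/mapP; exists (i, 4 + i); first by move: i4; clear; case: i => [|[|[|[|]]]].
by rewrite qE eE /=; congr pair; lia.
Qed.

Lemma tower_sub d : {subset tower m K us d <= full_tower d}.
Proof.
have sub0 : {subset tower m K us 0 <= full_tower d}.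
  by elim: d => // d IH q /IH qi; rewrite mem_cat qi orbT.
move=> q; rewrite !mem_cat => /or3P[qK|qF|/mapP[q' ql ->]].
- by apply: sub0; rewrite mem_cat qK.
- by apply: sub0; rewrite !mem_cat qF orbT.
exact: mem_full_tower.
Qed.

Lemma tower_drawn d : drawn (m + 4 * d.+1) (tower m K us d) layout.
Proof.
have [pI pV pE] := full_tower_drawn d; split=> //.
  by move=> q x /tower_sub; apply: pV.
by move=> q s /tower_sub qi /tower_sub si; apply: pE.
Qed.

End Layout.

(** * Certificates for the given graphs *)

Lemma cycle_cpairs e c q : cycle e c -> q \in cpairs c -> e q.1 q.2.
Proof.
case: c => // x l; rewrite /cycle /cpairs; move: (rcons l x) => s {l}.
elim: s x => //= y s IH x /andP[exy ps]; rewrite inE => /orP[/eqP->//|]; exact: IH.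
Qed.

Lemma nonham_check n E order : perm_eq order (iota 0 n) -> no_cycle E order [:: [::]] ->
  ~ ham_on (adj E) (gtn n).
Proof.
move=> po nc [c [_ cc uc cD]].
(* No vertex has been eliminated at the start, so there is no virtual edge. *)
apply: (@no_cycleP E order [:: [::]] [::] c) => //.
- by rewrite (perm_uniq po) iota_uniq.
- by move=> x; rewrite cD (perm_mem po) mem_iota.
by split=> // q qc; rewrite (cycle_cpairs cc qc).
Qed.

Definition covers (s l : seq nat) := [&& uniq s, all (mem l) s & size l <= size s].

Lemma coversP s l : covers s l -> uniq s /\ s =i l.
Proof.
by move=> /and3P[us /allP sl ss]; have [_ sE] := uniq_min_size us sl ss.
Qed.

(** Entry [v] of the list is a cycle through all vertices but [v]. Adjacency is looked up in a table
    of neighbours. *)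
Definition but_check n E (cycles : seq (seq nat)) : bool :=
  let tab := [seq nbrs E v | v <- iota 0 n] in
  all (fun v => let c := nth [::] cycles v in
    [&& 2 < size c, cycle (fun x y => y \in nth [::] tab x) c & covers c (rem v (iota 0 n))])
    (iota 0 (size cycles)).

Lemma but_checkP n E cycles v : but_check n E cycles -> v < size cycles ->
  ham_on (adj E) (fun x => (x != v) && (x < n)).
Proof.
move=> /allP /(_ v) + vs; rewrite mem_iota vs => /(_ isT) /and3P[sc cc /coversP[uc cD]].
exists (nth [::] cycles v); split=> //.
  apply: sub_cycle cc => x y; case: (ltnP x n) => xn; last first.
    by rewrite [nth _ _ x]nth_default ?size_map ?size_iota.
  by rewrite (nth_map 0) ?size_iota // nth_iota // mem_nbrs.
by move=> x; rewrite cD mem_rem_uniq ?iota_uniq // inE mem_iota.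
Qed.

Lemma link_check m E a b p : walk (adj E) a b p -> covers p (iota 0 m) ->
  linked1 (adj E) (gtn m) a b.
Proof.
by move=> w /coversP[up pD]; exists p; split=> // x; rewrite pD mem_iota.
Qed.

(** * The six plane graphs *)

(* [but_cycles] lists Hamiltonian cycles of the graph minus [v], for each [v] outside
   the quadrilateral; [link02] and [link13] are Hamiltonian paths of the graph minus
   the quadrilateral between two attachments. *)
Record plane_base := PlaneBase {
  inner_order : nat;
  inner_edges : seq (nat * nat);
  attachments : seq nat;
  positions : seq (Z * Z);
  radius : Z;
  elimination : seq nat;
  but_cycles : seq (seq nat);
  link02 : seq nat;
  link13 : seq nat }.

(** Cycles are demanded for the [m] outer vertices only; a missing corner of the quadrilateral is
    handled by the two links. *)
Definition base_check (b : plane_base) : bool :=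
  let: PlaneBase m K us pts r order cycles p02 p13 := b in
  let E := tower m K us 0 in
  [&& [&& all (fun q => [&& q.1 < m, q.2 < m & q.1 != q.2]) K, all (gtn m) us, size us == 4, 1 < m,
        (0 <? r)%coqZ & all (in_box r) pts],
      drawn_check (m + 4) E (layout m pts r),
      perm_eq order (iota 0 (m + 4)) && no_cycle E order [:: [::]],
      (m <= size cycles) && but_check (m + 4) E cycles,
      walk (adj K) (nth 0 us 0) (nth 0 us 2) p02 && covers p02 (iota 0 m) &
      walk (adj K) (nth 0 us 1) (nth 0 us 3) p13 && covers p13 (iota 0 m)].

Lemma base_checkP (R : realType) b d : base_check b ->
  exists G : sgraph, [/\ #|G| = inner_order b + 4 * d.+1, planar R G & hypohamiltonian G].
Proof.
case: b => m K us pts r order cycles p02 p13 /=.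
move=> /and5P[/and5P[K_ok us_lt /eqP us_size m1 /andP[r0 box]] dr /andP[po nc] /andP[ms bc]].
move=> /andP[/andP[w02 c02] /andP[w13 c13]].
have K_lt : all (fun q => (q.1 < m) && (q.2 < m)) K.
  by apply: sub_all K_ok => q /and3P[-> ->].
have lE : loopless (tower m K us d).
  rewrite /loopless !all_cat; apply/and3P; split.
  - by apply: sub_all K_ok => q /and3P[].
  - apply/allP => _ /mapP[i + ->] /=; rewrite mem_iota => i4.
    by have := allP us_lt _ (mem_nth 0 (_ : i < size us)); rewrite us_size => /(_ i4) /=; clear; lia.
  apply/allP => _ /mapP[[x y] xy ->] /=; rewrite eqn_add2l.
  have /ladder_parity : adj (ladder d) x y by rewrite /adj xy.
  by apply: contraNneq => ->.
exists (list_graph (m + 4 * d.+1) lE); split.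
- by rewrite card_ord.
- apply: drawn_planar; apply: (tower_drawn (pts := pts) (r0 := r)) => //.
  exact: drawn_checkP.
apply: tower_hypohamiltonian => //.
- exact: nonham_check po nc.
- by move=> v vm; apply: but_checkP bc _; apply: leq_trans ms.
- exact: link_check w02 c02.
exact: link_check w13 c13.
Qed.

(* For orders 43 and 45 no graph with a cubic quadrilateral is given, so that these
   graphs account for their own order only. *)
Definition solo_check n E (pts : seq (Z * Z)) order cycles : bool :=
  [&& all (fun q => q.1 != q.2) E, drawn_check n E (nth (0, 0)%coqZ pts),
      perm_eq order (iota 0 n), no_cycle E order [:: [::]] &
      (n <= size cycles) && but_check n E cycles].

Lemma solo_checkP (R : realType) n E pts order cycles : solo_check n E pts order cycles ->
  exists G : sgraph, [/\ #|G| = n, planar R G & hypohamiltonian G].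
Proof.
move=> /and5P[lE dr po nc /andP[ns bc]].
exists (list_graph n (lE : loopless E)); split.
- by rewrite card_ord.
- exact/drawn_planar/drawn_checkP/dr.
apply: list_graph_hypohamiltonian; first exact: nonham_check po nc.
by move=> v vn; apply: but_checkP bc _; apply: leq_trans ns.
Qed.

(* The graphs, their drawings and the certificates were found by a computer search. *)
Definition base42 : plane_base := PlaneBase 38
   [:: (0, 1); (0, 4); (0, 5); (1, 2); (1, 9); (2, 3); (2, 24); (3, 4); (3, 28); (4, 13); (5, 6); (5, 7); (6,
   9); (6, 12); (7, 8); (7, 13); (8, 12); (8, 15); (9, 10); (10, 11); (10, 24); (11, 12); (11, 25); (12, 16);
   (13, 14); (13, 19); (14, 15); (14, 18); (15, 17); (16, 17); (16, 23); (17, 21); (18, 20); (18, 21); (19,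
   20); (19, 28); (20, 26); (21, 22); (22, 23); (22, 26); (23, 25); (24, 27); (24, 32); (25, 32); (25, 36);
   (26, 34); (26, 36); (27, 28); (27, 29); (28, 30); (28, 34); (29, 30); (29, 32); (30, 31); (31, 32); (31,
   34); (31, 37); (32, 33); (33, 36); (33, 37); (34, 35); (35, 36); (35, 37)]
   [:: 37; 35; 36; 33]
   [:: (-54, -90); (-25, -104); (2, -92); (-49, -26); (-67, -56); (-88, -130); (-93, -155); (-113, -120);
   (-123, -154); (-48, -141); (-38, -153); (-111, -192); (-117, -175); (-116, -81); (-153, -120); (-145,
   -146); (-148, -182); (-160, -163); (-175, -127); (-123, -54); (-183, -118); (-181, -152); (-193, -160);
   (-157, -195); (41, -120); (-144, -219); (-218, -145); (17, -58); (-65, 22); (75, -77); (62, 45); (119,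
   117); (111, -147); (287, -293); (-150, 114); (-293, 288); (-281, -282); (287, 286)]%coqZ 660%coqZ
   [:: 0; 1; 2; 3; 4; 5; 6; 7; 8; 9; 10; 11; 12; 13; 14; 15; 16; 17; 18; 19; 20; 21; 22; 23; 24; 25; 26; 27;
   28; 29; 30; 31; 32; 33; 34; 35; 36; 40; 39; 41; 37; 38]
   [:: [:: 1; 2; 3; 4; 13; 14; 15; 17; 16; 23; 25; 32; 29; 30; 31; 37; 33; 36; 40; 41; 38; 39; 35; 34; 26; 22;
   21; 18; 20; 19; 28; 27; 24; 10; 11; 12; 8; 7; 5; 6; 9]; [:: 0; 4; 3; 2; 24; 27; 28; 19; 20; 18; 21; 22; 26;
   34; 31; 30; 29; 32; 33; 41; 40; 39; 38; 37; 35; 36; 25; 23; 16; 17; 15; 14; 13; 7; 8; 12; 11; 10; 9; 6; 5];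
   [:: 0; 1; 9; 6; 5; 7; 13; 14; 15; 8; 12; 11; 10; 24; 27; 29; 30; 31; 32; 25; 36; 33; 41; 40; 39; 38; 37;
   35; 34; 26; 22; 23; 16; 17; 21; 18; 20; 19; 28; 3; 4]; [:: 0; 1; 2; 24; 27; 29; 32; 25; 23; 16; 17; 21; 22;
   26; 36; 33; 37; 38; 41; 40; 39; 35; 34; 31; 30; 28; 19; 20; 18; 14; 15; 8; 12; 11; 10; 9; 6; 5; 7; 13; 4];
   [:: 0; 1; 2; 3; 28; 19; 20; 18; 21; 22; 23; 16; 17; 15; 14; 13; 7; 8; 12; 11; 25; 32; 33; 37; 38; 41; 40;
   39; 35; 36; 26; 34; 31; 30; 29; 27; 24; 10; 9; 6; 5]; [:: 0; 1; 2; 24; 27; 29; 30; 31; 34; 26; 36; 35; 39;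
   40; 41; 38; 37; 33; 32; 25; 11; 10; 9; 6; 12; 8; 7; 13; 14; 15; 17; 16; 23; 22; 21; 18; 20; 19; 28; 3; 4];
   [:: 0; 1; 9; 10; 11; 12; 8; 15; 14; 18; 20; 19; 28; 30; 31; 37; 33; 36; 40; 41; 38; 39; 35; 34; 26; 22; 21;
   17; 16; 23; 25; 32; 29; 27; 24; 2; 3; 4; 13; 7; 5]; [:: 0; 1; 2; 3; 4; 13; 14; 15; 8; 12; 11; 25; 32; 29;
   30; 31; 37; 33; 36; 40; 41; 38; 39; 35; 34; 26; 22; 23; 16; 17; 21; 18; 20; 19; 28; 27; 24; 10; 9; 6; 5];
   [:: 0; 1; 2; 24; 27; 29; 30; 31; 32; 25; 36; 33; 37; 38; 41; 40; 39; 35; 34; 26; 22; 23; 16; 12; 11; 10; 9;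
   6; 5; 7; 13; 14; 15; 17; 21; 18; 20; 19; 28; 3; 4]; [:: 0; 1; 2; 24; 10; 11; 12; 6; 5; 7; 8; 15; 14; 13;
   19; 20; 18; 21; 17; 16; 23; 22; 26; 34; 35; 39; 40; 41; 38; 37; 33; 36; 25; 32; 31; 30; 29; 27; 28; 3; 4];
   [:: 0; 1; 9; 6; 5; 7; 13; 14; 15; 8; 12; 11; 25; 32; 29; 30; 31; 37; 33; 36; 40; 41; 38; 39; 35; 34; 26;
   22; 23; 16; 17; 21; 18; 20; 19; 28; 27; 24; 2; 3; 4]; [:: 0; 1; 2; 24; 10; 9; 6; 5; 7; 13; 19; 20; 18; 14;
   15; 8; 12; 16; 17; 21; 22; 23; 25; 32; 33; 37; 38; 41; 40; 39; 35; 36; 26; 34; 31; 30; 29; 27; 28; 3; 4];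
   [:: 0; 1; 2; 24; 27; 29; 32; 25; 11; 10; 9; 6; 5; 7; 8; 15; 14; 13; 19; 20; 18; 21; 17; 16; 23; 22; 26; 34;
   35; 39; 38; 41; 40; 36; 33; 37; 31; 30; 28; 3; 4]; [:: 0; 1; 2; 24; 27; 29; 30; 31; 34; 26; 36; 35; 39; 40;
   41; 38; 37; 33; 32; 25; 11; 10; 9; 6; 5; 7; 8; 12; 16; 23; 22; 21; 17; 15; 14; 18; 20; 19; 28; 3; 4]; [::
   0; 1; 2; 24; 10; 9; 6; 5; 7; 13; 19; 20; 18; 21; 22; 23; 16; 17; 15; 8; 12; 11; 25; 32; 33; 37; 38; 41; 40;
   39; 35; 36; 26; 34; 31; 30; 29; 27; 28; 3; 4]; [:: 0; 1; 2; 3; 4; 13; 14; 18; 20; 19; 28; 27; 24; 32; 29;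
   30; 31; 37; 33; 36; 40; 41; 38; 39; 35; 34; 26; 22; 21; 17; 16; 23; 25; 11; 10; 9; 6; 12; 8; 7; 5]; [:: 0;
   1; 2; 24; 27; 29; 30; 31; 34; 26; 36; 35; 39; 40; 41; 38; 37; 33; 32; 25; 23; 22; 21; 17; 15; 8; 12; 11;
   10; 9; 6; 5; 7; 13; 14; 18; 20; 19; 28; 3; 4]; [:: 0; 1; 2; 24; 27; 29; 30; 31; 34; 26; 36; 35; 39; 40; 41;
   38; 37; 33; 32; 25; 11; 10; 9; 6; 5; 7; 13; 14; 15; 8; 12; 16; 23; 22; 21; 18; 20; 19; 28; 3; 4]; [:: 0; 1;
   2; 24; 27; 29; 32; 25; 11; 10; 9; 6; 5; 7; 8; 12; 16; 23; 22; 21; 17; 15; 14; 13; 19; 20; 26; 34; 35; 39;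
   38; 41; 40; 36; 33; 37; 31; 30; 28; 3; 4]; [:: 0; 1; 2; 3; 28; 27; 24; 32; 29; 30; 31; 34; 35; 39; 40; 41;
   38; 37; 33; 36; 25; 23; 16; 17; 21; 22; 26; 20; 18; 14; 15; 8; 12; 11; 10; 9; 6; 5; 7; 13; 4]; [:: 0; 1; 2;
   24; 27; 29; 30; 31; 32; 25; 36; 33; 37; 38; 41; 40; 39; 35; 34; 26; 22; 23; 16; 17; 21; 18; 14; 15; 8; 12;
   11; 10; 9; 6; 5; 7; 13; 19; 28; 3; 4]; [:: 0; 1; 2; 24; 27; 29; 30; 31; 32; 25; 36; 33; 37; 38; 41; 40; 39;
   35; 34; 26; 22; 23; 16; 17; 15; 8; 12; 11; 10; 9; 6; 5; 7; 13; 14; 18; 20; 19; 28; 3; 4]; [:: 0; 1; 2; 24;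
   27; 29; 32; 25; 23; 16; 17; 21; 18; 14; 15; 8; 12; 11; 10; 9; 6; 5; 7; 13; 19; 20; 26; 34; 35; 39; 38; 41;
   40; 36; 33; 37; 31; 30; 28; 3; 4]; [:: 0; 1; 2; 24; 27; 29; 32; 25; 11; 10; 9; 6; 5; 7; 13; 19; 20; 18; 14;
   15; 8; 12; 16; 17; 21; 22; 26; 34; 35; 39; 38; 41; 40; 36; 33; 37; 31; 30; 28; 3; 4]; [:: 0; 1; 2; 3; 28;
   27; 29; 30; 31; 34; 26; 36; 35; 37; 38; 39; 40; 41; 33; 32; 25; 11; 10; 9; 6; 5; 7; 8; 12; 16; 23; 22; 21;
   17; 15; 14; 18; 20; 19; 13; 4]; [:: 0; 1; 9; 10; 11; 12; 6; 5; 7; 8; 15; 14; 13; 19; 20; 18; 21; 17; 16;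
   23; 22; 26; 34; 35; 39; 38; 41; 40; 36; 33; 37; 31; 32; 29; 30; 28; 27; 24; 2; 3; 4]; [:: 0; 1; 2; 3; 28;
   27; 24; 32; 29; 30; 31; 34; 35; 39; 40; 41; 38; 37; 33; 36; 25; 11; 10; 9; 6; 5; 7; 8; 12; 16; 23; 22; 21;
   17; 15; 14; 18; 20; 19; 13; 4]; [:: 0; 1; 2; 24; 10; 9; 6; 5; 7; 13; 14; 15; 8; 12; 11; 25; 32; 29; 30; 31;
   37; 33; 36; 40; 41; 38; 39; 35; 34; 26; 22; 23; 16; 17; 21; 18; 20; 19; 28; 3; 4]; [:: 0; 1; 9; 10; 11; 12;
   6; 5; 7; 8; 15; 14; 13; 19; 20; 18; 21; 17; 16; 23; 22; 26; 34; 35; 39; 40; 41; 38; 37; 33; 36; 25; 32; 31;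
   30; 29; 27; 24; 2; 3; 4]; [:: 0; 1; 9; 10; 11; 12; 6; 5; 7; 8; 15; 14; 13; 19; 20; 18; 21; 17; 16; 23; 22;
   26; 34; 35; 39; 40; 41; 38; 37; 33; 36; 25; 32; 31; 30; 28; 27; 24; 2; 3; 4]; [:: 0; 1; 2; 24; 27; 29; 32;
   31; 37; 33; 36; 40; 41; 38; 39; 35; 34; 26; 22; 23; 25; 11; 10; 9; 6; 5; 7; 13; 14; 15; 8; 12; 16; 17; 21;
   18; 20; 19; 28; 3; 4]; [:: 0; 1; 2; 3; 28; 30; 29; 27; 24; 32; 33; 37; 38; 41; 40; 39; 35; 34; 26; 36; 25;
   11; 10; 9; 6; 5; 7; 8; 12; 16; 23; 22; 21; 17; 15; 14; 18; 20; 19; 13; 4]; [:: 0; 1; 2; 24; 27; 29; 30; 31;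
   37; 38; 39; 40; 41; 33; 36; 35; 34; 26; 22; 23; 25; 11; 10; 9; 6; 5; 7; 13; 14; 15; 8; 12; 16; 17; 21; 18;
   20; 19; 28; 3; 4]; [:: 0; 1; 2; 3; 28; 27; 24; 32; 29; 30; 31; 37; 38; 41; 40; 39; 35; 34; 26; 36; 25; 11;
   10; 9; 6; 5; 7; 8; 12; 16; 23; 22; 21; 17; 15; 14; 18; 20; 19; 13; 4]; [:: 0; 1; 2; 24; 27; 29; 30; 31; 32;
   33; 37; 38; 41; 40; 39; 35; 36; 26; 22; 23; 25; 11; 10; 9; 6; 5; 7; 13; 14; 15; 8; 12; 16; 17; 21; 18; 20;
   19; 28; 3; 4]; [:: 0; 1; 2; 3; 28; 30; 29; 27; 24; 32; 33; 41; 40; 39; 38; 37; 31; 34; 26; 36; 25; 11; 10;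
   9; 6; 5; 7; 8; 12; 16; 23; 22; 21; 17; 15; 14; 18; 20; 19; 13; 4]; [:: 0; 1; 2; 24; 27; 29; 30; 31; 32; 33;
   37; 38; 41; 40; 39; 35; 34; 26; 22; 23; 25; 11; 10; 9; 6; 5; 7; 13; 14; 15; 8; 12; 16; 17; 21; 18; 20; 19;
   28; 3; 4]; [:: 0; 1; 2; 24; 27; 29; 30; 31; 32; 33; 36; 40; 41; 38; 39; 35; 34; 26; 22; 23; 25; 11; 10; 9;
   6; 5; 7; 13; 14; 15; 8; 12; 16; 17; 21; 18; 20; 19; 28; 3; 4]]
   [:: 37; 35; 34; 26; 22; 23; 25; 11; 10; 9; 6; 5; 7; 13; 14; 15; 8; 12; 16; 17; 21; 18; 20; 19; 28; 3; 4; 0;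
   1; 2; 24; 27; 29; 30; 31; 32; 33; 36]
   [:: 35; 34; 26; 36; 25; 11; 10; 9; 6; 5; 7; 8; 12; 16; 23; 22; 21; 17; 15; 14; 18; 20; 19; 13; 4; 0; 1; 2;
   3; 28; 27; 24; 32; 29; 30; 31; 37; 33].

Lemma base42_ok : base_check base42.
Proof. by vm_compute. Qed.

Definition base44 : plane_base := PlaneBase 40
   [:: (0, 1); (0, 3); (0, 5); (1, 2); (1, 7); (2, 4); (2, 20); (3, 4); (3, 36); (4, 37); (5, 6); (5, 9); (6,
   12); (6, 36); (7, 8); (7, 9); (8, 11); (8, 20); (9, 10); (10, 11); (10, 12); (10, 13); (11, 15); (12, 33);
   (13, 14); (13, 17); (14, 15); (14, 18); (15, 16); (16, 19); (16, 20); (17, 23); (17, 33); (18, 19); (18,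
   23); (19, 22); (20, 21); (21, 22); (21, 37); (22, 24); (23, 24); (24, 25); (24, 27); (25, 26); (25, 37);
   (26, 27); (26, 35); (27, 28); (27, 33); (28, 29); (28, 35); (29, 30); (29, 33); (30, 31); (30, 35); (31,
   32); (31, 33); (32, 34); (32, 35); (33, 34); (34, 36); (34, 38); (35, 37); (35, 38); (36, 39); (37, 39);
   (38, 39)]
   [:: 37; 35; 38; 39]
   [:: (86, 11); (100, 72); (106, 91); (89, 7); (108, 92); (62, -38); (56, -61); (94, 71); (98, 94); (60,
   -10); (18, 4); (80, 77); (-3, -22); (-14, 33); (42, 74); (84, 93); (97, 104); (-40, 29); (56, 96); (86,
   108); (104, 106); (108, 115); (92, 112); (30, 91); (43, 108); (66, 115); (-72, 111); (-70, 98); (-103,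
   107); (-101, 93); (-109, 104); (-102, 79); (-104, 75); (-69, 9); (-78, -60); (-113, 114); (72, -80); (114,
   118); (-117, -115); (116, -117)]%coqZ 200%coqZ
   [:: 0; 1; 2; 3; 4; 5; 6; 7; 8; 9; 10; 11; 12; 13; 14; 15; 16; 17; 18; 19; 20; 21; 22; 23; 24; 25; 26; 27;
   28; 29; 30; 31; 32; 33; 34; 35; 36; 37; 41; 38; 40; 43; 42; 39]
   [:: [:: 1; 2; 4; 3; 36; 39; 43; 40; 41; 42; 38; 34; 32; 31; 30; 29; 28; 35; 26; 25; 37; 21; 22; 19; 18; 14;
   13; 17; 23; 24; 27; 33; 12; 6; 5; 9; 10; 11; 15; 16; 20; 8; 7]; [:: 0; 3; 4; 2; 20; 16; 15; 11; 8; 7; 9;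
   10; 12; 33; 27; 26; 25; 24; 23; 17; 13; 14; 18; 19; 22; 21; 37; 39; 38; 42; 43; 40; 41; 35; 28; 29; 30; 31;
   32; 34; 36; 6; 5]; [:: 0; 1; 7; 8; 11; 15; 14; 13; 17; 23; 18; 19; 16; 20; 21; 22; 24; 25; 26; 27; 33; 12;
   10; 9; 5; 6; 36; 34; 32; 31; 30; 29; 28; 35; 41; 40; 43; 42; 38; 39; 37; 4; 3]; [:: 0; 1; 2; 4; 37; 39; 38;
   42; 43; 40; 41; 35; 26; 25; 24; 23; 17; 13; 14; 18; 19; 22; 21; 20; 16; 15; 11; 8; 7; 9; 10; 12; 33; 27;
   28; 29; 30; 31; 32; 34; 36; 6; 5]; [:: 0; 1; 2; 20; 16; 15; 14; 13; 17; 23; 18; 19; 22; 21; 37; 39; 38; 42;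
   43; 40; 41; 35; 26; 25; 24; 27; 28; 29; 30; 31; 32; 34; 33; 12; 10; 11; 8; 7; 9; 5; 6; 36; 3]; [:: 0; 1; 2;
   20; 21; 22; 19; 16; 15; 11; 8; 7; 9; 10; 12; 6; 36; 34; 32; 31; 30; 29; 28; 27; 33; 17; 13; 14; 18; 23; 24;
   25; 26; 35; 41; 40; 43; 42; 38; 39; 37; 4; 3]; [:: 0; 1; 2; 4; 3; 36; 34; 32; 31; 30; 29; 28; 35; 41; 40;
   43; 42; 38; 39; 37; 21; 22; 19; 18; 14; 13; 17; 23; 24; 25; 26; 27; 33; 12; 10; 11; 15; 16; 20; 8; 7; 9;
   5]; [:: 0; 1; 2; 4; 37; 21; 22; 19; 18; 23; 17; 13; 14; 15; 16; 20; 8; 11; 10; 9; 5; 6; 12; 33; 34; 32; 31;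
   30; 29; 28; 27; 24; 25; 26; 35; 41; 40; 43; 42; 38; 39; 36; 3]; [:: 0; 1; 7; 9; 5; 6; 36; 34; 32; 31; 30;
   29; 28; 35; 41; 40; 43; 42; 38; 39; 37; 21; 22; 19; 18; 14; 13; 17; 23; 24; 25; 26; 27; 33; 12; 10; 11; 15;
   16; 20; 2; 4; 3]; [:: 0; 1; 7; 8; 11; 10; 12; 33; 34; 32; 31; 30; 29; 28; 27; 24; 25; 26; 35; 41; 40; 43;
   42; 38; 39; 37; 21; 22; 19; 18; 23; 17; 13; 14; 15; 16; 20; 2; 4; 3; 36; 6; 5]; [:: 0; 1; 2; 20; 16; 15;
   11; 8; 7; 9; 5; 6; 12; 33; 27; 28; 29; 30; 31; 32; 34; 36; 39; 38; 42; 43; 40; 41; 35; 26; 25; 24; 23; 17;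
   13; 14; 18; 19; 22; 21; 37; 4; 3]; [:: 0; 1; 2; 20; 8; 7; 9; 5; 6; 36; 39; 38; 42; 43; 40; 41; 35; 26; 25;
   24; 27; 28; 29; 30; 31; 32; 34; 33; 12; 10; 13; 17; 23; 18; 14; 15; 16; 19; 22; 21; 37; 4; 3]; [:: 0; 1; 2;
   20; 21; 22; 24; 25; 26; 27; 33; 17; 23; 18; 19; 16; 15; 14; 13; 10; 11; 8; 7; 9; 5; 6; 36; 34; 32; 31; 30;
   29; 28; 35; 41; 40; 43; 42; 38; 39; 37; 4; 3]; [:: 0; 1; 2; 20; 21; 22; 19; 16; 15; 14; 18; 23; 17; 33; 12;
   10; 11; 8; 7; 9; 5; 6; 36; 34; 32; 31; 30; 29; 28; 27; 24; 25; 26; 35; 41; 40; 43; 42; 38; 39; 37; 4; 3];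
   [:: 0; 1; 2; 20; 21; 22; 24; 25; 26; 27; 33; 12; 10; 13; 17; 23; 18; 19; 16; 15; 11; 8; 7; 9; 5; 6; 36; 34;
   32; 31; 30; 29; 28; 35; 41; 40; 43; 42; 38; 39; 37; 4; 3]; [:: 0; 1; 7; 8; 11; 10; 9; 5; 6; 12; 33; 17; 13;
   14; 18; 23; 24; 27; 28; 29; 30; 31; 32; 34; 36; 39; 38; 42; 43; 40; 41; 35; 26; 25; 37; 21; 22; 19; 16; 20;
   2; 4; 3]; [:: 0; 1; 2; 20; 21; 22; 19; 18; 23; 17; 33; 12; 10; 13; 14; 15; 11; 8; 7; 9; 5; 6; 36; 34; 32;
   31; 30; 29; 28; 27; 24; 25; 26; 35; 41; 40; 43; 42; 38; 39; 37; 4; 3]; [:: 0; 1; 2; 20; 21; 22; 19; 16; 15;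
   11; 8; 7; 9; 5; 6; 36; 34; 32; 31; 30; 29; 28; 27; 33; 12; 10; 13; 14; 18; 23; 24; 25; 26; 35; 41; 40; 43;
   42; 38; 39; 37; 4; 3]; [:: 0; 1; 2; 20; 21; 22; 19; 16; 15; 14; 13; 17; 23; 24; 25; 26; 27; 33; 12; 10; 11;
   8; 7; 9; 5; 6; 36; 34; 32; 31; 30; 29; 28; 35; 41; 40; 43; 42; 38; 39; 37; 4; 3]; [:: 0; 1; 2; 20; 16; 15;
   11; 8; 7; 9; 5; 6; 12; 10; 13; 14; 18; 23; 17; 33; 27; 28; 29; 30; 31; 32; 34; 36; 39; 38; 42; 43; 40; 41;
   35; 26; 25; 24; 22; 21; 37; 4; 3]; [:: 0; 1; 2; 4; 37; 21; 22; 19; 16; 15; 11; 8; 7; 9; 5; 6; 12; 10; 13;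
   14; 18; 23; 17; 33; 34; 32; 31; 30; 29; 28; 27; 24; 25; 26; 35; 41; 40; 43; 42; 38; 39; 36; 3]; [:: 0; 1;
   2; 20; 16; 15; 14; 13; 17; 23; 18; 19; 22; 24; 25; 26; 27; 33; 12; 10; 11; 8; 7; 9; 5; 6; 36; 34; 32; 31;
   30; 29; 28; 35; 41; 40; 43; 42; 38; 39; 37; 4; 3]; [:: 0; 1; 2; 4; 37; 21; 20; 8; 7; 9; 5; 6; 12; 10; 11;
   15; 16; 19; 18; 14; 13; 17; 23; 24; 25; 26; 27; 33; 34; 32; 31; 30; 29; 28; 35; 41; 40; 43; 42; 38; 39; 36;
   3]; [:: 0; 1; 2; 20; 8; 7; 9; 5; 6; 12; 10; 11; 15; 16; 19; 18; 14; 13; 17; 33; 27; 28; 29; 30; 31; 32; 34;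
   36; 39; 38; 42; 43; 40; 41; 35; 26; 25; 24; 22; 21; 37; 4; 3]; [:: 0; 1; 2; 20; 21; 22; 19; 16; 15; 11; 8;
   7; 9; 5; 6; 12; 10; 13; 14; 18; 23; 17; 33; 27; 28; 29; 30; 31; 32; 34; 36; 39; 38; 42; 43; 40; 41; 35; 26;
   25; 37; 4; 3]; [:: 0; 1; 2; 20; 21; 22; 24; 23; 18; 19; 16; 15; 14; 13; 17; 33; 12; 10; 11; 8; 7; 9; 5; 6;
   36; 34; 32; 31; 30; 29; 28; 27; 26; 35; 41; 40; 43; 42; 38; 39; 37; 4; 3]; [:: 0; 1; 2; 20; 21; 22; 19; 16;
   15; 11; 8; 7; 9; 5; 6; 12; 10; 13; 14; 18; 23; 17; 33; 29; 30; 31; 32; 34; 36; 39; 38; 42; 43; 40; 41; 35;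
   28; 27; 24; 25; 37; 4; 3]; [:: 0; 1; 2; 20; 8; 7; 9; 5; 6; 36; 39; 43; 40; 41; 42; 38; 34; 32; 31; 30; 29;
   28; 35; 26; 25; 24; 23; 18; 14; 13; 17; 33; 12; 10; 11; 15; 16; 19; 22; 21; 37; 4; 3]; [:: 0; 1; 2; 20; 21;
   22; 19; 16; 15; 11; 8; 7; 9; 5; 6; 12; 10; 13; 14; 18; 23; 17; 33; 29; 30; 31; 32; 34; 36; 39; 38; 42; 43;
   40; 41; 35; 26; 27; 24; 25; 37; 4; 3]; [:: 0; 1; 2; 20; 8; 7; 9; 5; 6; 36; 39; 43; 40; 41; 42; 38; 34; 32;
   31; 30; 35; 28; 27; 26; 25; 24; 23; 18; 14; 13; 17; 33; 12; 10; 11; 15; 16; 19; 22; 21; 37; 4; 3]; [:: 0;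
   1; 2; 4; 3; 36; 34; 32; 31; 33; 29; 28; 27; 26; 35; 41; 40; 43; 42; 38; 39; 37; 25; 24; 23; 17; 13; 14; 18;
   19; 22; 21; 20; 16; 15; 11; 8; 7; 9; 10; 12; 6; 5]; [:: 0; 1; 2; 20; 8; 7; 9; 5; 6; 36; 39; 43; 40; 41; 42;
   38; 34; 32; 35; 30; 29; 28; 27; 26; 25; 24; 23; 18; 14; 13; 17; 33; 12; 10; 11; 15; 16; 19; 22; 21; 37; 4;
   3]; [:: 0; 1; 2; 20; 21; 22; 19; 16; 15; 11; 8; 7; 9; 5; 6; 12; 10; 13; 14; 18; 23; 17; 33; 31; 30; 29; 28;
   27; 24; 25; 26; 35; 41; 40; 43; 42; 38; 34; 36; 39; 37; 4; 3]; [:: 0; 1; 2; 4; 3; 36; 34; 32; 31; 30; 29;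
   28; 27; 26; 35; 41; 40; 43; 42; 38; 39; 37; 25; 24; 23; 17; 13; 14; 18; 19; 22; 21; 20; 16; 15; 11; 8; 7;
   9; 10; 12; 6; 5]; [:: 0; 1; 2; 20; 8; 7; 9; 5; 6; 36; 39; 38; 42; 43; 40; 41; 35; 32; 31; 30; 29; 28; 27;
   26; 25; 24; 23; 18; 14; 13; 17; 33; 12; 10; 11; 15; 16; 19; 22; 21; 37; 4; 3]; [:: 0; 1; 2; 20; 8; 7; 9; 5;
   6; 36; 39; 43; 40; 41; 42; 38; 34; 32; 31; 30; 29; 28; 27; 26; 25; 24; 23; 18; 14; 13; 17; 33; 12; 10; 11;
   15; 16; 19; 22; 21; 37; 4; 3]; [:: 0; 1; 2; 20; 21; 22; 19; 16; 15; 11; 8; 7; 9; 5; 6; 12; 10; 13; 14; 18;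
   23; 17; 33; 27; 24; 25; 26; 35; 28; 29; 30; 31; 32; 34; 38; 42; 41; 40; 43; 39; 37; 4; 3]; [:: 0; 1; 2; 4;
   3; 36; 39; 38; 42; 43; 40; 41; 35; 28; 29; 30; 31; 32; 34; 33; 27; 26; 25; 24; 23; 17; 13; 14; 18; 19; 22;
   21; 20; 16; 15; 11; 8; 7; 9; 10; 12; 6; 5]; [:: 0; 1; 2; 20; 21; 22; 19; 16; 15; 11; 8; 7; 9; 5; 6; 12; 10;
   13; 14; 18; 23; 17; 33; 27; 24; 25; 26; 35; 28; 29; 30; 31; 32; 34; 36; 39; 43; 42; 41; 40; 37; 4; 3]; [::
   0; 1; 2; 20; 8; 7; 9; 5; 6; 36; 34; 38; 42; 43; 40; 41; 35; 32; 31; 30; 29; 28; 27; 26; 25; 24; 23; 18; 14;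
   13; 17; 33; 12; 10; 11; 15; 16; 19; 22; 21; 37; 4; 3]]
   [:: 37; 4; 3; 0; 1; 2; 20; 21; 22; 19; 16; 15; 11; 8; 7; 9; 5; 6; 12; 10; 13; 14; 18; 23; 17; 33; 27; 24;
   25; 26; 35; 28; 29; 30; 31; 32; 34; 36; 39; 38]
   [:: 35; 32; 31; 30; 29; 28; 27; 26; 25; 24; 23; 18; 14; 13; 17; 33; 12; 10; 11; 15; 16; 19; 22; 21; 37; 4;
   3; 0; 1; 2; 20; 8; 7; 9; 5; 6; 36; 34; 38; 39].

Lemma base44_ok : base_check base44.
Proof. by vm_compute. Qed.

Definition base47 : plane_base := PlaneBase 43
   [:: (0, 1); (0, 3); (0, 10); (1, 2); (1, 6); (2, 4); (2, 5); (3, 4); (3, 12); (4, 13); (5, 8); (5, 15); (6,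
   7); (6, 8); (7, 9); (7, 10); (8, 14); (9, 14); (9, 23); (10, 11); (11, 12); (11, 23); (12, 16); (13, 15);
   (13, 16); (13, 18); (14, 42); (15, 35); (15, 42); (16, 17); (17, 22); (17, 23); (18, 19); (18, 22); (19,
   20); (19, 35); (20, 21); (20, 31); (21, 22); (21, 26); (22, 25); (23, 24); (23, 38); (24, 25); (24, 32);
   (25, 28); (26, 27); (26, 28); (27, 30); (27, 31); (28, 29); (29, 30); (29, 32); (30, 34); (31, 37); (32,
   33); (33, 34); (33, 38); (34, 37); (35, 36); (35, 37); (36, 39); (36, 42); (37, 39); (37, 40); (38, 40);
   (38, 42); (39, 41); (40, 41); (41, 42)]
   [:: 41; 40; 38; 42]
   [:: (-6, -108); (46, -105); (61, -99); (3, -103); (40, -96); (75, -98); (52, -109); (7, -112); (73, -109);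
   (4, -114); (-30, -112); (-54, -113); (-31, -108); (47, -92); (80, -114); (81, -93); (-7, -100); (-50,
   -106); (23, -79); (21, -36); (-26, 0); (-35, -40); (-37, -87); (-73, -115); (-76, -105); (-66, -94); (-51,
   -22); (-50, 6); (-71, -74); (-83, -74); (-70, -28); (-42, 30); (-93, -92); (-104, -94); (-73, -22); (40,
   -33); (89, -57); (-44, 52); (-120, -124); (78, 66); (-117, 118); (123, 122); (114, -115)]%coqZ 240%coqZ
   [:: 0; 1; 2; 3; 4; 5; 6; 7; 8; 9; 10; 11; 12; 13; 14; 15; 16; 17; 18; 19; 20; 21; 22; 23; 24; 25; 26; 27;
   28; 29; 30; 31; 32; 33; 34; 35; 36; 37; 38; 39; 40; 44; 41; 43; 46; 45; 42]
   [:: [:: 1; 2; 4; 3; 12; 16; 17; 22; 21; 20; 31; 27; 26; 28; 25; 24; 32; 29; 30; 34; 33; 38; 45; 46; 43; 44;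
   40; 37; 39; 41; 42; 36; 35; 19; 18; 13; 15; 5; 8; 14; 9; 23; 11; 10; 7; 6]; [:: 0; 3; 4; 2; 5; 15; 13; 18;
   19; 35; 36; 42; 46; 45; 44; 43; 41; 39; 37; 40; 38; 33; 34; 30; 29; 32; 24; 25; 28; 26; 27; 31; 20; 21; 22;
   17; 16; 12; 11; 23; 9; 14; 8; 6; 7; 10]; [:: 0; 1; 6; 7; 10; 11; 12; 16; 17; 22; 18; 19; 35; 36; 42; 38;
   40; 44; 45; 46; 43; 41; 39; 37; 31; 20; 21; 26; 27; 30; 34; 33; 32; 29; 28; 25; 24; 23; 9; 14; 8; 5; 15;
   13; 4; 3]; [:: 0; 1; 2; 4; 13; 18; 19; 20; 21; 22; 17; 16; 12; 11; 23; 9; 14; 42; 41; 43; 46; 45; 44; 40;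
   38; 33; 34; 30; 29; 32; 24; 25; 28; 26; 27; 31; 37; 39; 36; 35; 15; 5; 8; 6; 7; 10]; [:: 0; 1; 2; 5; 15;
   35; 36; 42; 38; 40; 44; 45; 46; 43; 41; 39; 37; 31; 27; 26; 28; 29; 30; 34; 33; 32; 24; 25; 22; 21; 20; 19;
   18; 13; 16; 17; 23; 9; 14; 8; 6; 7; 10; 11; 12; 3]; [:: 0; 1; 2; 4; 3; 12; 16; 17; 22; 21; 20; 19; 18; 13;
   15; 35; 37; 31; 27; 26; 28; 25; 24; 32; 29; 30; 34; 33; 38; 40; 44; 45; 46; 43; 41; 39; 36; 42; 14; 8; 6;
   7; 9; 23; 11; 10]; [:: 0; 1; 2; 5; 8; 14; 9; 7; 10; 11; 12; 16; 17; 23; 24; 25; 28; 29; 32; 33; 34; 30; 27;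
   26; 21; 22; 18; 19; 20; 31; 37; 39; 41; 43; 46; 45; 44; 40; 38; 42; 36; 35; 15; 13; 4; 3]; [:: 0; 1; 6; 8;
   14; 9; 23; 24; 25; 28; 29; 32; 33; 34; 30; 27; 26; 21; 20; 31; 37; 39; 41; 43; 46; 45; 44; 40; 38; 42; 36;
   35; 19; 18; 22; 17; 16; 13; 15; 5; 2; 4; 3; 12; 11; 10]; [:: 0; 1; 6; 7; 10; 11; 12; 16; 17; 23; 9; 14; 42;
   41; 43; 46; 45; 44; 40; 38; 33; 34; 30; 27; 26; 28; 29; 32; 24; 25; 22; 21; 20; 31; 37; 39; 36; 35; 19; 18;
   13; 15; 5; 2; 4; 3]; [:: 0; 1; 2; 5; 15; 35; 36; 42; 14; 8; 6; 7; 10; 11; 12; 16; 17; 23; 24; 25; 22; 21;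
   26; 28; 29; 32; 33; 38; 40; 44; 45; 46; 43; 41; 39; 37; 34; 30; 27; 31; 20; 19; 18; 13; 4; 3]; [:: 0; 1; 2;
   5; 8; 6; 7; 9; 14; 42; 15; 35; 36; 39; 41; 43; 46; 45; 44; 40; 38; 33; 34; 37; 31; 27; 30; 29; 32; 24; 25;
   28; 26; 21; 20; 19; 18; 22; 17; 23; 11; 12; 16; 13; 4; 3]; [:: 0; 1; 2; 4; 3; 12; 16; 17; 22; 21; 20; 31;
   27; 26; 28; 25; 24; 23; 9; 14; 42; 38; 33; 32; 29; 30; 34; 37; 40; 44; 45; 46; 43; 41; 39; 36; 35; 19; 18;
   13; 15; 5; 8; 6; 7; 10]; [:: 0; 1; 2; 5; 8; 6; 7; 10; 11; 23; 9; 14; 42; 15; 35; 36; 39; 41; 43; 46; 45;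
   44; 40; 38; 33; 34; 37; 31; 27; 30; 29; 32; 24; 25; 28; 26; 21; 20; 19; 18; 22; 17; 16; 13; 4; 3]; [:: 0;
   1; 6; 8; 14; 9; 7; 10; 11; 12; 16; 17; 23; 24; 25; 28; 29; 32; 33; 34; 30; 27; 26; 21; 22; 18; 19; 20; 31;
   37; 39; 41; 43; 46; 45; 44; 40; 38; 42; 36; 35; 15; 5; 2; 4; 3]; [:: 0; 1; 2; 4; 3; 12; 16; 17; 22; 21; 20;
   31; 27; 26; 28; 25; 24; 32; 29; 30; 34; 33; 38; 40; 37; 39; 41; 43; 44; 45; 46; 42; 36; 35; 19; 18; 13; 15;
   5; 8; 6; 7; 9; 23; 11; 10]; [:: 0; 1; 2; 5; 8; 6; 7; 10; 11; 12; 16; 17; 23; 9; 14; 42; 36; 39; 41; 43; 46;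
   45; 44; 40; 38; 33; 34; 30; 27; 26; 28; 29; 32; 24; 25; 22; 21; 20; 31; 37; 35; 19; 18; 13; 4; 3]; [:: 0;
   1; 2; 4; 13; 18; 19; 20; 21; 22; 17; 23; 9; 14; 42; 41; 43; 46; 45; 44; 40; 38; 33; 34; 30; 29; 32; 24; 25;
   28; 26; 27; 31; 37; 39; 36; 35; 15; 5; 8; 6; 7; 10; 11; 12; 3]; [:: 0; 1; 2; 5; 15; 35; 36; 42; 38; 40; 44;
   45; 46; 43; 41; 39; 37; 31; 20; 19; 18; 22; 21; 26; 27; 30; 34; 33; 32; 29; 28; 25; 24; 23; 9; 14; 8; 6; 7;
   10; 11; 12; 16; 13; 4; 3]; [:: 0; 1; 2; 5; 8; 6; 7; 10; 11; 12; 16; 17; 22; 21; 20; 19; 35; 36; 39; 41; 43;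
   46; 45; 44; 40; 38; 33; 32; 29; 30; 34; 37; 31; 27; 26; 28; 25; 24; 23; 9; 14; 42; 15; 13; 4; 3]; [:: 0; 1;
   2; 5; 15; 35; 36; 42; 38; 40; 44; 45; 46; 43; 41; 39; 37; 31; 20; 21; 26; 27; 30; 34; 33; 32; 29; 28; 25;
   24; 23; 9; 14; 8; 6; 7; 10; 11; 12; 16; 17; 22; 18; 13; 4; 3]; [:: 0; 1; 2; 5; 8; 6; 7; 10; 11; 12; 16; 17;
   23; 9; 14; 42; 36; 39; 41; 43; 46; 45; 44; 40; 38; 33; 34; 37; 31; 27; 30; 29; 32; 24; 25; 28; 26; 21; 22;
   18; 19; 35; 15; 13; 4; 3]; [:: 0; 1; 2; 5; 8; 6; 7; 10; 11; 12; 16; 17; 23; 9; 14; 42; 41; 43; 46; 45; 44;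
   40; 38; 33; 34; 30; 27; 26; 28; 29; 32; 24; 25; 22; 18; 19; 20; 31; 37; 39; 36; 35; 15; 13; 4; 3]; [:: 0;
   1; 2; 5; 8; 6; 7; 10; 11; 12; 16; 17; 23; 9; 14; 42; 15; 35; 36; 39; 41; 43; 46; 45; 44; 40; 38; 33; 34;
   37; 31; 27; 30; 29; 32; 24; 25; 28; 26; 21; 20; 19; 18; 13; 4; 3]; [:: 0; 1; 6; 8; 14; 9; 7; 10; 11; 12;
   16; 17; 22; 21; 20; 31; 27; 26; 28; 25; 24; 32; 29; 30; 34; 33; 38; 45; 46; 43; 44; 40; 37; 39; 41; 42; 36;
   35; 19; 18; 13; 15; 5; 2; 4; 3]; [:: 0; 1; 2; 5; 8; 6; 7; 10; 11; 12; 16; 17; 23; 9; 14; 42; 15; 35; 36;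
   39; 41; 43; 46; 45; 44; 40; 38; 33; 32; 29; 30; 34; 37; 31; 27; 26; 28; 25; 22; 21; 20; 19; 18; 13; 4; 3];
   [:: 0; 1; 2; 5; 8; 6; 7; 10; 11; 12; 16; 17; 22; 18; 19; 20; 21; 26; 28; 29; 32; 24; 23; 9; 14; 42; 41; 43;
   46; 45; 44; 40; 38; 33; 34; 30; 27; 31; 37; 39; 36; 35; 15; 13; 4; 3]; [:: 0; 1; 2; 5; 15; 35; 36; 42; 38;
   40; 44; 45; 46; 43; 41; 39; 37; 31; 27; 30; 34; 33; 32; 29; 28; 25; 24; 23; 9; 14; 8; 6; 7; 10; 11; 12; 16;
   17; 22; 21; 20; 19; 18; 13; 4; 3]; [:: 0; 1; 2; 5; 8; 6; 7; 10; 11; 12; 16; 17; 23; 9; 14; 42; 41; 43; 46;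
   45; 44; 40; 38; 33; 34; 30; 29; 32; 24; 25; 28; 26; 21; 22; 18; 19; 20; 31; 37; 39; 36; 35; 15; 13; 4; 3];
   [:: 0; 1; 2; 5; 8; 6; 7; 10; 11; 12; 16; 17; 23; 9; 14; 42; 36; 39; 41; 43; 46; 45; 44; 40; 38; 33; 34; 37;
   31; 20; 21; 26; 27; 30; 29; 32; 24; 25; 22; 18; 19; 35; 15; 13; 4; 3]; [:: 0; 1; 2; 5; 8; 6; 7; 10; 11; 12;
   16; 17; 23; 9; 14; 42; 36; 39; 41; 43; 46; 45; 44; 40; 38; 33; 32; 24; 25; 28; 26; 27; 30; 34; 37; 31; 20;
   21; 22; 18; 19; 35; 15; 13; 4; 3]; [:: 0; 1; 2; 5; 8; 6; 7; 10; 11; 12; 16; 17; 22; 18; 19; 20; 21; 26; 27;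
   31; 37; 34; 33; 32; 29; 28; 25; 24; 23; 9; 14; 42; 38; 40; 44; 45; 46; 43; 41; 39; 36; 35; 15; 13; 4; 3];
   [:: 0; 1; 2; 5; 8; 6; 7; 10; 11; 12; 16; 17; 22; 18; 19; 20; 21; 26; 27; 30; 34; 37; 39; 41; 43; 46; 45;
   44; 40; 38; 33; 32; 29; 28; 25; 24; 23; 9; 14; 42; 36; 35; 15; 13; 4; 3]; [:: 0; 1; 2; 5; 8; 6; 7; 10; 11;
   12; 16; 17; 22; 18; 19; 20; 21; 26; 27; 31; 37; 39; 41; 43; 46; 45; 44; 40; 38; 33; 34; 30; 29; 28; 25; 24;
   23; 9; 14; 42; 36; 35; 15; 13; 4; 3]; [:: 0; 1; 2; 5; 15; 42; 41; 43; 46; 45; 44; 40; 38; 23; 9; 14; 8; 6;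
   7; 10; 11; 12; 16; 17; 22; 21; 20; 31; 27; 26; 28; 25; 24; 32; 29; 30; 34; 37; 39; 36; 35; 19; 18; 13; 4;
   3]; [:: 0; 1; 2; 5; 8; 6; 7; 10; 11; 12; 16; 17; 23; 9; 14; 42; 41; 43; 46; 45; 44; 40; 38; 33; 32; 24; 25;
   28; 29; 30; 27; 26; 21; 22; 18; 19; 20; 31; 37; 39; 36; 35; 15; 13; 4; 3]; [:: 0; 1; 2; 5; 15; 42; 36; 39;
   41; 43; 46; 45; 44; 40; 38; 33; 34; 37; 31; 27; 30; 29; 32; 24; 25; 28; 26; 21; 20; 19; 18; 22; 17; 23; 9;
   14; 8; 6; 7; 10; 11; 12; 16; 13; 4; 3]; [:: 0; 1; 2; 5; 8; 6; 7; 10; 11; 12; 16; 17; 23; 9; 14; 42; 46; 45;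
   44; 43; 41; 39; 37; 40; 38; 33; 34; 30; 29; 32; 24; 25; 28; 26; 27; 31; 20; 21; 22; 18; 19; 35; 15; 13; 4;
   3]; [:: 0; 1; 2; 5; 8; 6; 7; 10; 11; 12; 16; 17; 23; 9; 14; 42; 36; 39; 41; 43; 46; 45; 44; 40; 38; 33; 34;
   30; 29; 32; 24; 25; 28; 26; 27; 31; 20; 21; 22; 18; 19; 35; 15; 13; 4; 3]; [:: 0; 1; 2; 5; 8; 6; 7; 10; 11;
   12; 16; 17; 22; 18; 19; 35; 36; 39; 41; 43; 46; 45; 44; 40; 37; 31; 20; 21; 26; 27; 30; 34; 33; 32; 29; 28;
   25; 24; 23; 9; 14; 42; 15; 13; 4; 3]; [:: 0; 1; 2; 5; 15; 35; 36; 42; 41; 43; 46; 45; 44; 40; 38; 33; 34;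
   37; 31; 27; 30; 29; 32; 24; 25; 28; 26; 21; 20; 19; 18; 22; 17; 23; 9; 14; 8; 6; 7; 10; 11; 12; 16; 13; 4;
   3]; [:: 0; 1; 2; 5; 8; 6; 7; 10; 11; 12; 16; 17; 22; 18; 19; 20; 21; 26; 28; 25; 24; 32; 29; 30; 27; 31;
   37; 34; 33; 38; 23; 9; 14; 42; 46; 45; 44; 43; 41; 39; 36; 35; 15; 13; 4; 3]; [:: 0; 1; 2; 5; 8; 6; 7; 10;
   11; 12; 16; 17; 23; 9; 14; 42; 36; 39; 37; 40; 44; 43; 46; 45; 38; 33; 34; 30; 29; 32; 24; 25; 28; 26; 27;
   31; 20; 21; 22; 18; 19; 35; 15; 13; 4; 3]; [:: 0; 1; 2; 5; 15; 35; 36; 39; 41; 43; 46; 45; 44; 40; 38; 33;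
   34; 37; 31; 27; 30; 29; 32; 24; 25; 28; 26; 21; 20; 19; 18; 22; 17; 23; 9; 14; 8; 6; 7; 10; 11; 12; 16; 13;
   4; 3]]
   [:: 41; 40; 37; 39; 36; 42; 14; 9; 23; 17; 16; 12; 11; 10; 7; 6; 8; 5; 2; 1; 0; 3; 4; 13; 15; 35; 19; 18;
   22; 21; 20; 31; 27; 26; 28; 25; 24; 32; 29; 30; 34; 33; 38]
   [:: 40; 41; 39; 36; 35; 15; 13; 4; 3; 0; 1; 2; 5; 8; 6; 7; 10; 11; 12; 16; 17; 22; 18; 19; 20; 21; 26; 28;
   25; 24; 32; 29; 30; 27; 31; 37; 34; 33; 38; 23; 9; 14; 42].

Lemma base47_ok : base_check base47.
Proof. by vm_compute. Qed.

Definition base49 : plane_base := PlaneBase 45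
   [:: (0, 1); (0, 4); (0, 11); (1, 2); (1, 5); (2, 3); (2, 6); (3, 4); (3, 8); (4, 10); (5, 7); (5, 17); (6,
   9); (6, 17); (7, 11); (7, 19); (8, 9); (8, 15); (9, 13); (10, 12); (10, 15); (11, 12); (11, 34); (12, 39);
   (13, 14); (13, 25); (14, 17); (14, 20); (15, 16); (15, 25); (16, 26); (16, 39); (17, 18); (18, 19); (18,
   24); (19, 22); (20, 21); (20, 24); (21, 25); (21, 27); (22, 23); (22, 34); (23, 24); (23, 33); (24, 31);
   (25, 28); (26, 28); (26, 40); (27, 29); (27, 31); (28, 29); (29, 30); (30, 32); (30, 40); (31, 32); (32,
   33); (33, 35); (33, 43); (34, 35); (34, 37); (35, 36); (36, 37); (36, 43); (37, 38); (37, 39); (38, 41);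
   (38, 43); (39, 41); (39, 44); (40, 43); (40, 44); (41, 42); (42, 43); (42, 44)]
   [:: 40; 44; 42; 43]
   [:: (-20, 33); (-7, 31); (7, 49); (2, 71); (-27, 60); (21, 6); (70, 35); (8, 5); (30, 88); (65, 82); (-38,
   65); (-22, 25); (-61, 58); (98, 90); (110, 31); (27, 95); (23, 101); (94, -16); (118, -52); (96, -62);
   (126, -15); (123, 85); (116, -85); (134, -95); (132, -59); (105, 111); (125, 139); (140, 90); (125, 129);
   (144, 115); (151, 118); (142, 9); (145, 5); (141, -109); (76, -73); (124, -111); (123, -124); (45, -62);
   (82, -123); (-80, 66); (155, 153); (-95, -107); (-152, -154); (146, -147); (-149, 147)]%coqZ 260%coqZ
   [:: 0; 1; 2; 3; 4; 5; 6; 7; 8; 9; 10; 11; 12; 13; 14; 15; 16; 17; 18; 19; 20; 21; 22; 23; 24; 25; 26; 27;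
   28; 29; 30; 31; 32; 33; 34; 35; 36; 37; 38; 39; 40; 41; 42; 43; 48; 44; 46; 45; 47]
   [:: [:: 1; 2; 3; 4; 10; 15; 8; 9; 6; 17; 14; 13; 25; 21; 20; 24; 18; 19; 22; 23; 33; 35; 34; 37; 36; 43;
   38; 41; 42; 47; 48; 45; 46; 44; 40; 30; 32; 31; 27; 29; 28; 26; 16; 39; 12; 11; 7; 5]; [:: 0; 4; 3; 2; 6;
   9; 8; 15; 10; 12; 39; 16; 26; 28; 29; 30; 32; 31; 27; 21; 25; 13; 14; 20; 24; 23; 33; 43; 48; 47; 46; 45;
   40; 44; 42; 41; 38; 37; 36; 35; 34; 22; 19; 18; 17; 5; 7; 11]; [:: 0; 1; 5; 7; 11; 12; 10; 15; 16; 39; 37;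
   36; 43; 38; 41; 42; 47; 48; 45; 46; 44; 40; 26; 28; 29; 30; 32; 31; 27; 21; 25; 13; 14; 20; 24; 23; 33; 35;
   34; 22; 19; 18; 17; 6; 9; 8; 3; 4]; [:: 0; 1; 2; 6; 9; 8; 15; 16; 39; 37; 36; 43; 38; 41; 42; 47; 48; 45;
   46; 44; 40; 26; 28; 29; 30; 32; 31; 27; 21; 25; 13; 14; 20; 24; 23; 33; 35; 34; 22; 19; 18; 17; 5; 7; 11;
   12; 10; 4]; [:: 0; 1; 2; 3; 8; 9; 6; 17; 5; 7; 19; 18; 24; 31; 32; 30; 29; 27; 21; 20; 14; 13; 25; 28; 26;
   40; 44; 46; 45; 48; 47; 42; 41; 38; 43; 33; 23; 22; 34; 35; 36; 37; 39; 16; 15; 10; 12; 11]; [:: 0; 1; 2;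
   6; 9; 13; 25; 21; 27; 31; 32; 33; 43; 38; 41; 42; 47; 48; 45; 46; 44; 40; 30; 29; 28; 26; 16; 39; 37; 36;
   35; 34; 22; 23; 24; 20; 14; 17; 18; 19; 7; 11; 12; 10; 15; 8; 3; 4]; [:: 0; 1; 2; 3; 8; 9; 13; 25; 15; 16;
   39; 37; 36; 35; 34; 22; 19; 18; 24; 23; 33; 43; 38; 41; 42; 47; 48; 45; 46; 44; 40; 26; 28; 29; 30; 32; 31;
   27; 21; 20; 14; 17; 5; 7; 11; 12; 10; 4]; [:: 0; 1; 5; 17; 14; 13; 25; 21; 20; 24; 18; 19; 22; 23; 33; 43;
   38; 41; 42; 47; 48; 45; 46; 44; 40; 30; 32; 31; 27; 29; 28; 26; 16; 39; 37; 36; 35; 34; 11; 12; 10; 15; 8;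
   9; 6; 2; 3; 4]; [:: 0; 1; 5; 7; 11; 12; 10; 15; 16; 39; 37; 36; 35; 34; 22; 19; 18; 17; 14; 20; 24; 23; 33;
   43; 38; 41; 42; 47; 48; 45; 46; 44; 40; 26; 28; 29; 30; 32; 31; 27; 21; 25; 13; 9; 6; 2; 3; 4]; [:: 0; 1;
   2; 6; 17; 5; 7; 11; 34; 35; 36; 37; 38; 41; 42; 44; 40; 45; 46; 47; 48; 43; 33; 23; 22; 19; 18; 24; 20; 14;
   13; 25; 21; 27; 31; 32; 30; 29; 28; 26; 16; 39; 12; 10; 15; 8; 3; 4]; [:: 0; 1; 2; 6; 9; 13; 25; 21; 20;
   14; 17; 5; 7; 11; 12; 39; 37; 36; 35; 34; 22; 19; 18; 24; 23; 33; 43; 38; 41; 42; 47; 48; 45; 46; 44; 40;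
   30; 32; 31; 27; 29; 28; 26; 16; 15; 8; 3; 4]; [:: 0; 1; 2; 6; 9; 13; 25; 21; 20; 14; 17; 5; 7; 19; 18; 24;
   23; 22; 34; 37; 36; 35; 33; 43; 38; 41; 42; 47; 48; 45; 46; 44; 40; 30; 32; 31; 27; 29; 28; 26; 16; 39; 12;
   10; 15; 8; 3; 4]; [:: 0; 1; 2; 3; 8; 9; 6; 17; 5; 7; 11; 34; 22; 19; 18; 24; 23; 33; 35; 36; 37; 38; 41;
   42; 43; 40; 45; 48; 47; 46; 44; 39; 16; 26; 28; 29; 30; 32; 31; 27; 21; 20; 14; 13; 25; 15; 10; 4]; [:: 0;
   1; 5; 17; 14; 20; 21; 25; 28; 26; 16; 39; 37; 36; 43; 38; 41; 42; 47; 48; 45; 46; 44; 40; 30; 29; 27; 31;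
   32; 33; 35; 34; 22; 23; 24; 18; 19; 7; 11; 12; 10; 15; 8; 9; 6; 2; 3; 4]; [:: 0; 1; 2; 6; 9; 13; 25; 21;
   20; 24; 23; 33; 43; 38; 41; 42; 47; 48; 45; 46; 44; 40; 30; 32; 31; 27; 29; 28; 26; 16; 39; 37; 36; 35; 34;
   22; 19; 18; 17; 5; 7; 11; 12; 10; 15; 8; 3; 4]; [:: 0; 1; 2; 3; 8; 9; 6; 17; 5; 7; 11; 34; 35; 36; 37; 38;
   41; 42; 44; 40; 45; 46; 47; 48; 43; 33; 23; 22; 19; 18; 24; 31; 32; 30; 29; 27; 21; 20; 14; 13; 25; 28; 26;
   16; 39; 12; 10; 4]; [:: 0; 1; 2; 6; 9; 13; 25; 21; 27; 31; 32; 30; 29; 28; 26; 40; 44; 46; 45; 48; 47; 42;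
   41; 38; 43; 33; 23; 22; 19; 18; 24; 20; 14; 17; 5; 7; 11; 34; 35; 36; 37; 39; 12; 10; 15; 8; 3; 4]; [:: 0;
   1; 5; 7; 11; 34; 35; 36; 37; 38; 41; 42; 44; 40; 45; 46; 47; 48; 43; 33; 23; 22; 19; 18; 24; 20; 14; 13;
   25; 21; 27; 31; 32; 30; 29; 28; 26; 16; 39; 12; 10; 15; 8; 9; 6; 2; 3; 4]; [:: 0; 1; 2; 6; 9; 13; 25; 21;
   27; 31; 32; 30; 29; 28; 26; 16; 39; 37; 38; 41; 42; 44; 40; 45; 46; 47; 48; 43; 36; 35; 33; 23; 24; 20; 14;
   17; 5; 7; 19; 22; 34; 11; 12; 10; 15; 8; 3; 4]; [:: 0; 1; 2; 6; 9; 13; 14; 20; 21; 25; 28; 26; 16; 39; 37;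
   36; 43; 38; 41; 42; 47; 48; 45; 46; 44; 40; 30; 29; 27; 31; 32; 33; 35; 34; 22; 23; 24; 18; 17; 5; 7; 11;
   12; 10; 15; 8; 3; 4]; [:: 0; 1; 2; 6; 9; 13; 14; 17; 5; 7; 11; 34; 35; 36; 37; 38; 41; 42; 44; 40; 45; 46;
   47; 48; 43; 33; 23; 22; 19; 18; 24; 31; 32; 30; 29; 27; 21; 25; 28; 26; 16; 39; 12; 10; 15; 8; 3; 4]; [::
   0; 1; 2; 6; 9; 13; 25; 28; 26; 16; 39; 37; 34; 35; 36; 43; 38; 41; 42; 47; 48; 45; 46; 44; 40; 30; 29; 27;
   31; 32; 33; 23; 22; 19; 18; 24; 20; 14; 17; 5; 7; 11; 12; 10; 15; 8; 3; 4]; [:: 0; 1; 2; 6; 9; 13; 25; 21;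
   20; 14; 17; 5; 7; 19; 18; 24; 23; 33; 43; 38; 41; 42; 47; 48; 45; 46; 44; 40; 30; 32; 31; 27; 29; 28; 26;
   16; 39; 37; 36; 35; 34; 11; 12; 10; 15; 8; 3; 4]; [:: 0; 1; 2; 6; 9; 13; 25; 21; 27; 31; 32; 33; 43; 38;
   41; 42; 47; 48; 45; 46; 44; 40; 30; 29; 28; 26; 16; 39; 37; 36; 35; 34; 22; 19; 18; 24; 20; 14; 17; 5; 7;
   11; 12; 10; 15; 8; 3; 4]; [:: 0; 1; 2; 6; 9; 13; 14; 20; 21; 25; 28; 26; 16; 39; 37; 34; 35; 36; 43; 38;
   41; 42; 47; 48; 45; 46; 44; 40; 30; 29; 27; 31; 32; 33; 23; 22; 19; 18; 17; 5; 7; 11; 12; 10; 15; 8; 3; 4];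
   [:: 0; 1; 2; 6; 9; 13; 14; 20; 21; 27; 29; 28; 26; 16; 39; 37; 36; 43; 38; 41; 42; 47; 48; 45; 46; 44; 40;
   30; 32; 31; 24; 23; 33; 35; 34; 22; 19; 18; 17; 5; 7; 11; 12; 10; 15; 8; 3; 4]; [:: 0; 1; 2; 6; 17; 5; 7;
   11; 12; 10; 15; 16; 39; 37; 36; 35; 34; 22; 19; 18; 24; 23; 33; 43; 38; 41; 42; 47; 48; 45; 46; 44; 40; 30;
   32; 31; 27; 29; 28; 25; 21; 20; 14; 13; 9; 8; 3; 4]; [:: 0; 1; 2; 6; 9; 13; 14; 20; 21; 25; 28; 29; 30; 32;
   31; 24; 23; 33; 43; 38; 41; 42; 47; 48; 45; 46; 44; 40; 26; 16; 39; 37; 36; 35; 34; 22; 19; 18; 17; 5; 7;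
   11; 12; 10; 15; 8; 3; 4]; [:: 0; 1; 2; 3; 8; 9; 6; 17; 5; 7; 11; 12; 39; 16; 26; 40; 44; 46; 45; 48; 47;
   42; 41; 38; 43; 36; 37; 34; 35; 33; 23; 22; 19; 18; 24; 31; 32; 30; 29; 27; 21; 20; 14; 13; 25; 15; 10; 4];
   [:: 0; 1; 2; 6; 9; 13; 25; 28; 26; 16; 39; 37; 36; 35; 34; 22; 19; 18; 24; 23; 33; 43; 38; 41; 42; 47; 48;
   45; 46; 44; 40; 30; 32; 31; 27; 21; 20; 14; 17; 5; 7; 11; 12; 10; 15; 8; 3; 4]; [:: 0; 1; 2; 6; 17; 5; 7;
   11; 12; 10; 15; 16; 26; 40; 44; 42; 47; 46; 45; 48; 43; 38; 41; 39; 37; 36; 35; 34; 22; 19; 18; 24; 23; 33;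
   32; 31; 27; 29; 28; 25; 21; 20; 14; 13; 9; 8; 3; 4]; [:: 0; 1; 2; 6; 9; 13; 25; 28; 26; 16; 39; 37; 38; 41;
   42; 44; 40; 45; 46; 47; 48; 43; 36; 35; 34; 22; 19; 18; 24; 23; 33; 32; 30; 29; 27; 21; 20; 14; 17; 5; 7;
   11; 12; 10; 15; 8; 3; 4]; [:: 0; 1; 2; 6; 9; 13; 14; 20; 21; 25; 28; 26; 16; 39; 37; 36; 43; 38; 41; 42;
   47; 48; 45; 46; 44; 40; 30; 29; 27; 31; 24; 23; 33; 35; 34; 22; 19; 18; 17; 5; 7; 11; 12; 10; 15; 8; 3; 4];
   [:: 0; 1; 5; 17; 14; 20; 21; 25; 13; 9; 6; 2; 3; 8; 15; 16; 26; 28; 29; 27; 31; 32; 30; 40; 44; 42; 47; 46;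
   45; 48; 43; 38; 41; 39; 37; 36; 35; 34; 22; 23; 24; 18; 19; 7; 11; 12; 10; 4]; [:: 0; 1; 2; 6; 9; 13; 25;
   21; 27; 31; 32; 30; 29; 28; 26; 16; 39; 37; 38; 41; 42; 44; 40; 45; 46; 47; 48; 43; 36; 35; 33; 23; 22; 19;
   18; 24; 20; 14; 17; 5; 7; 11; 12; 10; 15; 8; 3; 4]; [:: 0; 1; 2; 6; 9; 13; 25; 28; 29; 30; 40; 26; 16; 39;
   44; 46; 45; 48; 47; 42; 41; 38; 43; 36; 37; 34; 22; 19; 18; 24; 23; 33; 32; 31; 27; 21; 20; 14; 17; 5; 7;
   11; 12; 10; 15; 8; 3; 4]; [:: 0; 1; 2; 6; 9; 13; 25; 21; 27; 31; 32; 30; 29; 28; 26; 16; 39; 41; 42; 44;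
   40; 45; 46; 47; 48; 43; 38; 37; 34; 35; 33; 23; 22; 19; 18; 24; 20; 14; 17; 5; 7; 11; 12; 10; 15; 8; 3; 4];
   [:: 0; 1; 2; 6; 9; 13; 25; 28; 29; 30; 40; 26; 16; 39; 44; 46; 45; 48; 47; 42; 41; 38; 43; 36; 35; 34; 22;
   19; 18; 24; 23; 33; 32; 31; 27; 21; 20; 14; 17; 5; 7; 11; 12; 10; 15; 8; 3; 4]; [:: 0; 1; 2; 6; 9; 13; 25;
   21; 27; 31; 32; 30; 29; 28; 26; 16; 39; 41; 42; 44; 40; 45; 46; 47; 48; 43; 36; 37; 34; 35; 33; 23; 22; 19;
   18; 24; 20; 14; 17; 5; 7; 11; 12; 10; 15; 8; 3; 4]; [:: 0; 1; 5; 17; 14; 20; 21; 25; 13; 9; 6; 2; 3; 8; 15;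
   16; 26; 28; 29; 27; 31; 32; 30; 40; 44; 46; 45; 48; 47; 42; 41; 38; 37; 36; 43; 33; 35; 34; 22; 23; 24; 18;
   19; 7; 11; 12; 10; 4]; [:: 0; 1; 2; 6; 9; 13; 25; 21; 27; 31; 32; 30; 29; 28; 26; 16; 39; 44; 46; 45; 48;
   47; 42; 41; 38; 43; 36; 37; 34; 35; 33; 23; 22; 19; 18; 24; 20; 14; 17; 5; 7; 11; 12; 10; 15; 8; 3; 4]; [::
   0; 1; 2; 6; 9; 13; 25; 28; 29; 30; 40; 26; 16; 39; 44; 42; 47; 46; 45; 48; 43; 38; 37; 36; 35; 34; 22; 19;
   18; 24; 23; 33; 32; 31; 27; 21; 20; 14; 17; 5; 7; 11; 12; 10; 15; 8; 3; 4]; [:: 0; 1; 5; 17; 14; 20; 21;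
   25; 13; 9; 6; 2; 3; 8; 15; 16; 26; 28; 29; 27; 31; 32; 30; 40; 45; 48; 47; 46; 44; 39; 41; 38; 37; 36; 43;
   33; 35; 34; 22; 23; 24; 18; 19; 7; 11; 12; 10; 4]; [:: 0; 1; 2; 6; 9; 13; 25; 28; 29; 30; 40; 26; 16; 39;
   44; 46; 45; 48; 47; 42; 41; 38; 37; 36; 35; 34; 22; 19; 18; 24; 23; 33; 32; 31; 27; 21; 20; 14; 17; 5; 7;
   11; 12; 10; 15; 8; 3; 4]; [:: 0; 1; 2; 6; 9; 13; 25; 28; 29; 30; 40; 26; 16; 39; 37; 38; 41; 42; 47; 46;
   45; 48; 43; 36; 35; 34; 22; 19; 18; 24; 23; 33; 32; 31; 27; 21; 20; 14; 17; 5; 7; 11; 12; 10; 15; 8; 3; 4]]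
   [:: 40; 44; 39; 16; 26; 28; 29; 30; 32; 31; 27; 21; 25; 13; 9; 6; 2; 1; 0; 4; 3; 8; 15; 10; 12; 11; 7; 5;
   17; 14; 20; 24; 18; 19; 22; 23; 33; 35; 34; 37; 36; 43; 38; 41; 42]
   [:: 44; 42; 41; 38; 37; 39; 16; 26; 40; 30; 29; 28; 25; 13; 9; 6; 2; 1; 0; 4; 3; 8; 15; 10; 12; 11; 7; 5;
   17; 14; 20; 21; 27; 31; 32; 33; 23; 24; 18; 19; 22; 34; 35; 36; 43].

Lemma base49_ok : base_check base49.
Proof. by vm_compute. Qed.

Lemma solo43_ok : solo_check 43
   [:: (0, 1); (0, 2); (0, 16); (1, 4); (1, 13); (2, 3); (2, 9); (3, 4); (3, 5); (4, 23); (5, 6); (5, 7); (6,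
   8); (6, 23); (7, 9); (7, 11); (8, 11); (8, 22); (9, 10); (10, 12); (10, 16); (11, 12); (12, 17); (13, 14);
   (13, 15); (14, 16); (14, 18); (15, 23); (15, 34); (16, 20); (17, 20); (17, 21); (17, 22); (18, 19); (18,
   34); (19, 20); (19, 37); (20, 25); (21, 25); (21, 27); (22, 24); (22, 27); (23, 24); (23, 32); (24, 28);
   (25, 26); (26, 27); (26, 38); (27, 30); (28, 29); (28, 30); (29, 31); (29, 32); (30, 38); (30, 41); (31,
   35); (31, 41); (32, 33); (33, 34); (33, 35); (34, 36); (35, 42); (36, 37); (36, 42); (37, 39); (38, 39);
   (39, 40); (40, 41); (40, 42)]
   [:: (57, 26); (50, 18); (27, 40); (18, 29); (30, 13); (-13, 25); (-23, -3); (-24, 36); (-40, -11); (1, 59);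
   (1, 80); (-54, 19); (-76, 26); (55, 7); (65, 8); (38, -6); (76, 24); (-48, -64); (53, -21); (46, -49); (46,
   -65); (-24, -61); (-35, -46); (2, -15); (-21, -37); (18, -62); (6, -58); (-21, -53); (-14, -39); (-4, -35);
   (-9, -49); (4, -39); (7, -23); (29, -25); (42, -22); (25, -33); (38, -38); (39, -46); (7, -53); (27, -48);
   (21, -45); (2, -45); (30, -39)]%coqZ
   [:: 0; 1; 2; 3; 4; 5; 6; 7; 8; 9; 10; 11; 12; 13; 14; 15; 16; 17; 18; 19; 20; 21; 22; 23; 24; 25; 26; 27;
   28; 29; 30; 31; 32; 33; 34; 35; 36; 37; 38; 39; 40; 41; 42]
   [:: [:: 1; 4; 3; 2; 9; 7; 5; 6; 23; 15; 34; 18; 19; 20; 17; 21; 25; 26; 27; 30; 38; 39; 37; 36; 42; 40; 41;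
   31; 35; 33; 32; 29; 28; 24; 22; 8; 11; 12; 10; 16; 14; 13]; [:: 0; 2; 3; 4; 23; 15; 13; 14; 18; 19; 20; 25;
   26; 38; 39; 37; 36; 34; 33; 32; 29; 31; 35; 42; 40; 41; 30; 28; 24; 22; 27; 21; 17; 12; 11; 8; 6; 5; 7; 9;
   10; 16]; [:: 0; 1; 4; 3; 5; 6; 8; 22; 27; 21; 25; 26; 38; 30; 41; 31; 35; 42; 40; 39; 37; 36; 34; 33; 32;
   29; 28; 24; 23; 15; 13; 14; 18; 19; 20; 17; 12; 11; 7; 9; 10; 16]; [:: 0; 1; 4; 23; 24; 22; 27; 30; 28; 29;
   32; 33; 35; 31; 41; 40; 42; 36; 37; 39; 38; 26; 25; 21; 17; 20; 19; 18; 34; 15; 13; 14; 16; 10; 12; 11; 8;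
   6; 5; 7; 9; 2]; [:: 0; 1; 13; 14; 16; 10; 9; 7; 11; 12; 17; 21; 27; 30; 28; 29; 32; 33; 35; 31; 41; 40; 42;
   36; 37; 39; 38; 26; 25; 20; 19; 18; 34; 15; 23; 24; 22; 8; 6; 5; 3; 2]; [:: 0; 1; 13; 15; 34; 18; 14; 16;
   10; 9; 7; 11; 12; 17; 20; 19; 37; 36; 42; 40; 39; 38; 26; 25; 21; 27; 30; 41; 31; 35; 33; 32; 29; 28; 24;
   22; 8; 6; 23; 4; 3; 2]; [:: 0; 1; 4; 23; 24; 22; 8; 11; 12; 17; 21; 27; 30; 28; 29; 32; 33; 35; 31; 41; 40;
   42; 36; 37; 39; 38; 26; 25; 20; 19; 18; 34; 15; 13; 14; 16; 10; 9; 7; 5; 3; 2]; [:: 0; 1; 4; 3; 5; 6; 23;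
   24; 22; 8; 11; 12; 17; 21; 27; 30; 28; 29; 32; 33; 35; 31; 41; 40; 42; 36; 37; 39; 38; 26; 25; 20; 19; 18;
   34; 15; 13; 14; 16; 10; 9; 2]; [:: 0; 1; 4; 3; 5; 6; 23; 24; 22; 27; 30; 28; 29; 32; 33; 35; 31; 41; 40;
   42; 36; 37; 39; 38; 26; 25; 21; 17; 20; 19; 18; 34; 15; 13; 14; 16; 10; 12; 11; 7; 9; 2]; [:: 0; 1; 4; 23;
   6; 8; 22; 24; 28; 29; 32; 33; 35; 31; 41; 40; 42; 36; 37; 39; 38; 30; 27; 26; 25; 21; 17; 20; 19; 18; 34;
   15; 13; 14; 16; 10; 12; 11; 7; 5; 3; 2]; [:: 0; 1; 4; 3; 5; 6; 8; 22; 24; 28; 29; 32; 23; 15; 13; 14; 16;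
   20; 19; 18; 34; 33; 35; 31; 41; 40; 42; 36; 37; 39; 38; 30; 27; 26; 25; 21; 17; 12; 11; 7; 9; 2]; [:: 0; 1;
   4; 23; 6; 8; 22; 24; 28; 29; 32; 33; 35; 31; 41; 30; 27; 21; 25; 26; 38; 39; 40; 42; 36; 37; 19; 18; 34;
   15; 13; 14; 16; 20; 17; 12; 10; 9; 7; 5; 3; 2]; [:: 0; 1; 4; 23; 24; 22; 27; 30; 28; 29; 32; 33; 35; 31;
   41; 40; 42; 36; 37; 39; 38; 26; 25; 21; 17; 20; 19; 18; 34; 15; 13; 14; 16; 10; 9; 7; 11; 8; 6; 5; 3; 2];
   [:: 0; 1; 4; 23; 15; 34; 18; 14; 16; 10; 9; 7; 11; 12; 17; 20; 19; 37; 36; 42; 40; 39; 38; 26; 25; 21; 27;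
   30; 41; 31; 35; 33; 32; 29; 28; 24; 22; 8; 6; 5; 3; 2]; [:: 0; 1; 13; 15; 34; 18; 19; 37; 36; 42; 40; 39;
   38; 26; 25; 21; 27; 30; 41; 31; 35; 33; 32; 29; 28; 24; 22; 8; 11; 12; 17; 20; 16; 10; 9; 7; 5; 6; 23; 4;
   3; 2]; [:: 0; 1; 13; 14; 16; 10; 9; 7; 5; 6; 8; 11; 12; 17; 21; 27; 22; 24; 28; 30; 41; 40; 42; 36; 37; 39;
   38; 26; 25; 20; 19; 18; 34; 33; 35; 31; 29; 32; 23; 4; 3; 2]; [:: 0; 1; 4; 23; 15; 13; 14; 18; 19; 20; 25;
   21; 27; 26; 38; 30; 41; 31; 35; 42; 40; 39; 37; 36; 34; 33; 32; 29; 28; 24; 22; 17; 12; 10; 9; 7; 11; 8; 6;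
   5; 3; 2]; [:: 0; 1; 4; 3; 5; 6; 8; 22; 24; 28; 30; 41; 40; 42; 36; 37; 39; 38; 26; 27; 21; 25; 20; 19; 18;
   34; 33; 35; 31; 29; 32; 23; 15; 13; 14; 16; 10; 12; 11; 7; 9; 2]; [:: 0; 1; 4; 23; 6; 8; 11; 12; 17; 21;
   27; 22; 24; 28; 30; 41; 40; 39; 38; 26; 25; 20; 19; 37; 36; 42; 35; 31; 29; 32; 33; 34; 15; 13; 14; 16; 10;
   9; 7; 5; 3; 2]; [:: 0; 1; 4; 3; 5; 6; 8; 22; 24; 28; 29; 32; 23; 15; 13; 14; 18; 34; 33; 35; 31; 41; 40;
   42; 36; 37; 39; 38; 30; 27; 26; 25; 21; 17; 20; 16; 10; 12; 11; 7; 9; 2]; [:: 0; 1; 4; 23; 6; 8; 11; 12;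
   17; 21; 25; 26; 27; 22; 24; 28; 29; 32; 33; 35; 31; 41; 30; 38; 39; 40; 42; 36; 37; 19; 18; 34; 15; 13; 14;
   16; 10; 9; 7; 5; 3; 2]; [:: 0; 1; 4; 23; 6; 8; 11; 12; 17; 20; 25; 26; 27; 22; 24; 28; 29; 32; 33; 35; 31;
   41; 30; 38; 39; 40; 42; 36; 37; 19; 18; 34; 15; 13; 14; 16; 10; 9; 7; 5; 3; 2]; [:: 0; 1; 4; 23; 24; 28;
   29; 32; 33; 35; 31; 41; 30; 27; 21; 25; 26; 38; 39; 40; 42; 36; 37; 19; 18; 34; 15; 13; 14; 16; 20; 17; 12;
   10; 9; 7; 11; 8; 6; 5; 3; 2]; [:: 0; 1; 4; 3; 5; 6; 8; 22; 24; 28; 29; 32; 33; 35; 31; 41; 40; 42; 36; 37;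
   39; 38; 30; 27; 26; 25; 21; 17; 20; 19; 18; 34; 15; 13; 14; 16; 10; 12; 11; 7; 9; 2]; [:: 0; 1; 4; 23; 32;
   33; 35; 31; 29; 28; 30; 41; 40; 42; 36; 37; 39; 38; 26; 25; 20; 19; 18; 34; 15; 13; 14; 16; 10; 9; 7; 11;
   12; 17; 21; 27; 22; 8; 6; 5; 3; 2]; [:: 0; 1; 4; 23; 15; 13; 14; 18; 19; 20; 16; 10; 9; 7; 11; 12; 17; 21;
   27; 26; 38; 30; 41; 31; 35; 42; 40; 39; 37; 36; 34; 33; 32; 29; 28; 24; 22; 8; 6; 5; 3; 2]; [:: 0; 1; 4;
   23; 6; 8; 11; 12; 17; 20; 25; 21; 27; 22; 24; 28; 29; 32; 33; 35; 31; 41; 30; 38; 39; 40; 42; 36; 37; 19;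
   18; 34; 15; 13; 14; 16; 10; 9; 7; 5; 3; 2]; [:: 0; 1; 4; 23; 15; 13; 14; 18; 19; 20; 16; 10; 9; 7; 11; 12;
   17; 21; 25; 26; 38; 30; 41; 31; 35; 42; 40; 39; 37; 36; 34; 33; 32; 29; 28; 24; 22; 8; 6; 5; 3; 2]; [:: 0;
   1; 13; 15; 34; 33; 32; 29; 31; 35; 42; 36; 37; 39; 40; 41; 30; 38; 26; 25; 20; 19; 18; 14; 16; 10; 9; 7; 5;
   6; 8; 11; 12; 17; 21; 27; 22; 24; 23; 4; 3; 2]; [:: 0; 1; 4; 23; 32; 33; 35; 31; 41; 40; 42; 36; 37; 39;
   38; 26; 25; 20; 19; 18; 34; 15; 13; 14; 16; 10; 9; 7; 11; 12; 17; 21; 27; 30; 28; 24; 22; 8; 6; 5; 3; 2];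
   [:: 0; 1; 4; 23; 15; 13; 14; 16; 10; 9; 7; 11; 12; 17; 20; 25; 21; 27; 26; 38; 39; 40; 41; 31; 35; 42; 36;
   37; 19; 18; 34; 33; 32; 29; 28; 24; 22; 8; 6; 5; 3; 2]; [:: 0; 1; 4; 23; 15; 13; 14; 16; 10; 9; 7; 11; 12;
   17; 20; 19; 18; 34; 36; 37; 39; 38; 26; 25; 21; 27; 30; 41; 40; 42; 35; 33; 32; 29; 28; 24; 22; 8; 6; 5; 3;
   2]; [:: 0; 1; 4; 23; 15; 13; 14; 16; 10; 9; 7; 11; 12; 17; 21; 27; 30; 41; 40; 42; 36; 37; 39; 38; 26; 25;
   20; 19; 18; 34; 33; 35; 31; 29; 28; 24; 22; 8; 6; 5; 3; 2]; [:: 0; 1; 4; 23; 32; 29; 31; 35; 42; 36; 37;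
   19; 18; 34; 15; 13; 14; 16; 10; 9; 7; 11; 12; 17; 20; 25; 21; 27; 26; 38; 39; 40; 41; 30; 28; 24; 22; 8; 6;
   5; 3; 2]; [:: 0; 1; 4; 23; 15; 13; 14; 18; 19; 20; 16; 10; 9; 7; 11; 12; 17; 21; 25; 26; 27; 30; 38; 39;
   37; 36; 42; 40; 41; 31; 35; 33; 32; 29; 28; 24; 22; 8; 6; 5; 3; 2]; [:: 0; 1; 4; 23; 15; 13; 14; 16; 10; 9;
   7; 11; 12; 17; 20; 19; 18; 34; 33; 32; 29; 31; 41; 40; 42; 36; 37; 39; 38; 26; 25; 21; 27; 30; 28; 24; 22;
   8; 6; 5; 3; 2]; [:: 0; 1; 4; 23; 15; 13; 14; 16; 10; 9; 7; 11; 12; 17; 20; 25; 21; 27; 26; 38; 30; 41; 31;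
   35; 42; 40; 39; 37; 19; 18; 34; 33; 32; 29; 28; 24; 22; 8; 6; 5; 3; 2]; [:: 0; 1; 4; 23; 15; 13; 14; 16;
   10; 9; 7; 11; 12; 17; 20; 19; 18; 34; 36; 42; 40; 39; 38; 26; 25; 21; 27; 30; 41; 31; 35; 33; 32; 29; 28;
   24; 22; 8; 6; 5; 3; 2]; [:: 0; 1; 4; 23; 15; 13; 14; 16; 10; 9; 7; 11; 12; 17; 21; 27; 26; 25; 20; 19; 18;
   34; 33; 32; 29; 31; 35; 42; 36; 37; 39; 40; 41; 30; 28; 24; 22; 8; 6; 5; 3; 2]; [:: 0; 1; 4; 23; 24; 22;
   27; 21; 25; 26; 38; 30; 28; 29; 32; 33; 35; 31; 41; 40; 42; 36; 37; 19; 18; 34; 15; 13; 14; 16; 20; 17; 12;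
   10; 9; 7; 11; 8; 6; 5; 3; 2]; [:: 0; 1; 4; 23; 15; 13; 14; 16; 10; 9; 7; 11; 12; 17; 20; 25; 21; 27; 26;
   38; 39; 37; 19; 18; 34; 36; 42; 35; 33; 32; 29; 31; 41; 30; 28; 24; 22; 8; 6; 5; 3; 2]; [:: 0; 1; 4; 23;
   15; 13; 14; 18; 19; 37; 36; 34; 33; 32; 29; 31; 35; 42; 40; 39; 38; 26; 25; 20; 16; 10; 9; 7; 11; 12; 17;
   21; 27; 30; 28; 24; 22; 8; 6; 5; 3; 2]; [:: 0; 1; 4; 23; 15; 13; 14; 16; 10; 9; 7; 11; 12; 17; 21; 27; 30;
   38; 26; 25; 20; 19; 18; 34; 36; 37; 39; 40; 41; 31; 35; 33; 32; 29; 28; 24; 22; 8; 6; 5; 3; 2]].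
Proof. by vm_compute. Qed.

Lemma solo45_ok : solo_check 45
   [:: (0, 1); (0, 4); (0, 24); (1, 2); (1, 9); (2, 3); (2, 5); (3, 4); (3, 17); (4, 23); (5, 6); (5, 7); (6,
   9); (6, 11); (7, 8); (7, 17); (8, 11); (8, 14); (9, 10); (10, 12); (10, 24); (11, 12); (12, 13); (12, 25);
   (13, 14); (13, 27); (14, 15); (14, 26); (15, 16); (15, 17); (16, 19); (16, 26); (17, 18); (17, 19); (18,
   21); (18, 23); (19, 20); (19, 21); (20, 22); (20, 26); (21, 22); (22, 23); (22, 36); (23, 32); (24, 28);
   (24, 32); (25, 28); (25, 34); (26, 29); (26, 36); (27, 29); (27, 34); (28, 30); (29, 35); (30, 31); (30,
   38); (31, 32); (31, 37); (32, 33); (33, 36); (33, 40); (34, 38); (34, 44); (35, 39); (35, 44); (36, 39);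
   (37, 40); (37, 43); (38, 43); (39, 41); (40, 41); (41, 42); (42, 43); (42, 44)]
   [:: (-33, -29); (-48, -8); (-26, 32); (16, 33); (-3, 2); (-34, 48); (-74, 25); (2, 76); (1, 100); (-62,
   -15); (-56, -59); (-95, 32); (-60, -80); (58, -82); (96, 30); (79, 32); (76, 24); (40, 45); (40, 32); (61,
   28); (70, 17); (54, 24); (60, 13); (27, 4); (-39, -49); (-40, -74); (78, 15); (47, -66); (-36, -65); (60,
   -26); (-23, -60); (-11, -44); (-7, -31); (42, -7); (5, -66); (50, -27); (64, 7); (11, -37); (-1, -62); (57,
   -6); (36, -16); (44, -17); (22, -45); (7, -53); (19, -53)]%coqZ
   [:: 0; 1; 2; 3; 4; 5; 6; 7; 8; 9; 10; 11; 12; 13; 14; 15; 16; 17; 18; 19; 20; 21; 22; 23; 24; 25; 26; 27;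
   28; 29; 30; 31; 32; 33; 34; 35; 36; 37; 38; 39; 40; 41; 42; 43; 44]
   [:: [:: 1; 2; 3; 4; 23; 18; 17; 15; 16; 19; 21; 22; 20; 26; 14; 13; 27; 29; 35; 44; 42; 43; 37; 40; 41; 39;
   36; 33; 32; 31; 30; 38; 34; 25; 28; 24; 10; 12; 11; 8; 7; 5; 6; 9]; [:: 0; 4; 3; 2; 5; 7; 17; 15; 16; 19;
   21; 18; 23; 22; 20; 26; 29; 27; 34; 38; 43; 37; 40; 41; 42; 44; 35; 39; 36; 33; 32; 31; 30; 28; 25; 12; 13;
   14; 8; 11; 6; 9; 10; 24]; [:: 0; 1; 9; 6; 5; 7; 8; 11; 12; 10; 24; 28; 25; 34; 38; 30; 31; 32; 33; 36; 39;
   41; 40; 37; 43; 42; 44; 35; 29; 27; 13; 14; 26; 20; 22; 23; 18; 21; 19; 16; 15; 17; 3; 4]; [:: 0; 1; 2; 5;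
   6; 9; 10; 24; 28; 25; 34; 38; 30; 31; 32; 33; 36; 39; 41; 40; 37; 43; 42; 44; 35; 29; 27; 13; 12; 11; 8; 7;
   17; 15; 14; 26; 16; 19; 20; 22; 21; 18; 23; 4]; [:: 0; 1; 2; 3; 17; 15; 14; 26; 16; 19; 20; 22; 21; 18; 23;
   32; 31; 30; 28; 25; 34; 38; 43; 37; 40; 33; 36; 39; 41; 42; 44; 35; 29; 27; 13; 12; 11; 8; 7; 5; 6; 9; 10;
   24]; [:: 0; 1; 2; 3; 17; 7; 8; 11; 6; 9; 10; 24; 28; 25; 12; 13; 27; 29; 35; 39; 41; 40; 37; 43; 42; 44;
   34; 38; 30; 31; 32; 33; 36; 26; 14; 15; 16; 19; 20; 22; 21; 18; 23; 4]; [:: 0; 1; 9; 10; 24; 28; 25; 34;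
   38; 30; 31; 32; 33; 36; 39; 41; 40; 37; 43; 42; 44; 35; 29; 27; 13; 12; 11; 8; 14; 26; 20; 22; 23; 18; 21;
   19; 16; 15; 17; 7; 5; 2; 3; 4]; [:: 0; 1; 2; 5; 6; 9; 10; 24; 28; 25; 34; 38; 30; 31; 32; 33; 36; 39; 41;
   40; 37; 43; 42; 44; 35; 29; 27; 13; 12; 11; 8; 14; 26; 20; 22; 23; 18; 21; 19; 16; 15; 17; 3; 4]; [:: 0; 1;
   9; 6; 11; 12; 10; 24; 28; 25; 34; 38; 30; 31; 32; 33; 36; 39; 41; 40; 37; 43; 42; 44; 35; 29; 27; 13; 14;
   26; 20; 22; 23; 18; 21; 19; 16; 15; 17; 7; 5; 2; 3; 4]; [:: 0; 1; 2; 3; 4; 23; 18; 21; 19; 20; 22; 36; 33;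
   32; 31; 37; 40; 41; 39; 35; 44; 42; 43; 38; 30; 28; 25; 34; 27; 29; 26; 16; 15; 17; 7; 5; 6; 11; 8; 14; 13;
   12; 10; 24]; [:: 0; 1; 9; 6; 11; 8; 14; 13; 12; 25; 28; 24; 32; 23; 18; 21; 19; 20; 22; 36; 33; 40; 41; 39;
   35; 44; 42; 43; 37; 31; 30; 38; 34; 27; 29; 26; 16; 15; 17; 7; 5; 2; 3; 4]; [:: 0; 1; 2; 5; 6; 9; 10; 24;
   28; 25; 12; 13; 27; 29; 35; 39; 41; 40; 37; 43; 42; 44; 34; 38; 30; 31; 32; 33; 36; 26; 20; 22; 23; 18; 21;
   19; 16; 15; 14; 8; 7; 17; 3; 4]; [:: 0; 1; 2; 5; 7; 8; 11; 6; 9; 10; 24; 28; 25; 34; 38; 30; 31; 32; 33;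
   36; 39; 41; 40; 37; 43; 42; 44; 35; 29; 27; 13; 14; 26; 20; 22; 23; 18; 21; 19; 16; 15; 17; 3; 4]; [:: 0;
   1; 2; 3; 17; 7; 5; 6; 9; 10; 24; 28; 30; 38; 43; 42; 44; 35; 39; 41; 40; 37; 31; 32; 33; 36; 26; 29; 27;
   34; 25; 12; 11; 8; 14; 15; 16; 19; 20; 22; 21; 18; 23; 4]; [:: 0; 1; 2; 5; 7; 8; 11; 6; 9; 10; 24; 28; 25;
   12; 13; 27; 29; 35; 39; 41; 40; 37; 43; 42; 44; 34; 38; 30; 31; 32; 33; 36; 26; 20; 22; 23; 18; 21; 19; 16;
   15; 17; 3; 4]; [:: 0; 1; 2; 5; 6; 9; 10; 24; 28; 25; 34; 27; 29; 35; 44; 42; 41; 39; 36; 33; 40; 37; 43;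
   38; 30; 31; 32; 23; 18; 21; 22; 20; 19; 16; 26; 14; 13; 12; 11; 8; 7; 17; 3; 4]; [:: 0; 1; 2; 5; 7; 8; 11;
   6; 9; 10; 24; 28; 25; 12; 13; 27; 29; 35; 39; 41; 40; 37; 43; 42; 44; 34; 38; 30; 31; 32; 33; 36; 22; 23;
   18; 21; 19; 20; 26; 14; 15; 17; 3; 4]; [:: 0; 1; 2; 3; 4; 23; 18; 21; 19; 20; 22; 36; 33; 32; 31; 37; 40;
   41; 39; 35; 44; 42; 43; 38; 30; 28; 25; 34; 27; 29; 26; 16; 15; 14; 13; 12; 11; 8; 7; 5; 6; 9; 10; 24]; [::
   0; 1; 2; 5; 6; 9; 10; 24; 28; 25; 34; 27; 29; 35; 44; 42; 41; 39; 36; 33; 40; 37; 43; 38; 30; 31; 32; 23;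
   22; 21; 19; 20; 26; 16; 15; 14; 13; 12; 11; 8; 7; 17; 3; 4]; [:: 0; 1; 2; 5; 6; 9; 10; 24; 28; 25; 34; 27;
   29; 35; 44; 42; 41; 39; 36; 33; 40; 37; 43; 38; 30; 31; 32; 23; 18; 21; 22; 20; 26; 16; 15; 14; 13; 12; 11;
   8; 7; 17; 3; 4]; [:: 0; 1; 2; 5; 7; 8; 11; 6; 9; 10; 24; 28; 25; 12; 13; 27; 29; 35; 39; 41; 40; 37; 43;
   42; 44; 34; 38; 30; 31; 32; 33; 36; 22; 23; 18; 21; 19; 16; 26; 14; 15; 17; 3; 4]; [:: 0; 1; 2; 5; 7; 8;
   11; 6; 9; 10; 24; 28; 25; 12; 13; 27; 29; 35; 39; 41; 40; 37; 43; 42; 44; 34; 38; 30; 31; 32; 33; 36; 26;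
   14; 15; 16; 19; 20; 22; 23; 18; 17; 3; 4]; [:: 0; 1; 2; 5; 6; 9; 10; 24; 28; 25; 34; 27; 29; 35; 44; 42;
   41; 39; 36; 33; 40; 37; 43; 38; 30; 31; 32; 23; 18; 21; 19; 20; 26; 16; 15; 14; 13; 12; 11; 8; 7; 17; 3;
   4]; [:: 0; 1; 2; 5; 7; 8; 11; 6; 9; 10; 24; 28; 25; 12; 13; 27; 34; 38; 30; 31; 32; 33; 36; 39; 41; 40; 37;
   43; 42; 44; 35; 29; 26; 14; 15; 16; 19; 20; 22; 21; 18; 17; 3; 4]; [:: 0; 1; 2; 5; 7; 8; 11; 6; 9; 10; 12;
   13; 27; 29; 35; 44; 42; 41; 39; 36; 33; 40; 37; 43; 38; 34; 25; 28; 30; 31; 32; 23; 18; 21; 22; 20; 19; 16;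
   26; 14; 15; 17; 3; 4]; [:: 0; 1; 2; 5; 6; 9; 10; 24; 28; 30; 31; 32; 33; 36; 39; 35; 44; 42; 41; 40; 37;
   43; 38; 34; 27; 29; 26; 20; 22; 23; 18; 21; 19; 16; 15; 14; 13; 12; 11; 8; 7; 17; 3; 4]; [:: 0; 1; 2; 5; 6;
   9; 10; 24; 28; 25; 34; 27; 29; 35; 44; 42; 41; 39; 36; 33; 40; 37; 43; 38; 30; 31; 32; 23; 18; 21; 22; 20;
   19; 16; 15; 14; 13; 12; 11; 8; 7; 17; 3; 4]; [:: 0; 1; 2; 5; 6; 9; 10; 24; 28; 25; 34; 38; 30; 31; 32; 33;
   36; 39; 41; 40; 37; 43; 42; 44; 35; 29; 26; 20; 22; 23; 18; 21; 19; 16; 15; 14; 13; 12; 11; 8; 7; 17; 3;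
   4]; [:: 0; 1; 2; 5; 6; 9; 10; 24; 32; 31; 30; 38; 43; 37; 40; 33; 36; 26; 20; 22; 23; 18; 21; 19; 16; 15;
   14; 13; 27; 29; 35; 39; 41; 42; 44; 34; 25; 12; 11; 8; 7; 17; 3; 4]; [:: 0; 1; 2; 5; 6; 9; 10; 24; 28; 30;
   38; 43; 42; 44; 35; 39; 41; 40; 37; 31; 32; 33; 36; 26; 20; 22; 23; 18; 21; 19; 16; 15; 14; 13; 27; 34; 25;
   12; 11; 8; 7; 17; 3; 4]; [:: 0; 1; 2; 5; 7; 8; 11; 6; 9; 10; 24; 28; 25; 12; 13; 27; 29; 35; 44; 34; 38;
   43; 42; 41; 39; 36; 33; 40; 37; 31; 32; 23; 18; 21; 22; 20; 19; 16; 26; 14; 15; 17; 3; 4]; [:: 0; 1; 2; 5;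
   6; 9; 10; 24; 28; 30; 38; 43; 37; 40; 33; 32; 23; 18; 21; 19; 20; 22; 36; 26; 16; 15; 14; 13; 27; 29; 35;
   39; 41; 42; 44; 34; 25; 12; 11; 8; 7; 17; 3; 4]; [:: 0; 1; 2; 3; 17; 7; 5; 6; 9; 10; 24; 28; 25; 34; 38;
   30; 31; 37; 43; 42; 44; 35; 39; 41; 40; 33; 36; 26; 29; 27; 13; 12; 11; 8; 14; 15; 16; 19; 20; 22; 21; 18;
   23; 4]; [:: 0; 1; 2; 5; 6; 9; 10; 24; 28; 25; 34; 27; 29; 26; 36; 39; 35; 44; 42; 41; 40; 37; 43; 38; 30;
   31; 32; 23; 18; 21; 22; 20; 19; 16; 15; 14; 13; 12; 11; 8; 7; 17; 3; 4]; [:: 0; 1; 2; 5; 7; 8; 11; 6; 9;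
   10; 24; 28; 25; 12; 13; 27; 29; 35; 44; 42; 41; 39; 36; 33; 40; 37; 43; 38; 30; 31; 32; 23; 18; 21; 22; 20;
   19; 16; 26; 14; 15; 17; 3; 4]; [:: 0; 1; 2; 5; 6; 9; 10; 24; 28; 25; 34; 44; 42; 41; 39; 36; 33; 40; 37;
   43; 38; 30; 31; 32; 23; 18; 21; 22; 20; 19; 16; 15; 14; 26; 29; 27; 13; 12; 11; 8; 7; 17; 3; 4]; [:: 0; 1;
   2; 5; 6; 9; 10; 24; 28; 25; 34; 38; 30; 31; 37; 43; 42; 44; 35; 39; 41; 40; 33; 32; 23; 18; 21; 22; 20; 19;
   16; 15; 14; 26; 29; 27; 13; 12; 11; 8; 7; 17; 3; 4]; [:: 0; 1; 2; 5; 6; 9; 10; 24; 28; 25; 34; 27; 29; 35;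
   44; 42; 43; 38; 30; 31; 32; 33; 40; 41; 39; 36; 26; 20; 22; 23; 18; 21; 19; 16; 15; 14; 13; 12; 11; 8; 7;
   17; 3; 4]; [:: 0; 1; 2; 5; 6; 9; 10; 24; 28; 30; 31; 32; 33; 36; 26; 20; 22; 23; 18; 21; 19; 16; 15; 14;
   13; 27; 29; 35; 39; 41; 40; 37; 43; 42; 44; 34; 25; 12; 11; 8; 7; 17; 3; 4]; [:: 0; 1; 2; 5; 6; 9; 10; 24;
   28; 25; 34; 27; 29; 35; 44; 42; 41; 40; 37; 43; 38; 30; 31; 32; 33; 36; 26; 20; 22; 23; 18; 21; 19; 16; 15;
   14; 13; 12; 11; 8; 7; 17; 3; 4]; [:: 0; 1; 2; 5; 6; 9; 10; 24; 28; 30; 38; 43; 37; 31; 32; 33; 36; 26; 20;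
   22; 23; 18; 21; 19; 16; 15; 14; 13; 27; 29; 35; 39; 41; 42; 44; 34; 25; 12; 11; 8; 7; 17; 3; 4]; [:: 0; 1;
   2; 5; 7; 8; 11; 6; 9; 10; 24; 28; 25; 12; 13; 27; 29; 35; 39; 36; 33; 40; 37; 43; 42; 44; 34; 38; 30; 31;
   32; 23; 18; 21; 22; 20; 19; 16; 26; 14; 15; 17; 3; 4]; [:: 0; 1; 2; 5; 6; 9; 10; 24; 28; 30; 38; 43; 37;
   31; 32; 33; 40; 41; 39; 36; 26; 20; 22; 23; 18; 21; 19; 16; 15; 14; 13; 27; 29; 35; 44; 34; 25; 12; 11; 8;
   7; 17; 3; 4]; [:: 0; 1; 2; 5; 6; 9; 10; 24; 28; 25; 34; 38; 30; 31; 37; 40; 41; 42; 44; 35; 39; 36; 33; 32;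
   23; 18; 21; 22; 20; 19; 16; 15; 14; 26; 29; 27; 13; 12; 11; 8; 7; 17; 3; 4]; [:: 0; 1; 2; 5; 6; 9; 10; 24;
   28; 30; 38; 43; 42; 41; 40; 37; 31; 32; 33; 36; 39; 35; 29; 26; 20; 22; 23; 18; 21; 19; 16; 15; 14; 13; 27;
   34; 25; 12; 11; 8; 7; 17; 3; 4]].
Proof. by vm_compute. Qed.

Theorem theorem4p3 (R : realType) (n : nat) (hn : (42 <= n)%N) :
  exists G : sgraph, [/\ #|G| = n, planar R G & hypohamiltonian G].
Proof.
case: (boolP (n \in [:: 43; 45])) => [|small].
  by rewrite !inE => /orP[] /eqP->; [exact: solo_checkP solo43_ok | exact: solo_checkP solo45_ok].
have from b : base_check b -> inner_order b + 4 <= n -> n = inner_order b %[mod 4] ->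
    exists G : sgraph, [/\ #|G| = n, planar R G & hypohamiltonian G].
  (* [ladder d] has [d.+1] layers, hence the predecessor; the quotient is positive because [n] is at
     least the order of the base. *)
  move=> bok bn bmod; have [G [cG pG hG]] := base_checkP R ((n - inner_order b) %/ 4).-1 bok.
  by exists G; split=> //; rewrite cG; lia.
have : n %% 4 < 4 by rewrite ltn_mod.
(* In the residue classes 1 and 3 the bases have orders 49 and 47; the smaller orders 45 and 43 have
   been settled above. *)
case E: (n %% 4) => [|[|[|[|//]]]] _.
- by apply: (from _ base44_ok); rewrite // [inner_order _]/=; lia.
- by apply: (from _ base49_ok); rewrite // [inner_order _]/=; move: small; rewrite !inE; lia.
- by apply: (from _ base42_ok); rewrite // [inner_order _]/=; lia.
by apply: (from _ base47_ok); rewrite // [inner_order _]/=; move: small; rewrite !inE; lia.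
Qed.
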